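(* Suppose $v\in \mathcal{D}^{1,p}(\mathbb{R}^n)$. Then there is an extremal $u\in \mathcal{D}^{1,p}(\mathbb{R}^n)$ such that $$\left(\frac{C_*}{2}\right)^p\|Du-Dv\|^p_{L^p(\mathbb{R}^n)}+[v]^p_{C^{1-n/p}(\mathbb{R}^n)}\le C_*^p\|Dv\|^p_{L^p(\mathbb{R}^n)}$$ when $2<p<\infty$, and $$\left(\frac{1}{2}\right)^{\frac{p}{p-1}}\|u'-v'\|^{\frac{p}{p-1}}_{L^p(\mathbb{R})}+[v]^{\frac{p}{p-1}}_{C^{1-1/p}(\mathbb{R})}\le \|v'\|^{\frac{p}{p-1}}_{L^p(\mathbb{R})}$$ when $1<p\le 2$ (in which case necessarily $n=1$).
   Context: Throughout, $n\ge 1$ is an integer and $n<p<\infty$. $\mathcal{D}^{1,p}(\mathbb{R}^n)$ is the space of $u\in L^1_{\mathrm{loc}}(\mathbb{R}^n)$ whose weak first-order partial derivatives all belong to $L^p(\mathbb{R}^n)$. Every such $u$ has a Hölder continuous representative and is always identified with it. Put $[u]_{C^{1-n/p}(\mathbb{R}^n)}:=\sup_{x\ne y}\frac{|u(x)-u(y)|}{|x-y|^{1-n/p}}$ and $\|Du\|_{L^p(\mathbb{R}^n)}:=\left(\int_{\mathbb{R}^n}|Du|^p\,dx\right)^{1/p}$. Morrey's inequality says there is a finite constant $C$ with $[u]_{C^{1-n/p}(\mathbb{R}^n)}\le C\|Du\|_{L^p(\mathbb{R}^n)}$ for all $u\in\mathcal{D}^{1,p}(\mathbb{R}^n)$; $C_*$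 denotes the sharp (smallest) such constant. An extremal is a function $u\in\mathcal{D}^{1,p}(\mathbb{R}^n)$ with $[u]_{C^{1-n/p}(\mathbb{R}^n)}=C_*\|Du\|_{L^p(\mathbb{R}^n)}$ (constants are allowed). *)

(* Defs.v *)
From HB Require Import structures.
From mathcomp Require Import all_boot all_order all_algebra.
From mathcomp Require Import all_classical all_reals all_analysis.

Set Implicit Arguments.
Unset Strict Implicit.
Unset Printing Implicit Defensive.

Import Order.TTheory GRing.Theory Num.Theory.
Import numFieldNormedType.Exports.

Local Open Scope classical_set_scope.
Local Open Scope ring_scope.

(* The sigma-algebra on row vectors is generated by the coordinate maps, as the
   library does for tuples; it is the Borel sigma-algebra of 'rV[R]_n. *)
Definition measure_rV_display : measure_display -> measure_display.
Proof. exact. Qed.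

Section measurable_rV.
Context {R : realType} (n : nat).

Let coors : 'I_n -> 'rV[R]_n -> measurableTypeR R := fun i x => x 0 i.

Let rV_set0 : g_sigma_preimage coors set0.
Proof. exact: sigma_algebra0. Qed.

Let rV_setC A : g_sigma_preimage coors A -> g_sigma_preimage coors (~` A).
Proof. exact: sigma_algebraC. Qed.

Let rV_bigcup (F : _^nat) : (forall i, g_sigma_preimage coors (F i)) ->
  g_sigma_preimage coors (\bigcup_i (F i)).
Proof. exact: sigma_algebra_bigcup. Qed.

HB.instance Definition _ := @isMeasurable.Build
  (measure_rV_display default_measure_display)
  'rV[R]_n (g_sigma_preimage coors) rV_set0 rV_setC rV_bigcup.

Lemma measurable_coord_rV (i : 'I_n) :
  measurable_fun [set: 'rV[R]_n] (fun x => x 0 i : measurableTypeR R).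
Proof.
move=> _ Y mY; rewrite setTI; apply: sub_sigma_algebra => /=.
rewrite -bigcup_seq/=; exists i => /=; first by rewrite mem_index_enum.
by exists Y => //; rewrite setTI.
Qed.

Lemma measurable_fun_rVP d (T : measurableType d) (f : T -> 'rV[R]_n) :
  (forall i, measurable_fun [set: T] (fun x => f x 0 i : measurableTypeR R)) ->
  measurable_fun [set: T] f.
Proof.
move=> mf _ A mA; rewrite setTI; move: A mA.
suff h : <<s \big[setU/set0]_(i < n)
    preimage_set_system setT (coors i) measurable >> `<=`
    [set A | measurable (f @^-1` A)] by [].
apply: smallest_sub.
  split=> /=.
  - by rewrite preimage_set0.
  - by move=> A mA; rewrite setTD preimage_setC; exact: measurableC.
  - by move=> F mF; rewrite preimage_bigcup; exact: bigcup_measurable.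
rewrite -bigcup_seq/=; apply: bigcup_sub => i _ A [B mB <-] /=.
by rewrite setTI -[X in measurable X]setTI; exact: mf.
Qed.

End measurable_rV.

Section lebesgue_measure_rV.
Context {R : realType}.

(* ['rV[R]_(1 + n)] is convertible to ['rV[R]_n.+1]. *)
Definition cons_rV n (xy : measurableTypeR R * 'rV[R]_n) : 'rV[R]_n.+1 :=
  row_mx (const_mx xy.1 : 'rV[R]_1) xy.2.

Lemma measurable_cons_rV n : measurable_fun setT (@cons_rV n).
Proof.
apply: measurable_fun_rVP => i.
have -> : (fun x : measurableTypeR R * 'rV[R]_n =>
    cons_rV x 0 i : measurableTypeR R) =
  match fintype.split (i : 'I_(1 + n)) with
  | inl _ => fst | inr j => (fun x : 'rV[R]_n => x 0 j : measurableTypeR R) \o snd end.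
  apply/funext => x; rewrite /cons_rV mxE.
  by case: fintype.split => j //=; rewrite mxE.
case: fintype.split => j; first exact: measurable_fst.
apply: measurableT_comp; last exact: measurable_snd.
exact: measurable_coord_rV.
Qed.

Definition uncons_rV n (x : 'rV[R]_n.+1) : measurableTypeR R * 'rV[R]_n :=
  ((x : 'rV[R]_(1 + n)) 0 (lshift n 0), rsubmx (x : 'rV[R]_(1 + n))).

Lemma cons_rVK n : cancel (@cons_rV n) (@uncons_rV n).
Proof.
by move=> [x y]; rewrite /uncons_rV /cons_rV row_mxKr row_mxEl mxE.
Qed.

Lemma measurable_uncons_rV n : measurable_fun setT (@uncons_rV n).
Proof.
apply/measurable_fun_pairP; split; first exact: measurable_coord_rV.
apply: measurable_fun_rVP => i.
rewrite (_ : (fun x => _) = fun x : 'rV[R]_n.+1 => x 0 (rshift 1 i)).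
  exact: measurable_coord_rV.
by apply/funext => x /=; rewrite mxE.
Qed.

Section lebesgue_rV_step.
Local Open Scope ereal_scope.
Context n (mu : {sigma_finite_measure set 'rV[R]_n -> \bar R}).

Definition lebesgue_rV_step : set 'rV[R]_n.+1 -> \bar R :=
  pushforward (lebesgue_measure \x mu) (@cons_rV n).

Let mcons := @measurable_cons_rV n.

Let step0 : lebesgue_rV_step set0 = 0.
Proof. exact: measure0. Qed.

Let step_ge0 A : 0 <= lebesgue_rV_step A.
Proof. exact: measure_ge0. Qed.

Let step_sigma_additive : semi_sigma_additive lebesgue_rV_step.
Proof. exact: measure_semi_sigma_additive. Qed.

HB.instance Definition _ := isMeasure.Build _ _ _ lebesgue_rV_step
  step0 step_ge0 step_sigma_additive.

Let step_sigma_finite : sigma_finite setT lebesgue_rV_step.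
Proof.
have /sigma_finiteP[F [TF ndF Foo]] := sigma_finiteT (@lebesgue_measure R).
have /sigma_finiteP[G [TG ndG Goo]] := sigma_finiteT mu.
exists (fun k => @uncons_rV n @^-1` (F k `*` G k)).
  rewrite -preimage_bigcup (_ : \bigcup_k _ = setT) ?preimage_setT//.
  apply/seteqP; split=> // -[x y] _.
  have [i _ Fix] : (\bigcup_k F k) x by rewrite -TF.
  have [j _ Gjy] : (\bigcup_k G k) y by rewrite -TG.
  exists (maxn i j) => //; split => /=.
    by move: x Fix; exact/subsetPset/ndF/leq_maxl.
  by move: y Gjy; exact/subsetPset/ndG/leq_maxr.
move=> k; have [mF Fk] := Foo k; have [mG Gk] := Goo k; split.
  rewrite -[X in measurable X]setTI; apply: measurable_uncons_rV => //.
  exact: measurableX.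
rewrite /lebesgue_rV_step /pushforward -comp_preimage.
rewrite (_ : _ \o _ = id); last by apply/funext => x; exact: cons_rVK.
rewrite preimage_id product_measure1E// lte_mul_pinfty// ge0_fin_numE//.
Qed.

HB.instance Definition _ := Measure_isSigmaFinite.Build _ _ _ lebesgue_rV_step
  step_sigma_finite.

End lebesgue_rV_step.

(* R^0 is a point, and R^(n+1) = R * R^n carries the product measure. *)
Fixpoint lebesgue_rV n : {sigma_finite_measure set 'rV[R]_n -> \bar R} :=
  match n with
  | 0 => \d_(0 : 'rV[R]_0)
  | n'.+1 => lebesgue_rV_step (lebesgue_rV n')
  end.

End lebesgue_measure_rV.

Section sobolev.
Context {R : realType} {n : nat}.
Implicit Types (u g phi : 'rV[R]_n -> R) (G : 'rV[R]_n -> 'rV[R]_n).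

Local Notation mu := (@lebesgue_rV R n).

(* The library norm of 'rV[R]_n is the sup norm. *)
Definition enorm (x : 'rV[R]_n) : R := Num.sqrt (\sum_(i < n) x 0 i ^+ 2).

Definition locally_integrable_rV u :=
  measurable_fun setT u /\
  forall K : set 'rV[R]_n, compact K ->
    (\int[mu]_(x in K) `|u x|%:E < +oo)%E.

Definition iter_partial (s : seq 'I_n) phi : 'rV[R]_n -> R :=
  foldr (fun i f x => 'D_('e_i) f x) phi s.

(* C^oo: all iterated partial derivatives exist and are continuous. *)
Definition smooth phi :=
  forall s : seq 'I_n, continuous (iter_partial s phi) /\
    forall (i : 'I_n) (x : 'rV[R]_n), derivable (iter_partial s phi) x 'e_i.

Definition test_function phi :=
  smooth phi /\ compact (closure [set x | phi x != 0]).

Definition is_weak_partial (i : 'I_n) u g :=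
  locally_integrable_rV g /\
  forall phi, test_function phi ->
    \int[mu]_x (u x * 'D_('e_i) phi x) = - \int[mu]_x (g x * phi x).

(* Determined up to a null set when u has a weak i-th partial derivative;
   meaningless otherwise. *)
Definition weak_partial (i : 'I_n) u : 'rV[R]_n -> R :=
  get [set g | is_weak_partial i u g].

Definition weak_grad u (x : 'rV[R]_n) : 'rV[R]_n :=
  \row_(i < n) weak_partial i u x.

Definition Lnorm_rV (p : R) G : \bar R := Lnorm mu p%:E (fun x => (enorm (G x))%:E).

(* D^{1,p}(R^n) for n < p: continuity selects the (unique) continuous
   representative of the a.e. class. *)
Definition D1p (p : R) u :=
  [/\ locally_integrable_rV u, continuous u &
      forall i : 'I_n, exists2 g, is_weak_partial i u g & g \in Lfun mu p%:E].

Definition holder_seminorm (a : R) u : \bar R :=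
  ereal_sup [set t | exists x y : 'rV[R]_n,
    x != y /\ t = (`|u x - u y| / enorm (x - y) `^ a)%:E].

Definition morrey_seminorm (p : R) u : \bar R :=
  holder_seminorm (1 - n%:R / p) u.

End sobolev.

(* Morrey's inequality says that this set is nonempty; being bounded below by 0
   when n > 0, it then has a genuine infimum (inf is 0 for an empty set). *)
Definition morrey_const {R : realType} (n : nat) (p : R) : R :=
  inf [set C : R | forall u : 'rV[R]_n -> R, D1p p u ->
    (morrey_seminorm p u <= C%:E * Lnorm_rV p (weak_grad u))%E].

Definition extremal {R : realType} {n : nat} (p : R) (u : 'rV[R]_n -> R) :=
  D1p p u /\
  morrey_seminorm p u =
    ((morrey_const n p)%:E * Lnorm_rV p (weak_grad u))%E.

(* Main.v *)
Require Import Defs.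
From HB Require Import structures.
From mathcomp Require Import all_boot all_order all_algebra.
From mathcomp Require Import all_classical all_reals all_analysis.
From mathcomp Require Import measurable_realfun ring lra.

Set Implicit Arguments.
Unset Strict Implicit.
Unset Printing Implicit Defensive.

Import Order.TTheory GRing.Theory Num.Theory.
Import numFieldNormedType.Exports.

Local Open Scope classical_set_scope.
Local Open Scope ring_scope.

(* Fix two points where [v] takes different values. Among the functions agreeing with
   [v] at these two points there is one, [u], of least gradient norm: by Clarkson's
   inequality the gradients of a minimizing sequence converge in [L^p], and by
   Morrey's inequality the functions themselves converge pointwise. Similarities of R^n
   carry any pair of points to any other one, so [u] is extremal and attains its Hoelder
   seminorm at the chosen pair. Since (u + v)/2 is a competitor of [u], Clarkson's
   inequality for [Du] and [Dv] gives, with s = p or s = p/(p-1) and [t] the Hoelder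
   quotient of [v] at the pair, [t^s + 2 (C_*/2)^s |Du - Dv|^s <= C_*^s |Dv|^s]. The
   quotient [t] need not be [[v]], which may not be attained; but unless [v] is itself
   extremal [|Du - Dv|] is bounded below independently of the pair, so that for a nearly
   maximizing pair the spare factor 2 pays for the difference.

   Morrey's inequality is obtained by comparing averages of [u] against tensor products
   of bumps: two such products whose factors have equal integrals differ by a sum of
   partial derivatives of test functions, so the averages of [u] differ by at most a
   multiple of [|Du|]; dyadic rescaling then reaches the values of [u] at points. *)

(** * Lebesgue measure on row vectors *)

Section rV_fubini.
Context {R : realType}.
Local Open Scope ereal_scope.

(** The behaviour of Lebesgue measure under similarities is derived without determinants: a Fubini
    argument shows that an invertible linear map changes the measure of all measurable sets by one
    factor, which is then read off a convenient set, the ball for rotations and the cube for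
    dilations. Gradients are carried as explicit witnesses beside the functions, since [weak_grad]
    is determined only almost everywhere. No nonconstant function of finite energy is constructed: a
    nonconstant [v] supplies the competitor that starts the minimization, and a constant [v] is its
    own extremal whatever C_* is. The lower bound that absorbs the slack is |Dv| - [v]/C_*, because
    |Du| = t/C_* and t <= [v]; it is positive unless [v] is extremal. For p < 2 the pointwise
    Clarkson inequality is proved for real numbers only, which suffices because n < p forces n = 1.
    The second estimate has 1 in place of C_*; it rests on C_* <= 1 in dimension one, obtained by
    stretching an interval so far that the width of the averaging bumps at its ends no longer
    matters. *)

Lemma ge0_integral_lebesgue_rVS n (f : 'rV[R]_n.+1 -> \bar R) :
  measurable_fun setT f -> (forall x, 0 <= f x) ->
  \int[lebesgue_rV n.+1]_x f x =
  \int[@lebesgue_measure R]_t \int[lebesgue_rV n]_y f (cons_rV (t, y)).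
Proof.
move=> mf f0.
rewrite -[LHS]/(\int[pushforward (@lebesgue_measure R \x lebesgue_rV n) (@cons_rV R n)]_x f x).
rewrite (ge0_integral_pushforward (@measurable_cons_rV R n))//=.
rewrite preimage_setT fubini_tonelli1//.
by apply: measurableT_comp => //; exact: measurable_cons_rV.
Qed.

Lemma ge0_integral_lebesgue_rV0 (f : 'rV[R]_0 -> \bar R) :
  measurable_fun setT f -> (forall x, 0 <= f x) ->
  \int[lebesgue_rV 0]_x f x = f 0%R.
Proof.
move=> mf f0 /=; rewrite integral_dirac//.
by rewrite diracE in_setT mul1e.
Qed.

Lemma ge0_integral_lebesgue_shift (f : R -> \bar R) (a : R) :
  measurable_fun setT f -> (forall x, 0 <= f x) ->
  \int[@lebesgue_measure R]_x f (x + a)%R = \int[@lebesgue_measure R]_x f x.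
Proof.
move=> mf f0; pose s (x : measurableTypeR R) : measurableTypeR R := (x + a)%R.
have ms : measurable_fun setT s by exact: measurable_funD.
transitivity (\int[pushforward (@lebesgue_measure R) s]_x f x).
  by rewrite (ge0_integral_pushforward ms).
apply: eq_measure_integral => A mA _.
apply/esym/lebesgue_measure_unique => //= _ [[b c]] _ <-.
rewrite /pushforward (_ : _ @^-1` _ = `](b - a)%R, (c - a)%R]%classic).
  rewrite !lebesgue_measure_itv/= !lte_fin ltrD2r; case: ifPn => // _.
  by rewrite -!EFinB; congr EFin; ring.
by apply/seteqP; split => x /=; rewrite !in_itv/= ltrBlDr lerBrDr.
Qed.

End rV_fubini.

(** * Translations and linear maps *)

Section rV_invariance.
Context {R : realType}.

Lemma measurable_rVD d (T : measurableType d) n (f g : T -> 'rV[R]_n) :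
  measurable_fun setT f -> measurable_fun setT g ->
  measurable_fun setT (fun x => f x + g x).
Proof.
move=> mf mg; apply: measurable_fun_rVP => i.
rewrite (_ : (fun x => _) = fun x => f x 0 i + g x 0 i).
  by apply: measurable_funD; exact: measurableT_comp (measurable_coord_rV i) _.
by apply/funext => x; rewrite mxE.
Qed.

Lemma measurable_rV_mulmx d (T : measurableType d) m n (f : T -> 'rV[R]_m)
    (A : 'M[R]_(m, n)) :
  measurable_fun setT f -> measurable_fun setT (fun x => f x *m A).
Proof.
move=> mf; apply: measurable_fun_rVP => i.
rewrite (_ : (fun x => _) = fun x => \sum_j f x 0 j * A j i).
  apply: measurable_sum => j; apply: measurable_funM => //.
  exact: measurableT_comp (measurable_coord_rV j) _.
by apply/funext => x; rewrite mxE.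
Qed.

Lemma measurable_rVN d (T : measurableType d) n (f : T -> 'rV[R]_n) :
  measurable_fun setT f -> measurable_fun setT (fun x => - f x).
Proof.
move=> mf; apply: measurable_fun_rVP => i.
rewrite (_ : (fun x => _) = fun x => - f x 0 i).
  by apply: measurableT_comp => //; exact: measurableT_comp (measurable_coord_rV i) _.
by apply/funext => x; rewrite mxE.
Qed.

Lemma cons_rVD n (t s : R) (y z : 'rV[R]_n) :
  cons_rV (t, y) + cons_rV (s, z) = cons_rV (t + s, y + z).
Proof.
by apply/rowP => i; rewrite !mxE /=; case: fintype.split => j; rewrite !mxE.
Qed.

Lemma measurable_cons_rVr n (t : R) :
  measurable_fun setT (fun y : 'rV[R]_n => cons_rV (t, y)).
Proof.
apply: measurable_fun_rVP => i.
rewrite (_ : (fun x => _) = match fintype.split (i : 'I_(1 + n)) with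
  | inl _ => cst t | inr j => fun y : 'rV[R]_n => y 0 j end).
  by case: fintype.split => j; [exact: measurable_cst|exact: measurable_coord_rV].
by apply/funext => x; rewrite mxE; case: fintype.split => j; rewrite ?mxE.
Qed.

Lemma uncons_rVK n : cancel (@uncons_rV R n) (@cons_rV R n).
Proof.
move=> x; apply/rowP => i; rewrite !mxE /=.
by case: (@splitP 1 n i) => j ij; rewrite !mxE; congr (x _ _); apply/val_inj => /=;
  rewrite ?ord1 ij ?ord1.
Qed.

Local Open Scope ereal_scope.

Lemma ge0_integral_rV_shift n (f : 'rV[R]_n -> \bar R) (a : 'rV[R]_n) :
  measurable_fun setT f -> (forall x, 0 <= f x) ->
  \int[lebesgue_rV n]_x f (x + a)%R = \int[lebesgue_rV n]_x f x.
Proof.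
elim: n f a => [|n IH] f a mf f0.
  by congr (integral _ _ _); apply/funext => x; rewrite !thinmx0.
have ma : measurable_fun setT (fun x : 'rV[R]_n.+1 => f (x + a)%R).
  by apply: measurableT_comp => //; exact: measurable_rVD.
have mfc : measurable_fun setT (fun ty : measurableTypeR R * 'rV[R]_n => f (cons_rV ty)).
  by apply: measurableT_comp => //; exact: measurable_cons_rV.
rewrite (ge0_integral_lebesgue_rVS ma (fun=> f0 _)) (ge0_integral_lebesgue_rVS mf f0).
rewrite -[a]uncons_rVK; move: (uncons_rV a) => [a0 a'].
rewrite -(ge0_integral_lebesgue_shift a0 (f := fun t => \int[lebesgue_rV n]_y f (cons_rV (t, y)))); last 2 first.
- exact: (measurable_fun_fubini_tonelli_F (m2 := lebesgue_rV n) (fun ty => f (cons_rV ty)) mfc (fun=> f0 _)).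
- by move=> x; exact: integral_ge0.
apply: eq_integral => t _; rewrite -(IH (fun y => f (cons_rV ((t + a0)%R, y))) a'); last 2 first.
- apply: (measurableT_comp mf).
  exact: measurable_cons_rVr.
- by [].
by apply: eq_integral => y _; rewrite cons_rVD.
Qed.

(** Integrate [a x * b (y *m M)] over both variables: translating [x] by [y *m M] and then [y] by
    [- x *m M'] moves the matrix from [b] to [a]. Consequently taking preimages under [M] multiplies
    all measures by one factor, which any convenient [B] computes. The symmetry of [B] turns
    [b (y *m M - x)] into a translate of [b]. *)
Lemma lebesgue_rV_mulmx_swap n (M M' : 'M[R]_n) (A B : set 'rV[R]_n) :
  M' *m M = 1%:M -> measurable A -> measurable B ->
  (forall x, B x -> B (- x)%R) ->
  lebesgue_rV n A * lebesgue_rV n ((mulmx^~ M) @^-1` B) =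
  lebesgue_rV n ((mulmx^~ M) @^-1` A) * lebesgue_rV n B.
Proof.
move=> M'M mA mB symB; set mu := lebesgue_rV n.
pose a x : \bar R := (\1_A x)%:E; pose b x : \bar R := (\1_B x)%:E.
have a0 x : 0 <= a x by rewrite lee_fin.
have b0 x : 0 <= b x by rewrite lee_fin.
have ma : measurable_fun setT a by exact/measurable_EFinP.
have mb : measurable_fun setT b by exact/measurable_EFinP.
have mT : measurable_fun setT (mulmx^~ M : 'rV[R]_n -> 'rV[R]_n).
  exact: measurable_rV_mulmx.
have symb x : b (- x)%R = b x.
  rewrite /b !indicE; congr ((nat_of_bool _)%:R%:E); apply/idP/idP; rewrite !inE; last exact: symB.
  by move=> /symB; rewrite opprK.
have int1 C : measurable C -> mu C = \int[mu]_x (\1_C x)%:E.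
  by move=> mC; rewrite integral_indic// setIT.
have mpre C : measurable C -> measurable ((mulmx^~ M : 'rV[R]_n -> 'rV[R]_n) @^-1` C).
  by move=> mC; rewrite -[X in measurable X]setTI; exact: mT.
have intT C : measurable C ->
    mu ((mulmx^~ M) @^-1` C) = \int[mu]_x (\1_C (x *m M)%R)%:E.
  by move=> mC; rewrite int1//; exact: mpre.
rewrite !intT// !int1//.
have maT : measurable_fun setT (fun y => a (y *m M)%R) by exact: measurableT_comp.
have mbT : measurable_fun setT (fun y => b (y *m M)%R) by exact: measurableT_comp.
have Ia : 0 <= \int[mu]_x a x by exact: integral_ge0.
have Ib : 0 <= \int[mu]_x b x by exact: integral_ge0.
rewrite -/a -/b.
transitivity (\int[mu]_y \int[mu]_x (a x * b (y *m M)%R)).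
  rewrite -(ge0_integralZl mu measurableT mbT (fun _ _ => b0 _) Ia).
  apply: eq_integral => y _.
  by rewrite (ge0_integralZr mu measurableT ma (fun _ _ => a0 _) (b0 _)).
transitivity (\int[mu]_y \int[mu]_x (a (x + y *m M)%R * b (y *m M)%R)).
  apply: eq_integral => y _.
  rewrite (ge0_integral_rV_shift (f := fun x => a x * b (y *m M)%R))//.
    by apply: emeasurable_funM.
  by move=> x; exact: mule_ge0.
have mTsnd : measurable_fun setT (fun xy : 'rV[R]_n * 'rV[R]_n => xy.2 *m M).
  by apply: measurable_rV_mulmx; exact: measurable_snd.
rewrite -(fubini_tonelli (m1 := mu) (m2 := mu) 
  (fun xy : 'rV[R]_n * 'rV[R]_n => a (xy.1 + xy.2 *m M)%R * b (xy.2 *m M)%R)); last 2 first.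
- apply: emeasurable_funM; apply: measurableT_comp => //.
  by apply: measurable_rVD.
- by move=> x; exact: mule_ge0.
transitivity (\int[mu]_x \int[mu]_y (a (y *m M)%R * b (y *m M - x)%R)).
  apply: eq_integral => x _.
  rewrite -[RHS](ge0_integral_rV_shift (x *m M')).
  - apply: eq_integral => y _ /=.
    by rewrite mulmxDl -mulmxA M'M mulmx1 addrK (addrC x).
  - apply: emeasurable_funM; apply: measurableT_comp => //.
    by apply: measurable_rVD.
  - by move=> y; exact: mule_ge0.
rewrite (fubini_tonelli (m1 := mu) (m2 := mu) 
  (fun xy : 'rV[R]_n * 'rV[R]_n => a (xy.2 *m M)%R * b (xy.2 *m M - xy.1)%R)); last 2 first.
- apply: emeasurable_funM; apply: measurableT_comp => //.
  by apply: measurable_rVD => //; apply: measurable_rVN.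
- by move=> x; exact: mule_ge0.
rewrite -(ge0_integralZr mu measurableT maT (fun _ _ => a0 _) Ib).
apply: eq_integral => y _ /=.
have mby : measurable_fun setT (fun x : 'rV[R]_n => b (y *m M - x)%R).
  by apply: measurableT_comp => //; apply: measurable_rVD => //; exact: measurable_rVN.
rewrite (ge0_integralZl mu measurableT mby (fun _ _ => b0 _) (a0 _)); congr (_ * _).
rewrite -[RHS](ge0_integral_rV_shift (- (y *m M))%R mb b0).
by apply: eq_integral => x _; rewrite -symb opprB.
Qed.

End rV_invariance.

(** * Borel sets and cubes *)

Section rV_borel.
Context {R : realType}.

Definition prod_rV n (A : 'I_n -> set R) : set 'rV[R]_n :=
  [set x | forall i, A i (x 0 i)].

Lemma measurable_prod_rV n (A : 'I_n -> set R) :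
  (forall i, measurable (A i)) -> measurable (prod_rV A).
Proof.
move=> mA.
rewrite (_ : prod_rV A = \bigcap_(i in [set: 'I_n]) ((fun x : 'rV[R]_n => x 0 i) @^-1` A i)).
  apply: fin_bigcap_measurable => // i _.
  by rewrite -[X in measurable X]setTI; exact: (measurable_coord_rV i measurableT (mA i)).
by apply/seteqP; split => [x Ax i _|x Ax i]; [exact: Ax|exact: (Ax i)].
Qed.

Lemma rV_ballP n (x y : 'rV[R]_n) (e : R) :
  ball x e y <-> 0 < e /\ forall i, `|x 0 i - y 0 i| < e.
Proof.
split=> [[e0 h]|[e0 h]]; first by split => // i; exact: h.
by split => // i j; rewrite ord1; exact: h.
Qed.

(** The boxes with rational centre and half-width 1/(k+1) are countably many, and every point of an
    open set lies in one that is still contained in the set. This links the topology to a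
    sigma-algebra defined by coordinates. *)
Lemma open_measurable_rV n (A : set 'rV[R]_n) : open A -> measurable A.
Proof.
move=> oA.
pose C (qk : 'rV[rat]_n * nat) : set 'rV[R]_n :=
  prod_rV (fun i => `](ratr (qk.1 0 i) - qk.2.+1%:R^-1), (ratr (qk.1 0 i) + qk.2.+1%:R^-1)[%classic).
have -> : A = \bigcup_qk (if `[< C qk `<=` A >] then C qk else set0).
  apply/seteqP; split => [x Ax|x [qk _]]; last by case: asboolP => // CA; exact: CA.
  have /nbhs_ballP[e /= e0 xeA] : nbhs x A by exact: open_nbhs_nbhs.
  have [k ke] : exists k, k.+1%:R^-1 < e / 2.
    have [k _ kh] := near_infty_natSinv_lt (PosNum (divr_gt0 e0 (ltr0n _ 2))).
    by exists k; apply: kh => /=.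
  have hk : 0 < k.+1%:R^-1 :> R by [].
  have qi (i : 'I_n) : exists q : rat, `|x 0 i - ratr q| < k.+1%:R^-1.
    have [|q] := @rat_in_itvoo R (x 0 i - k.+1%:R^-1) (x 0 i + k.+1%:R^-1);
      first by rewrite ltrBlDr -addrA ltrDl addr_gt0.
    by rewrite in_itv/= => /andP[q1 q2]; exists q; rewrite ltr_distlC q1 q2.
  pose q : 'rV[rat]_n := \row_i sval (cid (qi i)).
  have hq i : `|x 0 i - ratr (q 0 i)| < k.+1%:R^-1 by rewrite mxE; case: cid.
  exists (q, k) => //; rewrite asboolT.
    by move=> i /=; rewrite in_itv/= -ltr_distl.
  move=> y Cy; apply: xeA; apply/rV_ballP; split => // i.
  have := Cy i; rewrite /= in_itv/= -ltr_distl distrC => Cyi.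
  rewrite (le_lt_trans (ler_distD (ratr (q 0 i)) _ _))// [ltRHS]splitr ltrD//.
    exact: lt_trans (hq i) ke.
  exact: lt_trans ke.
apply: countable_bigcupT_measurable => // qk; case: ifPn => // _.
by apply: measurable_prod_rV => i; exact: measurable_itv.
Qed.

Lemma closed_measurable_rV n (A : set 'rV[R]_n) : closed A -> measurable A.
Proof. by move/closed_openC/open_measurable_rV/measurableC; rewrite setCK. Qed.

Lemma compact_measurable_rV n (A : set 'rV[R]_n) : compact A -> measurable A.
Proof.
by move/(compact_closed (@norm_hausdorff _ _)); exact: closed_measurable_rV.
Qed.

Lemma continuous_measurable_rV n (f : 'rV[R]_n -> R) :
  continuous f -> measurable_fun setT f.
Proof.
move=> /continuousP cf; apply: (measurability _ (RGenOpens.measurableE R)).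
move=> _ [_ [a [b ->] <-]]; rewrite setTI; apply: open_measurable_rV.
exact/cf/interval_open.
Qed.

Definition cube n (r : R) : set 'rV[R]_n := prod_rV (fun=> `[- r, r]%classic).

Lemma measurable_cube n r : measurable (@cube n r).
Proof. by apply: measurable_prod_rV => i; exact: measurable_itv. Qed.

Lemma lebesgue_cube n (r : R) : 0 <= r ->
  lebesgue_rV n (@cube n r) = ((2 * r) ^+ n)%:E.
Proof.
move=> r0.
have lr : @lebesgue_measure R `[- r, r]%classic = (2 * r)%:E.
  rewrite lebesgue_measure_itv/= lte_fin; case: ifPn => [h|].
    by rewrite -EFinD; congr EFin; ring.
  by rewrite -leNgt => h; congr EFin; lra.
elim: n => [|n IH].
  rewrite /= diracE mem_set//=; by move=> [].
rewrite -[LHS]/((@lebesgue_measure R \x lebesgue_rV n)%E (@cons_rV R n @^-1` cube r)).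
rewrite (_ : _ @^-1` _ = `[- r, r]%classic `*` @cube n r).
  rewrite product_measure1E//; last exact: measurable_cube.
  by rewrite IH exprS EFinM; congr *%E; exact: lr.
apply/seteqP; split => [[t y] /= h|[t y] /= [ht hy]].
  split.
    have := h (@lshift 1 n ord0); rewrite (@row_mxEl _ 1 1 n); first by rewrite mxE.
  by move=> i; have := h (@rshift 1 n i); rewrite (@row_mxEr _ 1 1 n).
by move=> i; rewrite /cons_rV !mxE; case: fintype.split => j; rewrite ?mxE//; exact: hy.
Qed.

Lemma compact_cube n (r : R) : compact (@cube n r).
Proof.
apply: (@rV_compact _ _ (fun=> `[- r, r]%classic)) => i.
exact: segment_compact.
Qed.

Lemma compact_sub_cube n (K : set 'rV[R]_n) : compact K ->
  exists2 r : R, 0 < r & K `<=` cube r.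
Proof.
move=> /compact_bounded[M [Mreal KM]]; exists (`|M| + 1); first by rewrite ltr_wpDl.
have {}KM : forall x, K x -> `|x| <= `|M| + 1.
  by apply: KM; rewrite (le_lt_trans (ler_norm _))// ltrDl.
move=> x /KM h i; rewrite /= in_itv/= -ler_norml; apply: le_trans h.
have /mapP[j Hj ->] : `|x ord0 i| \in [seq `|x x0.1 x0.2| | x0 : 'I_1 * 'I_n].
  by apply/mapP; exists (ord0, i) => //=; rewrite mem_enum.
by rewrite [leRHS]/Num.norm /= mx_normrE; apply/bigmax_geP; right => /=; exists j.
Qed.

Lemma cubeS n (r s : R) : r <= s -> @cube n r `<=` @cube n s.
Proof.
by move=> rs x h i; have := h i; rewrite /= !in_itv/= => /andP[? ?]; apply/andP; split; lra.
Qed.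

End rV_borel.

(** * The Euclidean norm *)

Section enorm_theory.
Context {R : realType} {n : nat}.
Implicit Types x y : 'rV[R]_n.

Lemma enorm_ge0 x : 0 <= enorm x. Proof. exact: sqrtr_ge0. Qed.

Lemma sqr_enorm x : enorm x ^+ 2 = \sum_i x 0 i ^+ 2.
Proof. by rewrite sqr_sqrtr// sumr_ge0// => i _; exact: sqr_ge0. Qed.

Lemma enormZ (a : R) x : enorm (a *: x) = `|a| * enorm x.
Proof.
rewrite /enorm -sqrtr_sqr -sqrtrM ?sqr_ge0// mulr_sumr; congr Num.sqrt.
by apply: eq_bigr => i _; rewrite mxE exprMn.
Qed.

Lemma enorm0 : enorm (0 : 'rV[R]_n) = 0.
Proof. by rewrite -(scale0r (0 : 'rV[R]_n)) enormZ normr0 mul0r. Qed.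

Lemma enormN x : enorm (- x) = enorm x.
Proof. by rewrite -scaleN1r enormZ normrN normr1 mul1r. Qed.

Lemma enormB_sym x y : enorm (x - y) = enorm (y - x).
Proof. by rewrite -enormN opprB. Qed.

Lemma normr_coord_enorm x i : `|x 0 i| <= enorm x.
Proof.
rewrite -sqrtr_sqr ler_wsqrtr// (bigD1 i)//= lerDl.
by apply: sumr_ge0 => j _; exact: sqr_ge0.
Qed.

Lemma enorm_eq0 x : (enorm x == 0) = (x == 0).
Proof.
apply/eqP/eqP => [x0|->]; last exact: enorm0.
apply/rowP => i; rewrite mxE; apply/eqP; rewrite -normr_le0 -x0.
exact: normr_coord_enorm.
Qed.

Lemma enorm_gt0 x : (0 < enorm x) = (x != 0).
Proof. by rewrite lt0r enorm_eq0 enorm_ge0 andbT. Qed.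

Lemma cauchy_schwarz_rV x y : \sum_i x 0 i * y 0 i <= enorm x * enorm y.
Proof.
have [->|x0] := eqVneq x 0.
  rewrite enorm0 mul0r big1// => i _; by rewrite mxE mul0r.
have [->|y0] := eqVneq y 0.
  rewrite enorm0 mulr0 big1// => i _; by rewrite mxE mulr0.
move: x0 y0; rewrite -!enorm_gt0 => x0 y0; set a := enorm x; set b := enorm y.
(* Young's inequality weighted by the ratio of the two norms, so that after summation each half of
   the right side equals [a * b / 2]. *)
have h i : x 0 i * y 0 i <= 2^-1 * (b / a * x 0 i ^+ 2 + a / b * y 0 i ^+ 2).
  rewrite -subr_ge0 (_ : _ - _ = (2 * (a * b))^-1 * (b * x 0 i - a * y 0 i) ^+ 2).
    by rewrite mulr_ge0 ?sqr_ge0// invr_ge0 !mulr_ge0// ltW.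
  by field; rewrite !gt_eqF.
apply: le_trans (ler_sum _ (fun i _ => h i)) _.
rewrite -mulr_sumr big_split/= -!mulr_sumr -!sqr_enorm -/a -/b.
by rewrite le_eqVlt; apply/orP; left; apply/eqP; field; rewrite !gt_eqF.
Qed.

Lemma enormD x y : enorm (x + y) <= enorm x + enorm y.
Proof.
rewrite -(@ler_pXn2r _ 2)// ?nnegrE ?enorm_ge0 ?addr_ge0 ?enorm_ge0//.
rewrite sqrrD !sqr_enorm.
under eq_bigr do rewrite mxE sqrrD.
rewrite !big_split/= lerD2r lerD2l.
by rewrite -mulr2n lerMn2r/= cauchy_schwarz_rV.
Qed.

Lemma enorm_le_sum x : enorm x <= \sum_i `|x 0 i|.
Proof.
have s0 : 0 <= \sum_i `|x 0 i| by exact: sumr_ge0.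
rewrite -(@ler_pXn2r _ 2)// ?nnegrE ?enorm_ge0// sqr_enorm expr2 mulr_suml.
apply: ler_sum => i _; rewrite -real_normK ?num_real// expr2 ler_wpM2l//.
by rewrite (bigD1 i)//= lerDl sumr_ge0.
Qed.

Lemma sqr_enormE x : enorm x ^+ 2 = (x *m x^T) 0 0.
Proof.
by rewrite sqr_enorm mxE; apply: eq_bigr => i _; rewrite mxE expr2.
Qed.

Lemma enorm_orthogonal x (Q : 'M[R]_n) : Q *m Q^T = 1%:M -> enorm (x *m Q) = enorm x.
Proof.
move=> QQ; apply/eqP; rewrite -(@eqrXn2 _ 2) ?enorm_ge0//; apply/eqP.
by rewrite !sqr_enormE trmx_mul mulmxA -(mulmxA x) QQ mulmx1.
Qed.

Lemma measurable_enorm : measurable_fun setT (@enorm R n).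
Proof.
apply: measurableT_comp; first by apply: continuous_measurable_fun; exact: sqrt_continuous.
apply: measurable_sum => i; apply: measurable_funX; exact: measurable_coord_rV.
Qed.

End enorm_theory.

Lemma mulIe_fin_num {R : realType} (z x y : \bar R) :
  z \is a fin_num -> (0 < z -> x * z = y * z -> x = y)%E.
Proof.
by move=> zf z0 e; apply/eqP; rewrite eq_le -(lee_pmul2r zf z0) e lexx -(lee_pmul2r zf z0) e lexx.
Qed.

(** * Similarities and change of variables *)

Section similarity.
Context {R : realType} {n : nat}.
Local Notation mu := (@lebesgue_rV R n).
Local Open Scope ereal_scope.

Let eball : set 'rV[R]_n := [set x | (enorm x <= 1)%R].

Let measurable_eball : measurable eball.
Proof.
rewrite (_ : eball = enorm @^-1` `]-oo, 1%R]%classic).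
  by rewrite -[X in measurable X]setTI; exact: measurable_enorm.
by apply/seteqP; split => x /=; rewrite in_itv.
Qed.

Let eball_gt0 : 0 < mu eball.
Proof.
apply: (@lt_le_trans _ _ (mu (cube n.+1%:R^-1))).
  by rewrite lebesgue_cube ?invr_ge0// lte_fin exprn_gt0// mulr_gt0// invr_gt0.
apply: le_measure; rewrite ?inE//; first exact: measurable_cube.
move=> x h; rewrite /eball /=; apply: le_trans (enorm_le_sum x) _.
apply: (@le_trans _ _ (\sum_(i < n) n.+1%:R^-1)%R).
  apply: ler_sum => i _; have := h i; rewrite /= in_itv/= -ler_norml; exact.
rewrite sumr_const card_ord -[X in (X <= _)%R]mulr_natl ler_pdivrMr// mul1r ler_nat//.
Qed.

Let eball_lty : mu eball < +oo.
Proof.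
apply: (@le_lt_trans _ _ (mu (cube 1))); last by rewrite lebesgue_cube// ltry.
apply: le_measure; rewrite ?inE//; first exact: measurable_cube.
move=> x h i; rewrite /= in_itv/= -ler_norml; exact: le_trans (normr_coord_enorm _ _) h.
Qed.

(** The unit ball is its own preimage under [Q], and its measure is neither zero nor infinite, so
    the common factor given by [lebesgue_rV_mulmx_swap] is 1. *)
Lemma lebesgue_rV_orthogonal (Q : 'M[R]_n) (A : set 'rV[R]_n) : Q *m Q^T = 1%:M ->
  measurable A -> mu ((mulmx^~ Q) @^-1` A) = mu A.
Proof.
move=> QQ mA.
have := @lebesgue_rV_mulmx_swap R n Q Q^T A eball (mulmx1C QQ) mA measurable_eball.
have -> : mulmx^~ Q @^-1` eball = eball.
  by apply/seteqP; split => x; rewrite /eball /= enorm_orthogonal.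
move=> h.
apply: (mulIe_fin_num _ eball_gt0); first by rewrite ge0_fin_numE// ltW.
by apply/esym/h => x; rewrite /eball/= enormN.
Qed.

(** Here the cube is the reference set: its preimage under the dilation is again a cube, of explicit
    measure. *)
Lemma lebesgue_rV_scale (r : R) (A : set 'rV[R]_n) : (0 < r)%R ->
  measurable A -> mu ( *:%R r @^-1` A) = (r ^- n)%:E * mu A.
Proof.
move=> r0 mA.
have MM : r^-1%:M *m r%:M = 1%:M :> 'M[R]_n.
  by rewrite -scalar_mxM mulVf// gt_eqF.
have := @lebesgue_rV_mulmx_swap R n _ _ A (@cube R n 1) MM mA (measurable_cube _).
have -> (B : set 'rV[R]_n) : mulmx^~ r%:M @^-1` B = *:%R r @^-1` B.
  by apply/seteqP; split => x; rewrite /= mul_mx_scalar.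
have -> (B : set 'rV[R]_n) : mulmx^~ r%:M @^-1` B = *:%R r @^-1` B.
  by apply/seteqP; split => x; rewrite /= mul_mx_scalar.
have -> : *:%R r @^-1` @cube R n 1 = @cube R n r^-1.
  apply/seteqP; split => x h i; have := h i; rewrite /= !in_itv/= mxE -!ler_norml normrM gtr0_norm//.
    by rewrite -[X in _ -> (_ <= X)%R]mulr1 ler_pdivlMl.
  by rewrite -[X in (_ <= X)%R -> _]mulr1 ler_pdivlMl.
rewrite !lebesgue_cube ?invr_ge0 ?(ltW r0)// => h.
have p2 : 0 < (2 ^+ n)%:E :> \bar R by rewrite lte_fin exprn_gt0.
apply: (mulIe_fin_num _ p2) => //.
rewrite -[in LHS](mulr1 2%R) -h; last first.
  by move=> x hx i; have := hx i; rewrite /= !in_itv/= mxE -!ler_norml normrN.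
by rewrite exprMn exprVn mulrC EFinM muleA (muleC (mu A)).
Qed.

Lemma ge0_integral_rV_pushforward (T : 'rV[R]_n -> 'rV[R]_n) (c : {nonneg R})
    (f : 'rV[R]_n -> \bar R) :
  measurable_fun setT T ->
  (forall A, measurable A -> mu (T @^-1` A) = c%:num%:E * mu A) ->
  measurable_fun setT f -> (forall x, 0 <= f x) ->
  \int[mu]_x f (T x) = c%:num%:E * \int[mu]_x f x.
Proof.
move=> mT hT mf f0; rewrite -ge0_integral_mscale//.
transitivity (\int[pushforward mu T]_x f x).
  by rewrite (ge0_integral_pushforward mT).
by apply: eq_measure_integral => A mA _; rewrite [LHS]hT.
Qed.

Definition simil (a : 'rV[R]_n) (r : R) (Q : 'M[R]_n) (x : 'rV[R]_n) : 'rV[R]_n :=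
  (a + r *: (x *m Q))%R.

Lemma measurable_simil a r Q : measurable_fun setT (simil a r Q).
Proof.
apply: measurable_rVD => //.
rewrite (_ : (fun x => _) = fun x : 'rV[R]_n => x *m (r *: Q)%R).
  exact: measurable_rV_mulmx.
by apply/funext => x; rewrite scalemxAr.
Qed.

Lemma ge0_integral_simil (a : 'rV[R]_n) (r : R) (Q : 'M[R]_n) (f : 'rV[R]_n -> \bar R) :
  (0 < r)%R -> Q *m Q^T = 1%:M ->
  measurable_fun setT f -> (forall x, 0 <= f x) ->
  \int[mu]_x f (simil a r Q x) = (r ^- n)%:E * \int[mu]_x f x.
Proof.
move=> r0 QQ mf f0.
have mS : measurable_fun setT (fun x : 'rV[R]_n => r *: x).
  rewrite (_ : (fun x => _) = fun x : 'rV[R]_n => x *m r%:M).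
    exact: measurable_rV_mulmx.
  by apply/funext => x; rewrite mul_mx_scalar.
have mQ : measurable_fun setT (mulmx^~ Q : 'rV[R]_n -> 'rV[R]_n).
  exact: measurable_rV_mulmx.
have mfa : measurable_fun setT (fun x => f (a + x)%R).
  by apply: measurableT_comp => //; exact: measurable_rVD.
have rn0 : (0 <= r ^- n)%R by rewrite invr_ge0 exprn_ge0// ltW.
rewrite (@ge0_integral_rV_pushforward (mulmx^~ Q) (NngNum (@ler01 R)) (fun x => f (a + r *: x)%R))//; last 2 first.
- by move=> A mA; rewrite mul1e lebesgue_rV_orthogonal.
- exact: measurableT_comp mfa mS.
rewrite mul1e (@ge0_integral_rV_pushforward ( *:%R r) (NngNum rn0) (fun x => f (a + x)%R))//; last first.
  by move=> A mA; rewrite lebesgue_rV_scale.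
congr (_ * _); rewrite -[RHS](ge0_integral_rV_shift a)//.
by under eq_integral do rewrite addrC.
Qed.

Lemma integrable_simil (a : 'rV[R]_n) (r : R) (Q : 'M[R]_n) (f : 'rV[R]_n -> \bar R) :
  (0 < r)%R -> Q *m Q^T = 1%:M -> mu.-integrable setT f ->
  mu.-integrable setT (f \o simil a r Q).
Proof.
move=> r0 QQ /integrableP[mf foo]; apply/integrableP; split.
  exact: measurableT_comp mf (measurable_simil _ _ _).
rewrite (@ge0_integral_simil a r Q (fun x => `|f x|))//; last exact: measurableT_comp.
by rewrite lte_mul_pinfty// lee_fin invr_ge0 exprn_ge0// ltW.
Qed.

Lemma integral_simil (a : 'rV[R]_n) (r : R) (Q : 'M[R]_n) (f : 'rV[R]_n -> \bar R) :
  (0 < r)%R -> Q *m Q^T = 1%:M -> mu.-integrable setT f ->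
  \int[mu]_x f (simil a r Q x) = (r ^- n)%:E * \int[mu]_x f x.
Proof.
move=> r0 QQ intf; have [mf foo] := integrableP _ _ _ intf.
rewrite [in LHS]integralE [in RHS]integralE.
have fE : (fun x => f (simil a r Q x)) = f \o simil a r Q by [].
rewrite fE funepos_comp funeneg_comp /=.
rewrite (@ge0_integral_simil a r Q f^\+)//; last exact: measurable_funepos.
rewrite (@ge0_integral_simil a r Q f^\-)//; last exact: measurable_funeneg.
have Af := integrable_pos_fin_num measurableT intf.
have Bf := integrable_neg_fin_num measurableT intf.
move: Af Bf; move: (\int[mu]_x f^\+ x) (\int[mu]_x f^\- x) => A B Af Bf.
by rewrite muleBr// fin_num_adde_defr.
Qed.

Lemma Rintegral_simil (a : 'rV[R]_n) (r : R) (Q : 'M[R]_n) (f : 'rV[R]_n -> R) :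
  (0 < r)%R -> Q *m Q^T = 1%:M -> mu.-integrable setT (EFin \o f) ->
  (\int[mu]_x f (simil a r Q x) = r ^- n * \int[mu]_x f x)%R.
Proof.
move=> r0 QQ intf; rewrite /Rintegral (@integral_simil a r Q (EFin \o f))//.
by rewrite fineM//; exact: integrable_fin_num.
Qed.

End similarity.

(** * Smooth functions and test functions *)

Section directional.
Context {R : realType} {V : normedModType R}.
Implicit Types (f : V -> R) (x v w : V).

(** Directional derivatives become derivatives of the restriction to a line, where the one-variable
    rules apply. *)
Lemma is_derive_lineP f x v (d : R) :
  is_derive x v f d <-> is_derive (0 : R) (1 : R) (fun h : R => f (h *: v + x)) d.
Proof.
have e : (fun h : R => h^-1 *: (((fun h : R => f (h *: v + x)) \o shift 0) (h *: 1) - f (0 *: v + x)))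
    = (fun h : R => h^-1 *: ((f \o shift x) (h *: v) - f x)).
  by apply/funext => h /=; rewrite addr0 scale0r add0r [h *: 1]mulr1.
split=> -[df dE]; split.
- by move/derivable1P : df.
- by rewrite /derive e.
- by apply/derivable1P.
- by rewrite -dE /derive e.
Qed.

Lemma is_derive_line f x v (s d : R) :
  is_derive (s *: v + x) v f d -> is_derive s 1 (fun h : R => f (h *: v + x)) d.
Proof.
move=> [df dE].
have e : (fun h : R => h^-1 *: (((fun h : R => f (h *: v + x)) \o shift s) (h *: 1) - f (s *: v + x)))
    = (fun h : R => h^-1 *: ((f \o shift (s *: v + x)) (h *: v) - f (s *: v + x))).
  by apply/funext => h /=; rewrite [h *: 1]mulr1 scalerDl addrA.
split; first by rewrite /derivable e.
by rewrite -dE /derive e.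
Qed.

Lemma is_derive_dirZ f x v (c d : R) :
  is_derive x v f d -> is_derive x (c *: v) f (c * d).
Proof.
move=> /is_derive_lineP df; apply/is_derive_lineP.
have -> : (fun h : R => f (h *: (c *: v) + x)) =
    (fun h : R => f (h *: v + x)) \o (fun h : R => h * c).
  by apply/funext => h /=; rewrite scalerA.
rewrite mulrC; apply: is_derive1_comp.
  by rewrite mul0r.
rewrite (_ : *%R^~ c = id * cst c)//.
by apply: is_derive_eq; rewrite scaler0 add0r [LHS]mulr1.
Qed.

Lemma mvt_dir f v : (forall x, derivable f x v) ->
  forall x (t : R), exists2 c : R, `|c| <= `|t| &
    f (t *: v + x) - f x = t * 'D_v f (c *: v + x).
Proof.
move=> df x t.
have dg (s : R) : is_derive s 1 (fun h : R => f (h *: v + x)) ('D_v f (s *: v + x)).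
  by apply: is_derive_line; apply: derivableP.
have cg : forall s : R, {for s, continuous (fun h : R => f (h *: v + x))}.
  by move=> s; apply/differentiable_continuous/derivable1_diffP; have [] := dg s.
have [t0|t0] := leP 0 t.
  have [|c c0 hc] := MVT_segment t0 (fun s _ => dg s).
    exact: continuous_subspaceT.
  exists c; last by rewrite scale0r add0r subr0 in hc; rewrite hc mulrC.
  by move: c0; rewrite in_itv/= => /andP[c0 ct]; rewrite !ger0_norm.
have [|c c0 hc] := MVT_segment (ltW t0) (fun s _ => dg s).
  exact: continuous_subspaceT.
exists c; last first.
  by rewrite scale0r add0r sub0r in hc; rewrite -opprB hc mulrN opprK mulrC.
by move: c0; rewrite in_itv/= => /andP[c0 ct]; rewrite !ler0_norm ?lerN2// ltW.
Qed.

(** The increment along [v + w] splits into a step along [v] and a step along [w] that starts at a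
    moving point. The mean value theorem turns the second into a value of ['D_w f] near [x], and
    continuity of that derivative gives the limit. *)
Lemma is_derive_dirD f v w x : (forall x, derivable f x v) -> (forall x, derivable f x w) ->
  {for x, continuous ('D_w f)} ->
  is_derive x (v + w) f ('D_v f x + 'D_w f x).
Proof.
move=> dv dw cw.
have h1 : (fun h : R => h^-1 *: ((f \o shift x) (h *: v) - f x)) @ 0^' --> 'D_v f x.
  exact: dv.
pose q (h : R) : R := h^-1 *: (f (h *: w + (h *: v + x)) - f (h *: v + x)).
have h2 : q @ 0^' --> 'D_w f x.
  apply/cvgrPdist_lt => e e0.
  move/cvgrPdist_lt : cw => /(_ e e0) /nbhs_ballP[d /= d0 hd].
  have M0 : 0 < `|v| + `|w| + 1 by rewrite ltr_wpDl// addr_ge0.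
  near=> h.
  have hn0 : h != 0 by near: h; exact: nbhs_dnbhs_neq.
  rewrite /q; have [c ch ->] := mvt_dir dw (h *: v + x) h.
  rewrite -[h * _]/(h *: _) [h^-1 *: _]scalerA mulVf// scale1r; apply: hd.
  rewrite -ball_normE /ball_/= distrC addrA addrK.
  have hd' : `|h| < d / (`|v| + `|w| + 1).
    near: h; apply: dnbhs0_lt; exact: divr_gt0.
  apply: le_lt_trans (ler_normD _ _) _; rewrite !normrZ.
  move: hd'; rewrite ltr_pdivlMr//; apply: le_lt_trans.
  have cw' : `|c| * `|w| <= `|h| * `|w| by rewrite ler_wpM2r.
  by rewrite !mulrDr mulr1; have := normr_ge0 h; lra.
have h3 := cvgD h1 h2.
have e : (fun h : R => h^-1 *: ((f \o shift x) (h *: (v + w)) - f x)) =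
    (fun h : R => h^-1 *: ((f \o shift x) (h *: v) - f x)) + q.
  apply/funext => h.
  rewrite -[RHS]/(h^-1 *: ((f \o shift x) (h *: v) - f x) +
    h^-1 *: (f (h *: w + (h *: v + x)) - f (h *: v + x))) -scalerDr; congr (_ *: _) => /=.
  rewrite (_ : h *: (v + w) + x = h *: w + (h *: v + x)); last first.
    by rewrite scalerDr [h *: v + h *: w]addrC addrA.
  by ring.
split; rewrite /derivable /derive e.
  by apply/cvg_ex; eexists; exact: h3.
by apply/cvg_lim => //; exact: h3.
Unshelve. all: by end_near. Qed.

End directional.

Lemma rV_near_ball {R : realType} {n : nat} (T : Type) (F : set_system T) (f : T -> 'rV[R]_n) (y : 'rV[R]_n) :
  Filter F -> (forall i, (fun x => f x 0 i) @ F --> y 0 i) -> f @ F --> y.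
Proof.
move=> FF h; apply/cvg_ballP => e e0.
have : \forall x \near F, forall i, `|y 0 i - f x 0 i| < e.
  by apply: filter_forall => i; move/cvgrPdist_lt : (h i); exact.
by apply: filterS => x hx; apply/rV_ballP.
Qed.

Lemma affine_continuous {R : realType} {n : nat} (a : 'rV[R]_n) (M : 'M[R]_n) :
  continuous (fun x : 'rV[R]_n => a + x *m M).
Proof.
move=> x; apply: (rV_near_ball (nbhs_filter x)) => i.
rewrite (_ : (fun y => _) = fun y : 'rV[R]_n => a 0 i + \sum_j y 0 j * M j i); last first.
  by apply/funext => y; rewrite !mxE.
rewrite !mxE; apply: cvgD; first exact: cvg_cst.
apply: cvg_big => [|j _]; first exact: add_continuous.
by apply: cvgM; [exact: coord_continuous|exact: cvg_cst].
Qed.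

Section smooth_theory.
Context {R : realType} {n : nat}.
Implicit Types phi psi : 'rV[R]_n -> R.

(** Coinduction: it is enough to exhibit a class of continuous functions that have partial
    derivatives and that is stable under taking them. No formula for iterated derivatives is then
    required. *)
Lemma smooth_coind (K : ('rV[R]_n -> R) -> Prop) :
  (forall f, K f -> continuous f /\
     forall i : 'I_n, (forall x, derivable f x 'e_i) /\ K (fun x => 'D_('e_i) f x)) ->
  forall f, K f -> smooth f.
Proof.
move=> HK f Kf s.
have Ks : K (iter_partial s f).
  by elim: s => //= i s IH; have [_ /(_ i)[]] := HK _ IH.
by have [cs ds] := HK _ Ks; split => // i x; have [] := ds i.
Qed.

Lemma smooth_partial phi (i : 'I_n) : smooth phi -> smooth (fun x => 'D_('e_i) phi x).
Proof.
move=> sphi s; have := sphi (rcons s i).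
rewrite (_ : iter_partial (rcons s i) phi = iter_partial s (fun x => 'D_('e_i) phi x))//.
by rewrite /iter_partial foldr_rcons.
Qed.

Lemma smooth_continuous phi : smooth phi -> continuous phi.
Proof. by move=> /(_ [::])[]. Qed.

Lemma smooth_derivable phi (i : 'I_n) x : smooth phi -> derivable phi x 'e_i.
Proof. by move=> /(_ [::])[_]; exact. Qed.

Lemma smooth_lincomb m (c : 'I_m -> R) (psi : 'I_m -> 'rV[R]_n -> R) :
  (forall k, smooth (psi k)) -> smooth (fun x => \sum_k c k * psi k x).
Proof.
pose K f := exists c : 'I_m -> R, exists psi : 'I_m -> 'rV[R]_n -> R,
  (forall k, smooth (psi k)) /\ f = (fun x => \sum_k c k * psi k x).
move=> spsi; apply: (@smooth_coind K); last by exists c, psi.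
move=> {c psi spsi} f [c [psi [spsi ->]]]; split.
  apply: continuous_big => [|k _ x]; first exact: add_continuous.
  by apply: continuousM; [exact: cst_continuous|exact: smooth_continuous].
have fE : (fun x => \sum_k c k * psi k x) = \sum_k (c k \*: psi k).
  by apply/funext => x; rewrite fct_sumE.
move=> i.
have der x : is_derive x 'e_i (fun x => \sum_k c k * psi k x) (\sum_k c k *: 'D_('e_i) (psi k) x).
  rewrite fE; apply: is_derive_sum => k; apply: is_deriveZ.
  by apply: derivableP; exact: smooth_derivable.
split; first by move=> x; have [] := der x.
exists c, (fun k x => 'D_('e_i) (psi k) x); split=> [k|]; first exact: smooth_partial.
by apply/funext => x; have [_ ->] := der x.
Qed.

(** The direction is built up one coordinate at a time with [is_derive_dirD]; continuity of the
    partial derivatives allows each step. *)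
Lemma smooth_dir phi (v x : 'rV[R]_n) : smooth phi ->
  is_derive x v phi (\sum_i v 0 i * 'D_('e_i) phi x).
Proof.
move=> sphi.
suff H (r : seq 'I_n) (w := \sum_(i <- r) v 0 i *: ('e_i : 'rV[R]_n)) : forall x,
    is_derive x w phi (\sum_(i <- r) v 0 i * 'D_('e_i) phi x).
  have -> : v = \sum_i v 0 i *: ('e_i : 'rV[R]_n) by exact: row_sum_delta.
  under [X in is_derive _ _ _ X]eq_bigr => i _.
    rewrite (_ : (\sum_j v 0 j *: 'e_j) 0 i = v 0 i); last by rewrite -row_sum_delta.
  over.
  exact: H.
rewrite /w {w}; elim: r => [y|i r IH y].
  by rewrite !big_nil; exact: is_derive0.
rewrite !big_cons addrC [X in is_derive _ _ _ X]addrC.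
set w := \sum_(j <- r) _ in IH *.
have hi z : is_derive z (v 0 i *: ('e_i : 'rV[R]_n)) phi (v 0 i * 'D_('e_i) phi z).
  by apply: is_derive_dirZ; apply: derivableP; exact: smooth_derivable.
have -> : \sum_(j <- r) v 0 j * 'D_('e_j) phi y + v 0 i * 'D_('e_i) phi y =
   'D_w phi y + 'D_(v 0 i *: ('e_i : 'rV[R]_n)) phi y.
  by have [_ ->] := IH y; have [_ ->] := hi y.
apply: is_derive_dirD.
- by move=> z; have [] := IH z.
- by move=> z; have [] := hi z.
- rewrite (_ : 'D_(_) phi = fun z => v 0 i * 'D_('e_i) phi z); last first.
    by apply/funext => z; have [_ ->] := hi z.
  apply: continuousM; first exact: cst_continuous.
  exact: (smooth_continuous (smooth_partial i sphi)).
Qed.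

Lemma is_derive_comp_affine phi (a x : 'rV[R]_n) (M : 'M[R]_n) (i : 'I_n) : smooth phi ->
  is_derive x 'e_i (fun x => phi (a + x *m M))
    (\sum_j M i j * 'D_('e_j) phi (a + x *m M)).
Proof.
move=> sphi; apply/is_derive_lineP.
have -> : (fun h : R => phi (a + (h *: 'e_i + x) *m M)) =
    (fun h : R => phi (h *: row i M + (a + x *m M))).
  apply/funext => h; rewrite mulmxDl -scalemxAl -rowE; congr (phi _).
  by rewrite addrCA.
apply: (is_derive_lineP phi _ _ _).1.
have := smooth_dir (row i M) (a + x *m M) sphi.
by under eq_bigr do rewrite mxE.
Qed.

Lemma smooth_comp_affine phi (a : 'rV[R]_n) (M : 'M[R]_n) : smooth phi ->
  smooth (fun x => phi (a + x *m M)).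
Proof.
move=> sphi; pose K f := exists2 psi, smooth psi & f = (fun x : 'rV[R]_n => psi (a + x *m M)).
apply: (@smooth_coind K); last by exists phi.
move=> {phi sphi} f [phi sphi ->]; split.
  move=> x; apply: (@cvg_comp _ _ _ (fun x : 'rV[R]_n => a + x *m M) phi).
    2: exact: smooth_continuous.
  exact: affine_continuous.
move=> i; have der x := is_derive_comp_affine a x M i sphi.
split; first by move=> x; have [] := der x.
exists (fun x => \sum_j M i j * 'D_('e_j) phi x).
  by apply: smooth_lincomb => j; exact: smooth_partial.
by apply/funext => x; have [_ ->] := der x.
Qed.

End smooth_theory.

(** * Smooth functions of one variable *)

Section smooth1_theory.
Context {R : realType}.
Implicit Types f g : R -> R.

Fixpoint nderivable (k : nat) f : Prop :=
  if k is k'.+1 then (forall x : R, derivable f x 1) /\ nderivable k' f^`()%classic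
  else True.

Definition smooth1 f := forall k, nderivable k f.

Definition deriv_at f (x d : R) := is_derive x (1 : R) f d.

Lemma deriv_atD f g (x a b : R) : deriv_at f x a -> deriv_at g x b ->
  deriv_at (fun y => f y + g y) x (a + b).
Proof. exact: is_deriveD. Qed.

Lemma deriv_atM f g (x a b : R) : deriv_at f x a -> deriv_at g x b ->
  deriv_at (fun y => f y * g y) x (f x * b + g x * a).
Proof. exact: is_deriveM. Qed.

Lemma deriv_at_comp f g (x a b : R) : deriv_at f (g x) a -> deriv_at g x b ->
  deriv_at (fun y => f (g y)) x (a * b).
Proof. exact: is_derive1_comp. Qed.

Lemma deriv_at_affine (c d x : R) : deriv_at (fun y => c * y + d) x c.
Proof.
rewrite /deriv_at (_ : (fun y => _) = cst c * id + cst d)//.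
by apply: is_derive_eq; rewrite addr0 scaler0 addr0 [LHS]mulr1.
Qed.

Lemma nderivable_is_derive k f g : (forall x : R, deriv_at f x (g x)) -> nderivable k g -> nderivable k.+1 f.
Proof.
move=> fg gk; split; first by move=> x; have [] := fg x.
rewrite (_ : f^`()%classic = g)//; apply/funext => x.
by rewrite derive1E; have [_ ->] := fg x.
Qed.

Lemma nderivableW k f : nderivable k.+1 f -> nderivable k f.
Proof. by elim: k f => [//|k IH] f [df] /IH. Qed.

Lemma nderivableS_is_derive k f : nderivable k.+1 f ->
  (forall x : R, deriv_at f x (f^`()%classic x)) /\ nderivable k f^`()%classic.
Proof. by move=> [df fk]; split => // x; rewrite derive1E; exact: derivableP. Qed.

Lemma nderivable_cst k (c : R) : nderivable k (fun=> c).
Proof.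
elim: k c => [//|k IH] c; apply: (@nderivable_is_derive _ _ (fun=> 0)) => //.
by move=> x; exact: is_derive_cst.
Qed.

Lemma nderivableD k f g : nderivable k f -> nderivable k g ->
  nderivable k (fun x => f x + g x).
Proof.
elim: k f g => [//|k IH] f g /nderivableS_is_derive[df fk] /nderivableS_is_derive[dg gk].
apply: (@nderivable_is_derive _ _ (fun x => f^`()%classic x + g^`()%classic x)); last exact: IH.
by move=> x; exact: deriv_atD.
Qed.

Lemma nderivableM k f g : nderivable k f -> nderivable k g ->
  nderivable k (fun x => f x * g x).
Proof.
elim: k f g => [//|k IH] f g fk1 gk1.
have [df fk] := nderivableS_is_derive fk1; have [dg gk] := nderivableS_is_derive gk1.
apply: (@nderivable_is_derive _ _ (fun x => f x * g^`()%classic x + g x * f^`()%classic x)).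
  by move=> x; exact: deriv_atM.
by apply: nderivableD; apply: IH => //; exact: nderivableW.
Qed.

Lemma nderivable_affine k f (c d : R) : nderivable k f -> nderivable k (fun x => f (c * x + d)).
Proof.
elim: k f => [//|k IH] f /nderivableS_is_derive[df fk].
apply: (@nderivable_is_derive _ _ (fun x => f^`()%classic (c * x + d) * c)).
  by move=> x; apply: deriv_at_comp => //; exact: deriv_at_affine.
by apply: nderivableM; [exact: IH|exact: nderivable_cst].
Qed.

(** For [t > 0] this is t^-m exp(-1/t). The parameter [m] closes the family under differentiation,
    up to linear combinations, so that all members are shown to be smooth at once. *)
Definition flat (m : nat) (t : R) : R :=
  if 0 < t then t^-1 ^+ m * expR (- t^-1) else 0.

Lemma flat_ge0 m t : 0 <= flat m t.
Proof.
rewrite /flat; case: ifPn => // t0.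
by rewrite mulr_ge0 ?expR_ge0// exprn_ge0// invr_ge0 ltW.
Qed.

(** With y = 1/t, the exponential series gives exp y >= y^(m+1)/(m+1)!. This bound is what sends the
    difference quotients at 0 to 0. *)
Lemma flat_le m t : `|flat m t| <= (m.+1)`!%:R * `|t|.
Proof.
rewrite /flat; case: ifPn => t0; last by rewrite normr0 mulr_ge0.
have y0 : 0 < t^-1 by rewrite invr_gt0.
rewrite !ger0_norm ?(ltW t0)//; last by rewrite mulr_ge0 ?expR_ge0// exprn_ge0// ltW.
rewrite expRN ler_pdivrMr ?expR_gt0//.
have h : t^-1 ^+ m.+1 / (m.+1)`!%:R <= expR t^-1.
  by apply: le_trans (expR_ge1Dxn m (ltW y0)); rewrite lerDr.
rewrite ler_pdivrMr ?ltr0n ?fact_gt0// in h.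
have -> : t^-1 ^+ m = t * t^-1 ^+ m.+1 by rewrite exprS mulrA mulfV ?mul1r// gt_eqF.
rewrite -mulrA mulrCA ler_pM2l//; apply: le_trans h _.
by rewrite mulrC.
Qed.

Lemma is_derive_flat (m : nat) (t : R) : deriv_at (flat m) t (flat m.+2 t - m%:R * flat m.+1 t).
Proof.
have [t0|t0|->] := ltgtP t 0.
- rewrite /deriv_at /flat [0 < t]ltNge (ltW t0)/= mulr0 subr0.
  apply: (near_eq_is_derive (f := cst 0)).
  near=> y; rewrite /flat ltNge ifF//; apply/negbTE; rewrite negbK.
  by apply/ltW; near: y; exact: lt_nbhsl.
- rewrite /deriv_at /flat t0.
  apply: (near_eq_is_derive (f := fun y : R => y^-1 ^+ m * expR (- y^-1) : R)).
    near=> y; rewrite /flat ifT//.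
    by near: y; exact: lt_nbhsr.
  have dV : is_derive t 1 (fun y : R => y^-1) (- t ^- 2).
    have tn0 : (id t : R) != 0 by rewrite gt_eqF.
    split; first exact: (@derivableV R R id t 1 tn0).
    by rewrite (@deriveV R R id t 1 tn0)// derive_id [LHS]mulr1.
  have dN : is_derive t 1 (fun y : R => - y^-1) (t ^- 2).
    by have := is_deriveN dV; rewrite opprK.
  have dE : is_derive t 1 (fun y : R => expR (- y^-1)) (expR (- t^-1) * t ^- 2).
    by apply: (@is_derive1_comp _ expR (fun y : R => - y^-1)).
  have dX : is_derive t 1 (fun y : R => y^-1 ^+ m) (m%:R * t^-1 ^+ m.-1 * - t ^- 2).
    rewrite (_ : (fun y : R => y^-1 ^+ m) = (fun y : R => y^-1) ^+ m); first exact: is_deriveX.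
    by apply/funext => y; elim: (m) => // k IH; rewrite !exprS IH.
  have := deriv_atM dX dE; congr (is_derive _ _ _ _).
  rewrite -!exprVn; case: (m) => [|k].
    by rewrite !expr0 !mul0r mulr0 addr0 subr0 mul1r mulrC.
  by rewrite /= !exprS; set E := expR _; set y := t^-1; set z := y ^+ k; ring.
- rewrite /deriv_at; have flat0 k : flat k 0 = 0 by rewrite /flat ltxx.
  rewrite !flat0 mulr0 subr0.
  have c0 : (fun h : R => h^-1 *: ((flat m \o shift 0) (h *: 1) - flat m 0)) @ 0^' --> (0 : R).
    apply/cvgrPdist_lt => e e0; near=> h.
    have hn0 : h != 0 by near: h; exact: nbhs_dnbhs_neq.
    rewrite sub0r normrN /= addr0 [h *: 1]mulr1 flat0 subr0.
    (* The difference quotient at 0 is again a member of the family, so [flat_le] applies to it. *)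
    have -> : h^-1 *: flat m h = flat m.+1 h.
      rewrite /flat; case: ifPn => h0; last by rewrite scaler0.
      by rewrite exprS [LHS]mulrA.
    apply: le_lt_trans (flat_le _ _) _.
    rewrite mulrC -ltr_pdivlMr ?ltr0n ?fact_gt0//.
    near: h; apply: dnbhs0_lt; rewrite divr_gt0// ltr0n fact_gt0//.
  split; first by apply/cvg_ex; exists 0.
  by apply/cvg_lim.
Unshelve. all: by end_near. Qed.

Lemma smooth1_flat m : smooth1 (flat m).
Proof.
move=> k; elim: k m => [//|k IH] m.
apply: nderivable_is_derive (is_derive_flat m) _.
have -> : (fun t => flat m.+2 t - m%:R * flat m.+1 t) =
  (fun t => flat m.+2 t + (- m%:R) * flat m.+1 t) by apply/funext => t; rewrite mulNr.
by apply: nderivableD => //; apply: nderivableM => //; exact: nderivable_cst.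
Qed.

(* [k] controls the sharpness: these functions increase to the indicator of ]a, b[ with [k]. *)
Definition smooth_bump (a b : R) (k : nat) (t : R) : R :=
  flat 0 (k.+1%:R * (t - a)) * flat 0 (k.+1%:R * (b - t)).

Lemma smooth1_smooth_bump a b k : smooth1 (smooth_bump a b k).
Proof.
move=> j; apply: nderivableM.
  have -> : (fun t => flat 0 (k.+1%:R * (t - a))) = fun t => flat 0 (k.+1%:R * t + - (k.+1%:R * a)).
    by apply/funext => t; rewrite mulrBr.
  exact/nderivable_affine/smooth1_flat.
have -> : (fun t => flat 0 (k.+1%:R * (b - t))) = fun t => flat 0 ((- k.+1%:R) * t + (k.+1%:R * b)).
  by apply/funext => t; rewrite mulrBr addrC mulNr.
exact/nderivable_affine/smooth1_flat.
Qed.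

Lemma flat0_le1 t : flat 0 t <= 1.
Proof.
rewrite /flat; case: ifPn => // t0; rewrite expr0 mul1r -expR0 ler_expR.
by rewrite oppr_le0 invr_ge0 ltW.
Qed.

Lemma smooth_bump_ge0 a b k t : 0 <= smooth_bump a b k t.
Proof. by rewrite mulr_ge0// flat_ge0. Qed.

Lemma smooth_bump_le1 a b k t : smooth_bump a b k t <= 1.
Proof. by rewrite mulr_ile1 ?flat_ge0 ?flat0_le1. Qed.

Lemma smooth_bump_gt0 a b k t : a < t < b -> 0 < smooth_bump a b k t.
Proof.
move=> /andP[ta tb]; rewrite mulr_gt0//= /flat ifT ?expr0 ?mul1r ?expR_gt0//.
  by rewrite mulr_gt0// subr_gt0.
by rewrite mulr_gt0// subr_gt0.
Qed.

Lemma smooth_bump_out a b k t : ~~ (a < t < b) -> smooth_bump a b k t = 0.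
Proof.
rewrite negb_and -!leNgt => /orP[h|h]; rewrite /smooth_bump /flat.
  by rewrite ifF ?mul0r// ltNge; apply/negbTE; rewrite negbK mulr_ge0_le0// subr_le0.
by rewrite [X in _ * X]ifF ?mulr0// ltNge; apply/negbTE; rewrite negbK mulr_ge0_le0// subr_le0.
Qed.

Lemma cvg_smooth_bump a b t : smooth_bump a b ^~ t @ \oo --> (if a < t < b then 1 else 0 : R).
Proof.
case: (boolP (a < t < b)) => tab; last first.
  by rewrite (_ : smooth_bump a b ^~ t = fun=> 0); [exact: cvg_cst|apply/funext => k; exact: smooth_bump_out].
have cflat c : 0 < c -> (fun k => flat 0 (k.+1%:R * c)) @ \oo --> (1 : R).
  move=> c0; rewrite (_ : (fun k => _) = (fun k => expR (- (c^-1 * k.+1%:R^-1)))).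
    rewrite -[X in _ --> X]expR0; apply: continuous_cvg; first exact: continuous_expR.
    rewrite -[X in _ --> X]oppr0; apply: cvgN; rewrite -[X in _ --> X](mulr0 c^-1).
    by apply: cvgM; [exact: cvg_cst|exact: cvg_harmonic].
  by apply/funext => k; rewrite /flat ifT ?mulr_gt0// expr0 mul1r invfM mulrC.
move: tab => /andP[ta tb]; rewrite -[X in _ --> X](mulr1 1).
by apply: cvgM; apply: cflat; rewrite subr_gt0.
Qed.

End smooth1_theory.

(** * Test functions *)

Section test_functions.
Context {R : realType} {n : nat}.
Implicit Types phi u f : 'rV[R]_n -> R.
Local Notation mu := (@lebesgue_rV R n).

(** A form of compact support that avoids closures; [test_functionP] shows that it is equivalent. *)
Definition bsupp phi := exists r : R, forall x, r < enorm x -> phi x = 0.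

Lemma cube_enorm (r : R) (x : 'rV[R]_n) : cube r x -> enorm x <= n%:R * r.
Proof.
move=> h; apply: le_trans (enorm_le_sum x) _.
rewrite mulr_natl -[n in leRHS]card_ord -sumr_const; apply: ler_sum => i _.
by have := h i; rewrite /= in_itv/= -ler_norml.
Qed.

Lemma enorm_cube (r : R) (x : 'rV[R]_n) : enorm x <= r -> cube r x.
Proof.
by move=> h i; rewrite /= in_itv/= -ler_norml (le_trans (normr_coord_enorm _ _)).
Qed.

Lemma test_functionP phi : test_function phi <-> smooth phi /\ bsupp phi.
Proof.
split=> -[sphi].
  move=> /compact_sub_cube[r r0 hr]; split => //; exists (n%:R * r) => x xr.
  apply/eqP; apply: contraTT xr => phix; rewrite -leNgt; apply: cube_enorm.
  by apply: hr; apply: subset_closure.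
move=> [r hr]; split => //.
apply: (subclosed_compact _ (@compact_cube R n r)); first exact: closed_closure.
rewrite [X in _ `<=` X](_ : _ = closure (cube r)); last first.
  by apply/closure_id; apply: compact_closed; [exact: norm_hausdorff|exact: compact_cube].
apply: closureS => x /= phix; apply: enorm_cube; rewrite leNgt.
by apply: contra_neqN phix => /hr.
Qed.

Lemma test_smooth phi : test_function phi -> smooth phi. Proof. by case. Qed.

Lemma test_bsupp phi : test_function phi -> bsupp phi.
Proof. by move=> /test_functionP[]. Qed.

Lemma test_partial phi (i : 'I_n) : test_function phi ->
  test_function (fun x => 'D_('e_i) phi x).
Proof.
move=> /test_functionP[sphi [r hr]]; apply/test_functionP; split.
  exact: smooth_partial.
(* From a point outside radius [r + 1], moves of length less than 1 along ['e_i] stay where [phi]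
   vanishes. *)
exists (r + 1) => x xr.
suff : is_derive x ('e_i : 'rV[R]_n) phi 0 by move=> [].
apply/is_derive_lineP; apply: (near_eq_is_derive (f := cst 0)).
near=> h; apply/esym/hr.
have h1 : `|h| < 1 by near: h; apply/nbhs_ballP; exists 1 => //= y; rewrite -ball_normE /= sub0r normrN.
have e1 : enorm ('e_i : 'rV[R]_n) = 1.
  apply/eqP; rewrite -(@eqrXn2 _ 2) ?enorm_ge0// expr1n sqr_enorm (bigD1 i)//= big1.
    by rewrite mxE !eqxx expr1n addr0.
  by move=> j ji; rewrite mxE (negbTE ji) andbF expr0n.
have : enorm x <= enorm (h *: 'e_i + x) + `|h|.
  have := enormD (h *: 'e_i + x) (- (h *: 'e_i)).
  by rewrite addrAC subrr add0r enormN enormZ e1 mulr1.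
by move=> h2; lra.
Unshelve. all: by end_near. Qed.

Lemma enorm_simil a r (Q : 'M[R]_n) (x : 'rV[R]_n) : 0 < r -> Q *m Q^T = 1%:M ->
  r * enorm x <= enorm (simil a r Q x) + enorm a.
Proof.
move=> r0 QQ; rewrite -(enorm_orthogonal x QQ) -[r in leLHS]gtr0_norm// -enormZ.
have := enormD (simil a r Q x) (- a); rewrite enormN; apply: le_trans.
by rewrite /simil addrAC subrr add0r.
Qed.

Lemma simil_affine a r (Q : 'M[R]_n) x : simil a r Q x = a + x *m (r *: Q).
Proof. by rewrite /simil scalemxAr. Qed.

Lemma test_comp_simil phi a r (Q : 'M[R]_n) : 0 < r -> Q *m Q^T = 1%:M ->
  test_function phi -> test_function (phi \o simil a r Q).
Proof.
move=> r0 QQ /test_functionP[sphi [s hs]]; apply/test_functionP; split.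
  rewrite (_ : _ \o _ = fun x => phi (a + x *m (r *: Q))); first exact: smooth_comp_affine.
  by apply/funext => x; rewrite /= simil_affine.
exists (r^-1 * (s + enorm a)) => x; rewrite ltr_pdivrMl// => h /=.
by apply: hs; have := enorm_simil a x r0 QQ; lra.
Qed.

Lemma bsupp_bounded f : continuous f -> bsupp f -> exists2 M : R, 0 <= M & forall x, `|f x| <= M.
Proof.
move=> cf [r hr].
have : compact (f @` cube r).
  by apply: continuous_compact; [exact: continuous_subspaceT|exact: compact_cube].
move=> /compact_bounded[M [Mreal KM]]; exists (`|M| + 1); first by rewrite addr_ge0.
move=> x; have [xr|xr] := leP (enorm x) r; last by rewrite hr// normr0 addr_ge0.
apply: (KM (`|M| + 1)); first by rewrite (le_lt_trans (ler_norm _))// ltrDl.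
by exists x => //; exact: enorm_cube.
Qed.

Lemma test_bounded phi : test_function phi -> exists2 M : R, 0 <= M & forall x, `|phi x| <= M.
Proof.
move=> tphi; apply: bsupp_bounded; last exact: test_bsupp.
exact/smooth_continuous/test_smooth.
Qed.

Lemma test_measurable phi : test_function phi -> measurable_fun setT phi.
Proof. by move=> [/smooth_continuous/continuous_measurable_rV]. Qed.

Lemma integrable_mul_bsupp u f : locally_integrable_rV u -> continuous f -> bsupp f ->
  mu.-integrable setT (EFin \o (fun x => u x * f x)).
Proof.
move=> [mu_ lu] cf bf; have [M M0 hM] := bsupp_bounded cf bf; case: bf => r hr.
have mf := continuous_measurable_rV cf.
apply/integrableP; split; first by apply/measurable_EFinP; exact: measurable_funM.
have mK := @measurable_cube R n r.
have mau : measurable_fun setT (fun x => `|u x|%:E).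
  by apply/measurable_EFinP; apply: measurableT_comp.
apply: (@le_lt_trans _ _ (\int[mu]_(x in cube r) (M%:E * `|u x|%:E))%E).
  rewrite [leRHS]integral_mkcond; apply: ge0_le_integral => //.
  - by apply: measurableT_comp => //; apply/measurable_EFinP; exact: measurable_funM.
  - apply/(measurable_restrictT _ _).1 => //.
    by apply: measurable_funTS; apply: measurable_funeM.
  move=> x _; rewrite /patch; case: ifPn => [xK|]; rewrite /= -?EFinM lee_fin normrM.
    by rewrite mulrC ler_wpM2r.
  rewrite notin_setE => xK; rewrite hr ?normr0 ?mulr0// ltNge; apply/negP => /enorm_cube.
  exact: xK.
rewrite ge0_integralZl//; last by apply: measurable_funTS.
by rewrite lte_mul_pinfty//; apply: lu; exact: compact_cube.
Qed.

Lemma integrable_mul_test u phi : locally_integrable_rV u -> test_function phi ->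
  mu.-integrable setT (EFin \o (fun x => u x * phi x)).
Proof.
move=> lu tphi; apply: integrable_mul_bsupp => //; last exact: test_bsupp.
exact/smooth_continuous/test_smooth.
Qed.

Lemma continuous_locally_integrable u : continuous u -> locally_integrable_rV u.
Proof.
move=> cu; have mu_ := continuous_measurable_rV cu; split => // K cK.
have mK := compact_measurable_rV cK.
have : compact (u @` K) by apply: continuous_compact => //; exact: continuous_subspaceT.
move=> /compact_bounded[M [Mreal KM]].
have {}KM x : K x -> `|u x| <= `|M| + 1.
  by move=> Kx; apply: (KM (`|M| + 1)); [rewrite (le_lt_trans (ler_norm _))// ltrDl|exists x].
apply: (@le_lt_trans _ _ (\int[mu]_(x in K) (`|M| + 1)%:E)%E).
  apply: ge0_le_integral => //.
  by apply: measurable_funTS; apply/measurable_EFinP; exact: measurableT_comp.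
rewrite integral_cst// lte_mul_pinfty//.
have [r r0 Kr] := compact_sub_cube cK.
apply: (@le_lt_trans _ _ (mu (cube r))).
  by apply: le_measure; rewrite ?inE//; exact: measurable_cube.
by rewrite lebesgue_cube ?ltry// ltW.
Qed.

Definition tens (F : 'I_n -> R -> R) (x : 'rV[R]_n) : R := \prod_i F i (x 0 i).

Definition upd (F : 'I_n -> R -> R) (j : 'I_n) (g : R -> R) : 'I_n -> R -> R :=
  fun i => if i == j then g else F i.

Lemma tens_upd F j g x : tens (upd F j g) x = g (x 0 j) * \prod_(i | i != j) F i (x 0 i).
Proof.
rewrite /tens (bigD1 j)//= /upd eqxx; congr (_ * _).
by apply: eq_bigr => i /negbTE ->.
Qed.

Lemma is_derive_tens F j (x : 'rV[R]_n) g : (forall t : R, deriv_at (F j) t (g t)) ->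
  is_derive x 'e_j (tens F) (tens (upd F j g) x).
Proof.
move=> dF; apply/is_derive_lineP; rewrite tens_upd.
have -> : (fun h : R => tens F (h *: 'e_j + x)) =
    (fun h => F j (1 * h + x 0 j) * \prod_(i | i != j) F i (x 0 i)).
  apply/funext => h; rewrite /tens (bigD1 j)//= !mxE !eqxx mulr1 mul1r; congr (_ * _).
  by apply: eq_bigr => i ij; rewrite !mxE (negbTE ij) andbF mulr0 add0r.
set c := \prod_(i | _) _.
have dF1 : deriv_at (fun h => F j (1 * h + x 0 j)) 0 (g (x 0 j)).
  have := deriv_at_comp (dF _) (deriv_at_affine 1 (x 0 j) 0).
  by rewrite mulr1 mulr0 add0r.
have := deriv_atM dF1 (is_derive_cst c (0 : R) 1).
by rewrite mulr0 add0r mulrC.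
Qed.

Lemma smooth1P g : smooth1 g -> (forall t : R, deriv_at g t (g^`()%classic t)) /\ smooth1 g^`()%classic.
Proof.
move=> sg; split; first by move=> t; have /nderivableS_is_derive[] := sg 1%N.
by move=> k; have [] := sg k.+1.
Qed.

Lemma smooth1_continuous (g : R -> R) : smooth1 g -> continuous g.
Proof.
move=> /smooth1P[dg _] t; apply/differentiable_continuous/derivable1_diffP.
by have [] := dg t.
Qed.

Lemma smooth_tens F : (forall i, smooth1 (F i)) -> smooth (tens F).
Proof.
pose K f := exists2 F, (forall i, smooth1 (F i)) & f = tens F.
move=> sF; apply: (@smooth_coind _ _ K); last by exists F.
move=> {F sF} f [F sF ->]; split.
  have -> : tens F = fun x => \prod_i F i (x 0 i) by [].
  apply: continuous_big => [|i _ y]; first exact: mul_continuous.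
  apply: continuous_comp; first exact: coord_continuous.
  exact: smooth1_continuous.
move=> j; have [dF sF'] := smooth1P (sF j).
have der x := is_derive_tens x dF.
split; first by move=> x; have [] := der x.
exists (upd F j (F j)^`()%classic).
  by move=> i; rewrite /upd; case: ifPn.
by apply/funext => x; have [_ ->] := der x.
Qed.

Lemma test_tens F (r : R) : (forall i, smooth1 (F i)) ->
  (forall i t, r < `|t| -> F i t = 0) -> test_function (tens F).
Proof.
move=> sF hF; apply/test_functionP; split; first exact: smooth_tens.
exists (n%:R * r) => x xr.
have [i xi] : exists i, r < `|x 0 i|.
  apply: contrapT => /forallNP h; move: xr.
  rewrite ltNge => /negP; apply; apply: cube_enorm => i.
  by have /negP := h i; rewrite -leNgt /= in_itv/= -ler_norml.
by apply/eqP; apply/prodf_eq0; exists i => //; apply/eqP/hF.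
Qed.

End test_functions.

(** * Weak derivatives *)

Section fundamental_lemma.
Context {R : realType} {n : nat}.
Local Notation mu := (@lebesgue_rV R n).
Implicit Types g u phi : 'rV[R]_n -> R.

(** [None] stands for the whole line: the boxes then include the whole space and the cylinders over
    one coordinate, which generate the sigma-algebra, and remain closed under intersection. *)
Definition oitv (c : option (R * R)) : set R :=
  if c is Some ab then `]ab.1, ab.2[%classic else setT.

Definition oboxes : set (set 'rV[R]_n) :=
  [set B | exists c : 'I_n -> option (R * R), B = prod_rV (fun i => oitv (c i))].

Definition oitvI (c d : option (R * R)) : option (R * R) :=
  match c, d with
  | None, _ => d
  | _, None => c
  | Some ab, Some ab' => Some (Num.max ab.1 ab'.1, Num.min ab.2 ab'.2)
  end.

Lemma oitvIE c d : oitv (oitvI c d) = oitv c `&` oitv d.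
Proof.
case: c => [[a b]|]; case: d => [[a' b']|]; rewrite /= ?setTI ?setIT//.
apply/seteqP; split => x /=; rewrite !in_itv/= gt_max lt_min.
  by move=> /andP[/andP[-> ->] /andP[-> ->]].
by move=> [/andP[-> ->] /andP[-> ->]].
Qed.

Lemma prod_rV_oitvI c d : prod_rV (fun i : 'I_n => oitv (c i)) `&` prod_rV (fun i => oitv (d i)) =
  prod_rV (fun i => oitv (oitvI (c i) (d i))).
Proof.
apply/seteqP; split => x; rewrite /prod_rV /=.
  by move=> [h1 h2] i; rewrite oitvIE; split.
by move=> h; split => i; have := h i; rewrite oitvIE => -[].
Qed.

Lemma measurable_oitv c : measurable (oitv c).
Proof. by case: c => [[a b]|] /=. Qed.

Lemma measurable_rV_oboxes : @measurable _ 'rV[R]_n = <<s oboxes >>.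
Proof.
apply/seteqP; split.
  apply: smallest_sub; first exact: smallest_sigma_algebra.
  rewrite -bigcup_seq/=; apply: bigcup_sub => i _ A [B mB <-]; rewrite setTI.
  move: B mB; rewrite /measurable/= -/(measurable _) => B.
  rewrite -[X in X B -> _]/(@measurable _ (measurableTypeR R)).
  rewrite [X in X B -> _](RGenOpens.measurableE R); move: B.
  suff : <<s @RGenOpens.G R >> `<=` [set B | <<s oboxes >> ((fun x : 'rV[R]_n => x 0 i) @^-1` B)] by [].
  apply: smallest_sub.
    split => /=.
    - by rewrite preimage_set0; exact: sigma_algebra0.
    - by move=> D hD; rewrite setTD preimage_setC -setTD; exact: sigma_algebraCD.
    - by move=> D hD; rewrite preimage_bigcup; exact: sigma_algebra_bigcup.
  move=> _ [a [b ->]]; apply: sub_sigma_algebra.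
  exists (fun j => if j == i then Some (a, b) else None).
  apply/seteqP; split => x /=; rewrite /prod_rV /=.
    by move=> xi j; case: eqP => // ->.
  by move=> /(_ i); rewrite eqxx.
apply: smallest_sub; first by split;
  [exact: measurable0|move=> A mA; exact: measurableD|move=> F mF; exact: bigcupT_measurable].
by move=> _ [c ->]; apply: measurable_prod_rV => i; exact: measurable_oitv.
Qed.

(** The measurable sets on which [h] integrates to zero form a Dynkin system, and boxes are closed
    under intersection. *)
Lemma integral_oboxes0 (h : 'rV[R]_n -> \bar R) : mu.-integrable setT h ->
  (forall B, oboxes B -> \int[mu]_(x in B) h x = 0)%E ->
  forall E, measurable E -> (\int[mu]_(x in E) h x = 0)%E.
Proof.
move=> ih h0 E mE; have hT : (\int[mu]_x h x = 0)%E.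
  apply: h0; exists (fun=> None); apply/seteqP; by split.
suff : forall S, <<s oboxes >> S -> (\int[mu]_(x in S) h x = 0)%E.
  by apply; rewrite -measurable_rV_oboxes.
apply: dynkin_induction => //.
- exact: measurable_rV_oboxes.
- by move=> _ _ [c ->] [d ->]; exists (fun i => oitvI (c i) (d i)); rewrite prod_rV_oitvI.
- move=> S mS S0.
  have := @integral_setU _ _ _ mu _ _ h mS (measurableC mS).
  rewrite setUCr S0 hT add0e => <-//.
    by apply: measurable_int; exact: ih.
  by rewrite disj_set2E setICr.
- move=> F mF tF F0; rewrite integral_bigcup//.
    by rewrite eseries0// => i _ _; exact: F0.
  by apply: integrableS ih => //; exact: bigcupT_measurable.
Qed.

(** Products of ever sharper bumps converge pointwise to the indicator of the open box, and against
    [g] they are dominated by [|g|] on a cube containing it; dominated convergence carries the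
    vanishing over to the box. *)
Lemma integral_obox0 g : locally_integrable_rV g ->
  (forall phi, test_function phi -> \int[mu]_x (g x * phi x) = 0) ->
  forall c : 'I_n -> R * R,
  (\int[mu]_(x in prod_rV (fun i => oitv (Some (c i)))) (g x)%:E = 0)%E.
Proof.
move=> lg g0 c; set B := prod_rV _.
pose phi k := tens (fun i => smooth_bump (c i).1 (c i).2 k).
have [r [r0 hr]] : exists r : R, 0 <= r /\ forall i, `|(c i).1| <= r /\ `|(c i).2| <= r.
  exists (\sum_i (`|(c i).1| + `|(c i).2|)); split; first by apply: sumr_ge0 => i _; exact: addr_ge0.
  move=> i; have hi : `|(c i).1| + `|(c i).2| <= \sum_i (`|(c i).1| + `|(c i).2|).
    by rewrite [leRHS](bigD1 i)//= lerDl sumr_ge0// => j _; exact: addr_ge0.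
  by split; apply: le_trans hi; rewrite ?lerDl ?lerDr.
have tphi k : test_function (phi k).
  apply: (@test_tens _ _ _ r) => [i|i t rt]; first exact: smooth1_smooth_bump.
  apply: smooth_bump_out; apply: contraTN rt => /andP[h1 h2]; rewrite -leNgt ler_norml.
  have [] := hr i; rewrite !ler_norml => /andP[? ?] /andP[? ?].
  by apply/andP; split; lra.
have mB : measurable B by apply: measurable_prod_rV => i; exact: measurable_oitv.
have BK : B `<=` cube r.
  move=> x Bx i; have := Bx i; rewrite /= !in_itv/= => /andP[h1 h2].
  have [] := hr i; rewrite !ler_norml => /andP[? ?] /andP[? ?].
  by apply/andP; split; lra.
have [mg lg'] := lg.
have mK := @measurable_cube R n r.
pose G : 'rV[R]_n -> \bar R := (fun x => `|g x|%:E) \_ (cube r).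
have iG : mu.-integrable setT G.
  apply/(integrable_mkcond _ mK); apply/integrableP; split.
    by apply: measurable_funTS; apply/measurable_EFinP; exact: measurableT_comp.
  rewrite (_ : (fun x => _) = fun x => `|g x|%:E); first by apply: lg'; exact: compact_cube.
  by apply/funext => x; rewrite gee0_abs// lee_fin.
have mgB : measurable_fun setT ((fun x => (g x)%:E) \_ B).
  by apply/(measurable_restrictT _ _).1 => //; apply: measurable_funTS; exact/measurable_EFinP.
rewrite integral_mkcond.
have phi01 k x : 0 <= phi k x <= 1.
  apply/andP; split; first by apply: prodr_ge0 => i _; exact: smooth_bump_ge0.
  by apply: prodr_ile1 => i _; rewrite smooth_bump_ge0 smooth_bump_le1.
have phiout k x : ~ B x -> phi k x = 0.
  move=> nBx; have [i nBi] : exists i, ~ oitv (Some (c i)) (x 0 i).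
    by apply: contrapT => /forallNP h; apply: nBx => i; apply: contrapT; exact: h.
  apply/eqP/prodf_eq0; exists i => //; apply/eqP/smooth_bump_out/negP.
  by move: nBi; rewrite /= in_itv.
have := @dominated_convergence _ _ R mu setT measurableT
  (fun k x => (g x * phi k x)%:E) ((fun x => (g x)%:E) \_ B) G _ mgB _ iG _.
case.
- move=> k; apply/measurable_EFinP; apply: measurable_funM => //.
  exact: test_measurable.
- apply: aeW => x _; rewrite /patch; case: ifPn => [/set_mem Bx|].
    apply: cvg_EFin; first by near=> k.
    rewrite -[X in _ --> X](mulr1 (g x)); apply: cvgM; first exact: cvg_cst.
    rewrite (_ : 1 = \prod_(i < n) (1 : R)); last by rewrite big1.
    apply: cvg_big => [|i _]; first exact: mul_continuous.
    have := @cvg_smooth_bump R (c i).1 (c i).2 (x 0 i).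
    by have := Bx i; rewrite /= in_itv/= => ->.
  rewrite notin_setE => nBx; rewrite (_ : (fun k => _) = cst 0%E); first exact: cvg_cst.
  by apply/funext => k; rewrite /= phiout// mulr0.
- apply: aeW => x k _; rewrite /G /patch; case: ifPn => [xK|].
    rewrite lee_fin normrM ler_piMr//.
    by have /andP[p0 p1] := phi01 k x; rewrite ger0_norm.
  by rewrite notin_setE => nK; rewrite phiout ?mulr0 ?abse0// => /BK.
move=> _ _ cv.
have : (fun k => \int[mu]_x (g x * phi k x)%:E)%E @ \oo --> (0 : \bar R).
  rewrite (_ : (fun k => _) = cst 0%E); first exact: cvg_cst.
  apply/funext => k /=; have := g0 _ (tphi k); rewrite /Rintegral.
  have := integrable_fin_num measurableT (integrable_mul_test lg (tphi k)).
  by move=> /fineK {2}<- ->.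
by apply: cvg_unique; [exact: ereal_hausdorff|exact: cv].
Unshelve. all: by end_near. Qed.

(** Since [g] is only locally integrable, the Dynkin argument is run on its restriction to each open
    cube [K k]; these cubes exhaust the space. *)
Lemma ae_eq0_test g : locally_integrable_rV g ->
  (forall phi, test_function phi -> \int[mu]_x (g x * phi x) = 0) ->
  {ae mu, forall x, g x = 0}.
Proof.
move=> lg g0; have [mg lg'] := lg.
pose K k : set 'rV[R]_n := prod_rV (fun i => oitv (Some (- k%:R, k%:R))).
have mK k : measurable (K k) by apply: measurable_prod_rV => i; exact: measurable_oitv.
have h k : {ae mu, forall x, ((fun x => (g x)%:E) \_ (K k)) x = 0%E}.
  have ig : mu.-integrable setT ((fun x => (g x)%:E) \_ (K k)).
    apply/(integrable_mkcond _ (mK k)); apply/integrableP; split.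
      by apply: measurable_funTS; exact/measurable_EFinP.
    apply: (@le_lt_trans _ _ (\int[mu]_(x in cube k%:R) `|g x|%:E)%E); last by apply: lg'; exact: compact_cube.
    apply: ge0_subset_integral => //; first exact: measurable_cube.
      by apply: measurable_funTS; apply/measurable_EFinP; exact: measurableT_comp.
    by move=> x Kx i; have := Kx i; rewrite /= !in_itv/= => /andP[? ?]; rewrite !ltW.
  have := @integral_ae_eq _ _ R mu setT measurableT (cst 0%E) _ ig (measurable_cst _).
  case.
    move=> E _ mE; rewrite integral_cst// mul0e; apply: integral_oboxes0 => // _ [d ->].
    rewrite -integral_mkcondr prod_rV_oitvI.
    (* Intersecting with the cube replaces every unbounded side by a bounded one, so
       [integral_obox0] covers all boxes. *)
    have -> : prod_rV (fun i => oitv (oitvI (d i) (Some (- k%:R, k%:R)))) =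
       prod_rV (fun i => oitv (Some
          (if d i is Some ab then (Num.max ab.1 (- k%:R), Num.min ab.2 k%:R) else (- k%:R, k%:R)))).
      by congr prod_rV; apply/funext => i; case: (d i).
    exact: integral_obox0.
  by move=> A [mA A0 HA]; exists A; split => // x Hx; apply: HA => /=; apply: contra_not Hx; apply.
have : {ae mu, forall x, forall k, ((fun x => (g x)%:E) \_ (K k)) x = 0%E} by exact: ae_foralln.
apply: filterS => x Hx.
have [k Kx] : exists k, K k x.
  exists (Num.truncn (enorm x)).+1 => i; rewrite /= in_itv/= -ltr_norml.
  apply: le_lt_trans (normr_coord_enorm _ _) _; rewrite truncnS_gt//.
by have := Hx k; rewrite /patch mem_set// => -[].
Qed.

End fundamental_lemma.

(** * Calculus of weak partial derivatives *)

Section weak_partials.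
Context {R : realType} {n : nat}.
Local Notation mu := (@lebesgue_rV R n).
Implicit Types g h u v phi : 'rV[R]_n -> R.

Lemma Rintegral_shift (f : 'rV[R]_n -> R) (a : 'rV[R]_n) :
  mu.-integrable setT (EFin \o f) -> \int[mu]_x f (x + a) = \int[mu]_x f x.
Proof.
move=> fi; have := @Rintegral_simil R n a 1 1%:M f ltr01 _ fi.
rewrite trmx1 mulmx1 expr1n invr1 mul1r => <-//.
by congr Rintegral; apply/funext => x; rewrite /simil mulmx1 scale1r addrC.
Qed.

Lemma integrable_shift (f : 'rV[R]_n -> R) (a : 'rV[R]_n) :
  mu.-integrable setT (EFin \o f) -> mu.-integrable setT (EFin \o (fun x => f (x + a))).
Proof.
move=> fi; have := @integrable_simil R n a 1 1%:M _ ltr01 _ fi.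
rewrite trmx1 mulmx1 => /(_ erefl); congr (_.-integrable _ _).
by apply/funext => x; rewrite /= /simil mulmx1 scale1r addrC.
Qed.

Lemma cube_lty (r : R) : (mu (cube r) < +oo)%E.
Proof.
apply: (@le_lt_trans _ _ (mu (cube `|r|))); last by rewrite lebesgue_cube// ltry.
by apply: le_measure; rewrite ?inE//; [exact: measurable_cube..|apply: cubeS; exact: ler_norm].
Qed.

Lemma locally_integrable_cst (c : R) : locally_integrable_rV (fun _ : 'rV[R]_n => c).
Proof. by apply: continuous_locally_integrable; exact: cst_continuous. Qed.

Lemma integrable_test phi : test_function phi -> mu.-integrable setT (EFin \o phi).
Proof.
move=> tphi; have := integrable_mul_test (locally_integrable_cst 1) tphi.
by congr (_.-integrable _ _); apply/funext => x /=; rewrite mul1r.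
Qed.

(** The derivative is the limit of the difference quotients [q k], whose integrals vanish by
    translation invariance. The mean value theorem bounds them uniformly and they live in a fixed
    cube, so dominated convergence applies. *)
Lemma Rintegral_partial_test phi (i : 'I_n) : test_function phi ->
  \int[mu]_x 'D_('e_i) phi x = 0.
Proof.
move=> tphi; have tD := test_partial i tphi.
have [sphi [r hr]] := (test_functionP phi).1 tphi.
have [M M0 hM] := test_bounded tD.
have dphi x : derivable phi x 'e_i by exact: smooth_derivable.
pose q (k : nat) x := k.+1%:R * (phi (x + k.+1%:R^-1 *: 'e_i) - phi x).
have e1 : enorm ('e_i : 'rV[R]_n) = 1.
  apply/eqP; rewrite -(@eqrXn2 _ 2) ?enorm_ge0// expr1n sqr_enorm (bigD1 i)//= big1.
    by rewrite mxE !eqxx expr1n addr0.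
  by move=> j ji; rewrite mxE (negbTE ji) andbF expr0n.
have iphi := integrable_test tphi.
have iq k : mu.-integrable setT (EFin \o (fun x => phi (x + k.+1%:R^-1 *: 'e_i) - phi x)).
  by have := integrableB measurableT (integrable_shift (k.+1%:R^-1 *: 'e_i) iphi) iphi.
have q0 k : (\int[mu]_x (q k x)%:E = 0)%E.
  have iqk : mu.-integrable setT (EFin \o q k).
    by have := integrableZl measurableT k.+1%:R (iq k).
  rewrite -(fineK (integrable_fin_num measurableT iqk)); congr EFin.
  rewrite -/(Rintegral _ _ _) /q RintegralZl//.
  by rewrite RintegralB//; [rewrite Rintegral_shift// subrr mulr0|exact: integrable_shift].
(* The increments are at most 1, so enlarging [r] by 1 covers the supports of all [q k]. *)
pose K := @cube R n (r + 1).
have mK : measurable K by exact: measurable_cube.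
pose G : 'rV[R]_n -> \bar R := (cst M%:E) \_ K.
have iG : mu.-integrable setT G.
  apply/(integrable_mkcond _ mK); apply/integrableP; split; first exact: measurable_cst.
  under eq_integral do rewrite /= ger0_norm//.
  rewrite integral_cst// lte_mul_pinfty// /K.
  exact: cube_lty.
have := @dominated_convergence _ _ R mu setT measurableT
  (fun k x => (q k x)%:E) (fun x => ('D_('e_i) phi x)%:E) G _ _ _ iG _.
case.
- move=> k; apply/measurable_EFinP; apply: measurable_funM => //.
  by apply/measurable_EFinP; apply: measurable_int; exact: iq.
- by apply/measurable_EFinP; exact: test_measurable.
- apply: aeW => x _; apply: cvg_EFin; first by near=> k.
  have := dphi x; rewrite /derivable => dx.
  have cq : (fun h : R => h^-1 *: ((phi \o shift x) (h *: 'e_i) - phi x)) @ 0^' --> 'D_('e_i) phi x.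
    exact: dx.
  move/cvgr_dnbhsP : cq => /(_ (fun k => k.+1%:R^-1)) cq.
  suff : q ^~ x @ \oo --> 'D_('e_i) phi x by [].
  have -> : q ^~ x = (fun k : nat => (k.+1%:R^-1)^-1 *:
      ((phi \o shift x) (k.+1%:R^-1 *: 'e_i) - phi x)).
    by apply/funext => k; rewrite /q invrK /= [X in phi X]addrC.
  by apply: cq; split; [move=> k; rewrite invr_neq0|exact: cvg_harmonic].
- apply: aeW => x k _; rewrite /G /patch; case: ifPn => [xK|].
    rewrite lee_fin /q [x + _]addrC.
    have [c _ ->] := mvt_dir dphi x k.+1%:R^-1.
    by rewrite mulrA mulfV// mul1r.
  rewrite notin_setE => nK.
  have xr : r + 1 < enorm x.
    by rewrite ltNge; apply/negP => /enorm_cube.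
  rewrite /q [phi x]hr; last by apply: lt_trans xr; rewrite ltrDl.
  rewrite hr ?subrr ?mulr0 ?abse0//.
  have := enormD (x + k.+1%:R^-1 *: 'e_i) (- (k.+1%:R^-1 *: 'e_i)).
  rewrite addrK enormN enormZ e1 mulr1 ger0_norm// => h1.
  have : k.+1%:R^-1 <= 1 :> R by rewrite invf_le1// ler1n.
  move=> h2; rewrite -(ltrD2r k.+1%:R^-1); apply: lt_le_trans h1.
  by apply: le_lt_trans xr; rewrite lerD2l.
move=> _ _ cv; rewrite /Rintegral.
have : (fun k => \int[mu]_x (q k x)%:E)%E @ \oo --> (0 : \bar R).
  rewrite (_ : (fun k => _) = cst 0%E); first exact: cvg_cst.
  by apply/funext => k; exact: q0.
by move=> /(cvg_unique (@ereal_hausdorff R) cv) ->.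
Unshelve. all: by end_near. Qed.

Lemma locally_integrableD (a b : R) g h : locally_integrable_rV g -> locally_integrable_rV h ->
  locally_integrable_rV (fun x => a * g x + b * h x).
Proof.
move=> [mg lg] [mh lh].
have m : measurable_fun setT (fun x => a * g x + b * h x).
  by apply: measurable_funD; apply: measurable_funM.
split => // K cK; have mK := compact_measurable_rV cK.
have mg' : measurable_fun K (fun x => `|g x|%:E).
  by apply: measurable_funTS; apply/measurable_EFinP; exact: measurableT_comp.
have mh' : measurable_fun K (fun x => `|h x|%:E).
  by apply: measurable_funTS; apply/measurable_EFinP; exact: measurableT_comp.
apply: (@le_lt_trans _ _ (\int[mu]_(x in K) (`|a|%:E * `|g x|%:E + `|b|%:E * `|h x|%:E))%E).
  apply: ge0_le_integral => //.
  - by apply: measurable_funTS; apply/measurable_EFinP; exact: measurableT_comp.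
  - by apply: emeasurable_funD; apply: measurable_funeM.
  - by move=> x _; rewrite -!EFinM -EFinD lee_fin -!normrM ler_normD.
rewrite ge0_integralD//; [|by apply: measurable_funeM..].
rewrite !ge0_integralZl// lte_add_pinfty// lte_mul_pinfty//; [exact: lg|exact: lh].
Qed.

Lemma weak_partial_unique i u g h : is_weak_partial i u g -> is_weak_partial i u h ->
  {ae mu, forall x, g x = h x}.
Proof.
move=> [lg wg] [lh wh].
have l := locally_integrableD 1 (-1) lg lh.
have : {ae mu, forall x, 1 * g x + -1 * h x = 0}.
  apply: ae_eq0_test => // phi tphi.
  have ig := integrable_mul_test lg tphi; have ih := integrable_mul_test lh tphi.
  have -> : (fun x => (1 * g x + -1 * h x) * phi x) = (fun x => g x * phi x - h x * phi x).
    by apply/funext => x; rewrite mul1r mulN1r mulrBl.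
  by rewrite RintegralB//; apply/eqP; rewrite subr_eq0 -eqr_opp -wg// -wh.
by apply: filterS => x; rewrite mul1r mulN1r => /subr0_eq.
Qed.

Lemma is_weak_partialD i (a b : R) u v g h :
  locally_integrable_rV u -> locally_integrable_rV v ->
  is_weak_partial i u g -> is_weak_partial i v h ->
  is_weak_partial i (fun x => a * u x + b * v x) (fun x => a * g x + b * h x).
Proof.
move=> lu lv [lg wg] [lh wh]; split; first exact: locally_integrableD.
have E f1 f2 phi : locally_integrable_rV f1 -> locally_integrable_rV f2 -> test_function phi ->
    \int[mu]_x ((a * f1 x + b * f2 x) * phi x) = a * \int[mu]_x (f1 x * phi x) + b * \int[mu]_x (f2 x * phi x).
  move=> l1 l2 tphi.
  have i1 := integrable_mul_test l1 tphi; have i2 := integrable_mul_test l2 tphi.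
  have -> : (fun x => (a * f1 x + b * f2 x) * phi x) = (fun x => a * (f1 x * phi x) + b * (f2 x * phi x)).
    by apply/funext => x; rewrite mulrDl !mulrA.
  rewrite RintegralD//; [|exact: (integrableZl measurableT a i1)|exact: (integrableZl measurableT b i2)].
  by rewrite !RintegralZl.
move=> phi tphi; rewrite (E _ _ _ lu lv (test_partial i tphi)) (E _ _ _ lg lh tphi).
by rewrite wg// wh// !mulrN opprD.
Qed.

Lemma is_weak_partial_cst (i : 'I_n) (c : R) : is_weak_partial i (fun=> c) (fun=> 0).
Proof.
split; first exact: locally_integrable_cst.
move=> phi tphi; rewrite RintegralZl//; last by apply: integrable_test; exact: test_partial.
rewrite Rintegral_partial_test// mulr0.
have -> : (fun x => 0 * phi x) = (fun=> 0) by apply/funext => x; rewrite mul0r.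
by rewrite Rintegral_cst// mul0r oppr0.
Qed.

End weak_partials.

(** * Vector fields in L^p *)

Section Lp_fields.
Context {R : realType} {n : nat} (p : R).
Hypothesis p1 : 1 <= p.
Local Notation mu := (@lebesgue_rV R n).
Implicit Types F G : 'rV[R]_n -> 'rV[R]_n.

Let p0 : 0 < p. Proof. exact: lt_le_trans p1. Qed.
Let pn0 : p != 0. Proof. by rewrite gt_eqF. Qed.
Let powRK (a : R) : 0 <= a -> (a `^ p) `^ p^-1 = a.
Proof. by move=> a0; rewrite -powRrM mulfV// powRr1. Qed.

(** The p-th power of the norm, kept extended-valued so that it can be computed before it is known
    to be finite. *)
Definition energy G : \bar R := (\int[mu]_x (enorm (G x) `^ p)%:E)%E.

Definition Lp_field G := measurable_fun setT G /\ (energy G < +oo)%E.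

(** [fine] sends an infinite norm to 0, so this number is meaningful only on [Lp_field]. *)
Definition pnorm G : R := fine (Lnorm_rV p G).

Lemma measurable_enorm_field G : measurable_fun setT G -> measurable_fun setT (fun x => enorm (G x)).
Proof. by move=> mG; apply: measurableT_comp => //; exact: measurable_enorm. Qed.

Lemma measurable_energy G : measurable_fun setT G -> measurable_fun setT (fun x => (enorm (G x) `^ p)%:E).
Proof.
move=> mG; apply/measurable_EFinP.
by apply: (measurableT_comp (measurable_powR p)); exact: measurable_enorm_field.
Qed.

Lemma energy_ge0 G : (0 <= energy G)%E.
Proof. by apply: integral_ge0 => x _; rewrite lee_fin powR_ge0. Qed.

Lemma Lnorm_rVE G : Lnorm_rV p G = (energy G `^ p^-1)%E.
Proof.
rewrite /Lnorm_rV unlock /energy.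
by under eq_integral do rewrite /= ger0_norm ?enorm_ge0//.
Qed.

Lemma Lp_field_norm G : Lp_field G -> Lnorm_rV p G = (pnorm G)%:E.
Proof.
move=> [mG eG]; rewrite /pnorm fineK// Lnorm_rVE ge0_fin_numE ?poweR_ge0//.
exact: poweR_lty.
Qed.

Lemma pnorm_ge0 G : 0 <= pnorm G.
Proof. by rewrite /pnorm fine_ge0// Lnorm_rVE poweR_ge0. Qed.

Lemma energyE G : Lp_field G -> energy G = (pnorm G `^ p)%:E.
Proof.
move=> LG; rewrite -poweR_EFin -Lp_field_norm// Lnorm_rVE -poweRrM mulVf//.
by rewrite poweRe1// energy_ge0.
Qed.

Lemma pnormE G (a : R) : energy G = (a `^ p)%:E -> 0 <= a -> pnorm G = a.
Proof. by move=> e a0; rewrite /pnorm Lnorm_rVE e poweR_EFin /= powRK. Qed.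

Lemma energyZ (c : R) G : measurable_fun setT G -> energy (fun x => c *: G x) = ((`|c| `^ p)%:E * energy G)%E.
Proof.
move=> mG; have e0 x : [set: 'rV[R]_n] x -> (0 <= (enorm (G x) `^ p)%:E)%E.
  by move=> _; rewrite lee_fin powR_ge0.
have c0 : (0 <= (`|c| `^ p)%:E)%E by rewrite lee_fin powR_ge0.
rewrite /energy -(ge0_integralZl mu measurableT (measurable_energy mG) e0 c0).
by apply: eq_integral => x _; rewrite enormZ powRM ?enorm_ge0// EFinM.
Qed.

Lemma measurable_rVZ (c : R) G : measurable_fun setT G -> measurable_fun setT (fun x => c *: G x).
Proof.
move=> mG; rewrite (_ : (fun x => _) = fun x => G x *m c%:M).
  exact: measurable_rV_mulmx.
by apply/funext => x; rewrite mul_mx_scalar.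
Qed.

Lemma Lp_fieldZ (c : R) G : Lp_field G -> Lp_field (fun x => c *: G x).
Proof.
move=> [mG eG]; split; first exact: measurable_rVZ.
by rewrite energyZ// lte_mul_pinfty// lee_fin powR_ge0.
Qed.

Lemma pnormZ (c : R) G : Lp_field G -> pnorm (fun x => c *: G x) = `|c| * pnorm G.
Proof.
move=> LG; apply: pnormE; last by rewrite mulr_ge0// pnorm_ge0.
by rewrite energyZ ?(energyE LG)// ?powRM ?pnorm_ge0//; case: LG.
Qed.

Lemma Lnorm_rVD F G : measurable_fun setT F -> measurable_fun setT G ->
  (Lnorm_rV p (fun x => (F x + G x)%R) <= Lnorm_rV p F + Lnorm_rV p G)%E.
Proof.
move=> mF mG.
have h := minkowski_EFin mu (measurable_enorm_field mF) (measurable_enorm_field mG) p1.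
apply: le_trans h; rewrite Lnorm_rVE unlock.
apply: gt0_ler_poweR.
- by rewrite invr_ge0 ltW.
- by rewrite in_itv/= energy_ge0 leey.
- by rewrite in_itv/= leey andbT; apply: integral_ge0 => x _; rewrite lee_fin powR_ge0.
apply: ge0_le_integral => //.
- by move=> x _; rewrite lee_fin powR_ge0.
- by apply: measurable_energy; exact: measurable_rVD.
- apply/measurable_EFinP; apply: (measurableT_comp (measurable_powR p)).
  by apply: measurableT_comp => //; apply: measurable_funD; exact: measurable_enorm_field.
move=> x _ /=; rewrite lee_fin ge0_ler_powR ?nnegrE ?enorm_ge0// ?(ltW p0)//.
by rewrite (le_trans (enormD _ _))// ler_norm.
Qed.

Lemma Lp_fieldD F G : Lp_field F -> Lp_field G -> Lp_field (fun x => F x + G x).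
Proof.
move=> LF LG; have [mF eF] := LF; have [mG eG] := LG; split; first exact: measurable_rVD.
have h := Lnorm_rVD mF mG; rewrite (Lp_field_norm LF) (Lp_field_norm LG) Lnorm_rVE in h.
apply: (@lty_poweRy _ _ p^-1); first by rewrite invr_neq0.
by apply: le_lt_trans h _; rewrite -EFinD ltry.
Qed.

Lemma pnormD F G : Lp_field F -> Lp_field G ->
  pnorm (fun x => F x + G x) <= pnorm F + pnorm G.
Proof.
move=> LF LG; have [mF eF] := LF; have [mG eG] := LG.
have h := Lnorm_rVD mF mG.
have LS := Lp_fieldD LF LG.
by rewrite (Lp_field_norm LS) (Lp_field_norm LF) (Lp_field_norm LG) -EFinD lee_fin in h.
Qed.

Lemma Lp_fieldB F G : Lp_field F -> Lp_field G -> Lp_field (fun x => F x - G x).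
Proof.
move=> LF LG; have := Lp_fieldD LF (Lp_fieldZ (-1) LG).
by congr Lp_field; apply/funext => x; rewrite scaleN1r.
Qed.

Lemma pnormN G : Lp_field G -> pnorm (fun x => - G x) = pnorm G.
Proof.
move=> LG; rewrite -[RHS]mul1r -(@normrN1 R) -pnormZ//.
by congr pnorm; apply/funext => x; rewrite scaleN1r.
Qed.

Lemma pnormB_sym F G : Lp_field F -> Lp_field G ->
  pnorm (fun x => F x - G x) = pnorm (fun x => G x - F x).
Proof.
move=> LF LG; rewrite -pnormN; last exact: Lp_fieldB.
by congr pnorm; apply/funext => x; rewrite opprB.
Qed.

Lemma pnormB_ge F G : Lp_field F -> Lp_field G ->
  pnorm F - pnorm G <= pnorm (fun x => F x - G x).
Proof.
move=> LF LG; rewrite lerBlDr.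
have := pnormD (Lp_fieldB LF LG) LG.
by congr (_ <= _); congr pnorm; apply/funext => x; rewrite subrK.
Qed.

Lemma Lp_field0 : Lp_field (fun=> 0).
Proof.
split; first exact: measurable_cst.
by rewrite /energy; under eq_integral do rewrite enorm0 powR0//; rewrite integral0.
Qed.

Lemma pnorm0 : pnorm (fun=> 0) = 0.
Proof.
apply: pnormE => //; rewrite /energy; under eq_integral do rewrite enorm0 powR0//.
by rewrite integral0 powR0.
Qed.

Lemma ae_eq_Lnorm_rV F G : measurable_fun setT F -> measurable_fun setT G ->
  {ae mu, forall x, F x = G x} -> Lnorm_rV p F = Lnorm_rV p G.
Proof.
move=> mF mG FG; have E : energy F = energy G.
  apply: ge0_ae_eq_integral => //; try exact: measurable_energy.
  - by move=> x _; rewrite lee_fin powR_ge0.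
  - by move=> x _; rewrite lee_fin powR_ge0.
  by apply: filterS FG => x -> _.
by rewrite (Lnorm_rVE F) E -Lnorm_rVE.
Qed.

(** Connects the coordinatewise condition in [D1p] with the Euclidean norm of the whole gradient
    that enters the inequalities. *)
Lemma Lfun_coordP G : (0 < n)%N ->
  (forall i, (fun x => G x 0 i) \in Lfun mu p%:E) <-> Lp_field G.
Proof.
move=> n0; split=> [h|[mG eG] i].
  have mGi i : measurable_fun setT (fun x => G x 0 i).
    by have := h i; rewrite inE => /andP[]; rewrite inE.
  have mG : measurable_fun setT G by exact: measurable_fun_rVP.
  split => //.
  have eGi i : (\int[mu]_x (`|G x 0 i| `^ p)%:E < +oo)%E.
    have := h i; rewrite inE => /andP[_]; rewrite inE /= /finite_norm unlock => hi.
    by apply: (@lty_poweRy _ _ p^-1); [rewrite invr_neq0|exact: hi].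
  have mi i : measurable_fun setT (fun x => (`|G x 0 i| `^ p)%:E).
    by apply/measurable_EFinP; apply: (measurableT_comp (measurable_powR p)); exact: measurableT_comp.
  (* The Euclidean norm is at most [n] times the largest coordinate, whose p-th power is one term of
     the sum. *)
  apply: (@le_lt_trans _ _ (\int[mu]_x ((n%:R `^ p)%:E * \sum_(i < n) (`|G x 0 i| `^ p)%:E))%E).
    apply: ge0_le_integral => //.
    - by move=> x _; rewrite lee_fin powR_ge0.
    - exact: measurable_energy.
    - by apply: measurable_funeM; apply: emeasurable_sum => i _; exact: mi.
    move=> x _; rewrite sumEFin -EFinM lee_fin.
    have [j _ hj] := @arg_maxP _ _ _ (Ordinal n0) xpredT (fun i => `|G x 0 i|) erefl.
    apply: (@le_trans _ _ ((n%:R * `|G x 0 j|) `^ p)).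
      rewrite ge0_ler_powR ?nnegrE ?enorm_ge0 ?mulr_ge0 ?(ltW p0)//.
      apply: cube_enorm => i; rewrite /= in_itv/= -ler_norml; exact: hj.
    rewrite powRM// ler_wpM2l ?powR_ge0// (bigD1 j)//= lerDl sumr_ge0// => i _.
  rewrite ge0_integralZl//.
  - rewrite lte_mul_pinfty ?lee_fin ?powR_ge0// ge0_integral_sum//.
    by apply: lte_sum_pinfty => i _; exact: eGi.
  - by apply: emeasurable_sum => i _; exact: mi.
  - by move=> x _; apply: sume_ge0 => i _; rewrite lee_fin powR_ge0.
have mGi : measurable_fun setT (fun x => G x 0 i).
  by apply: (measurableT_comp (measurable_coord_rV i)).
rewrite inE; apply/andP; split; rewrite inE//= /finite_norm unlock.
apply: poweR_lty; apply: le_lt_trans eG.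
apply: ge0_le_integral => //.
- by move=> x _; rewrite lee_fin powR_ge0.
- by apply/measurable_EFinP; apply: (measurableT_comp (measurable_powR p)); exact: measurableT_comp.
- exact: measurable_energy.
by move=> x _; rewrite /= lee_fin ge0_ler_powR ?nnegrE ?enorm_ge0 ?(ltW p0)// normr_coord_enorm.
Qed.

(** On a compact set, which has finite measure, t <= 1 + t^p reduces the claim to finiteness of the
    energy. *)
Lemma Lp_field_locally_integrable G i : Lp_field G -> locally_integrable_rV (fun x => G x 0 i).
Proof.
move=> [mG eG].
have mGi : measurable_fun setT (fun x => G x 0 i).
  by apply: (measurableT_comp (measurable_coord_rV i)).
split => // K cK; have mK := compact_measurable_rV cK.
apply: (@le_lt_trans _ _ (\int[mu]_(x in K) (1%:E + (enorm (G x) `^ p)%:E))%E).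
  apply: ge0_le_integral => //.
  - by apply: measurable_funTS; apply/measurable_EFinP; exact: measurableT_comp.
  - by apply: emeasurable_funD => //; apply: measurable_funTS; exact: measurable_energy.
  move=> x _; rewrite -EFinD lee_fin; apply: (@le_trans _ _ (enorm (G x))).
    exact: normr_coord_enorm.
  have [h|h] := leP (enorm (G x)) 1; first by rewrite (le_trans h)// lerDl powR_ge0.
  by rewrite (le_trans (le1r_powR (ltW h) p1))// lerDr.
rewrite ge0_integralD//; last 2 first.
- by move=> x _; rewrite lee_fin powR_ge0.
- by apply: measurable_funTS; exact: measurable_energy.
have [r r0 Kr] := compact_sub_cube cK.
rewrite lte_add_pinfty//.
  rewrite integral_cst// mul1e; apply: le_lt_trans (cube_lty r).
  by apply: le_measure; rewrite ?inE//; exact: measurable_cube.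
apply: le_lt_trans eG; apply: ge0_subset_integral => //.
- exact: measurable_energy.
- by move=> x _; rewrite lee_fin powR_ge0.
Qed.

End Lp_fields.

(** * Functions with p-integrable weak gradient *)

Lemma Rintegral_sum {d} {T : measurableType d} {R : realType} (m : {measure set T -> \bar R})
    (k : nat) (f : 'I_k -> T -> R) :
  (forall i, m.-integrable setT (EFin \o f i)) ->
  m.-integrable setT (EFin \o (fun x => \sum_i f i x)) /\
  (\int[m]_x (\sum_i f i x) = \sum_i \int[m]_x f i x)%R.
Proof.
move=> fi; elim: k f fi => [|k IH] f fi.
  split.
    rewrite (_ : EFin \o _ = cst 0%E); first exact: integrable0.
    by apply/funext => x; rewrite /= big_ord0.
  rewrite big_ord0 (_ : (fun x => _) = cst 0); first by rewrite Rintegral_cst// mul0r.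
  by apply/funext => x; rewrite big_ord0.
have [i1 e1] := IH (fun i => f (lift ord0 i)) (fun i => fi _).
have -> : (fun x => \sum_i f i x) = (fun x => f ord0 x + \sum_i f (lift ord0 i) x).
  by apply/funext => x; rewrite big_ord_recl.
by split; [exact: (integrableD measurableT (fi ord0) i1)|rewrite RintegralD// e1 big_ord_recl].
Qed.

Section Wgrad.
Context {R : realType} {n : nat} (p : R).
Hypothesis p1 : 1 <= p.
Local Notation mu := (@lebesgue_rV R n).
Implicit Types (u v : 'rV[R]_n -> R) (F G : 'rV[R]_n -> 'rV[R]_n).

Let p0 : 0 < p. Proof. exact: lt_le_trans p1. Qed.

(** The gradient is an argument rather than [weak_grad u]: linear combinations, similarities and
    limits produce an explicit representative, with which the chosen one agrees only almost
    everywhere. *)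
Definition Wgrad u G := [/\ continuous u, Lp_field p G &
  forall i, is_weak_partial i u (fun x => G x 0 i)].

Lemma Wgrad_locint u G : Wgrad u G -> locally_integrable_rV u.
Proof. by move=> [cu _ _]; exact: continuous_locally_integrable. Qed.

Lemma Wgrad_D1p u G : (0 < n)%N -> Wgrad u G -> D1p p u.
Proof.
move=> n0 WG; have [cu LG wG] := WG; split => //; first exact: Wgrad_locint WG.
by move=> i; exists (fun x => G x 0 i) => //; move: i; apply/(Lfun_coordP p1).
Qed.

Lemma Wgrad_unique u F G : Wgrad u F -> Wgrad u G -> {ae mu, forall x, F x = G x}.
Proof.
move=> [_ _ wF] [_ _ wG].
have : \forall x \ae mu, forall i, F x 0 i = G x 0 i.
  by apply: filter_forall => i; exact: weak_partial_unique (wF i) (wG i).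
by apply: filterS => x h; apply/rowP.
Qed.

(** [weak_partial] may select another representative than the one known to be in L^p; the two agree
    almost everywhere, so integrability passes to the selected one. *)
Lemma D1p_Wgrad u : (0 < n)%N -> D1p p u -> Wgrad u (weak_grad u).
Proof.
move=> n0 [lu cu hu].
have wu i : is_weak_partial i u (weak_partial i u).
  have [g wg _] := hu i.
  by apply: (@getPex _ [set g | is_weak_partial i u g]); exists g.
have wE i : (fun x => weak_grad u x 0 i) = weak_partial i u.
  by apply/funext => x; rewrite mxE.
split => //; last by move=> i; rewrite wE.
apply/(Lfun_coordP p1) => // i; rewrite wE.
have [g wg lg] := hu i; have ae := weak_partial_unique wg (wu i).
have mw : measurable_fun setT (weak_partial i u) by have [[]] := wu i.
move: lg; rewrite !inE => /andP[mg fg]; apply/andP; split; first by rewrite inE.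
move: fg mg; rewrite !inE /= /finite_norm unlock => fg mg.
have -> : (\int[mu]_x `|(EFin \o weak_partial i u) x| `^ p = \int[mu]_x `|(EFin \o g) x| `^ p)%E.
  have mpow (f : 'rV[R]_n -> R) : measurable_fun setT f -> measurable_fun setT (fun x => (`|(EFin \o f) x| `^ p)%E).
    move=> mf; apply/measurable_EFinP; apply: (measurableT_comp (measurable_powR p)).
    exact: measurableT_comp.
  apply: ge0_ae_eq_integral => //; try exact: mpow.
  - by move=> x _; rewrite lee_fin powR_ge0.
  - by move=> x _; rewrite lee_fin powR_ge0.
  by apply: filterS ae => x /= -> _.
exact: fg.
Qed.

Lemma Wgrad_Lnorm u G : (0 < n)%N -> Wgrad u G -> Lnorm_rV p (weak_grad u) = (pnorm p G)%:E.
Proof.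
move=> n0 WG; have WG' := D1p_Wgrad n0 (Wgrad_D1p n0 WG).
have ae := Wgrad_unique WG' WG.
have [_ [mG' _] _] := WG'; have [_ LG _] := WG; have [mG _] := LG.
by rewrite (ae_eq_Lnorm_rV p mG' mG ae) Lp_field_norm.
Qed.

Lemma Wgrad_LnormB u v F G : (0 < n)%N -> Wgrad u F -> Wgrad v G ->
  Lnorm_rV p (fun x => weak_grad u x - weak_grad v x) = (pnorm p (fun x => F x - G x))%:E.
Proof.
move=> n0 WF WG.
have WF' := D1p_Wgrad n0 (Wgrad_D1p n0 WF); have WG' := D1p_Wgrad n0 (Wgrad_D1p n0 WG).
have aeF := Wgrad_unique WF' WF; have aeG := Wgrad_unique WG' WG.
have [_ LF _] := WF; have [_ LG _] := WG; have [_ LF' _] := WF'; have [_ LG' _] := WG'.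
have LB := Lp_fieldB p1 LF LG; have LB' := Lp_fieldB p1 LF' LG'.
have ae : {ae mu, forall x, weak_grad u x - weak_grad v x = F x - G x}.
  by apply: filterS2 aeF aeG => x -> ->.
by rewrite (ae_eq_Lnorm_rV p LB'.1 LB.1 ae) Lp_field_norm.
Qed.

Lemma WgradD (a b : R) u v F G : Wgrad u F -> Wgrad v G ->
  Wgrad (fun x => a * u x + b * v x) (fun x => a *: F x + b *: G x).
Proof.
move=> WF WG; have [cu LF wF] := WF; have [cv LG wG] := WG; split.
- move=> x; apply: (@continuousD _ _ _ (fun x => a * u x) (fun x => b * v x)).
    by apply: (@continuousM _ _ (fun=> a) u); [exact: cst_continuous|exact: cu].
  by apply: (@continuousM _ _ (fun=> b) v); [exact: cst_continuous|exact: cv].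
- exact: (Lp_fieldD p1 (Lp_fieldZ a LF) (Lp_fieldZ b LG)).
move=> i; have := is_weak_partialD a b (Wgrad_locint WF) (Wgrad_locint WG) (wF i) (wG i).
by congr is_weak_partial; apply/funext => x; rewrite !mxE.
Qed.

Lemma Wgrad_cst (c : R) : Wgrad (fun=> c) (fun=> 0).
Proof.
split; [exact: cst_continuous|exact: Lp_field0|] => i.
have := @is_weak_partial_cst R n i c.
by congr is_weak_partial; apply/funext => x; rewrite mxE.
Qed.

(** The chain rule contributes r^p and the change of variables r^-n, together the p-th power of r^(1
    - n/p). Hoelder quotients scale by the same factor, which makes Morrey's inequality invariant
    under similarities. *)
Lemma energy_simil a r (Q : 'M[R]_n) G : 0 < r -> Q *m Q^T = 1%:M -> measurable_fun setT G ->
  energy p (fun x => r *: (G (simil a r Q x) *m Q^T)) = ((r `^ (1 - n%:R / p) `^ p)%:E * energy p G)%E.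
Proof.
move=> r0 QQ mG.
have mGS : measurable_fun setT (fun x => G (simil a r Q x) *m Q^T).
  apply: measurable_rV_mulmx; apply: measurableT_comp => //; exact: measurable_simil.
rewrite (energyZ p r mGS) (gtr0_norm r0) /energy.
under eq_integral do rewrite enorm_orthogonal ?trmxK ?(mulmx1C QQ)//.
have := @ge0_integral_simil R n a r Q (fun x => (enorm (G x) `^ p)%:E) r0 QQ (measurable_energy p mG).
move=> ->; last by move=> x; rewrite lee_fin powR_ge0.
rewrite muleA -EFinM; congr (_%:E * _)%E.
rewrite -powRrM mulrBl mul1r mulfVK ?gt_eqF// powRB ?(gt_eqF r0) ?implybT//.
by rewrite powR_mulrn// ltW.
Qed.

Lemma Lp_field_simil a r (Q : 'M[R]_n) G : 0 < r -> Q *m Q^T = 1%:M -> Lp_field p G ->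
  Lp_field p (fun x => r *: (G (simil a r Q x) *m Q^T)).
Proof.
move=> r0 QQ [mG eG]; split.
  apply: measurable_rVZ; apply: measurable_rV_mulmx.
  by apply: measurableT_comp => //; exact: measurable_simil.
by rewrite energy_simil// lte_mul_pinfty// lee_fin powR_ge0.
Qed.

Lemma pnorm_simil a r (Q : 'M[R]_n) G : 0 < r -> Q *m Q^T = 1%:M -> Lp_field p G ->
  pnorm p (fun x => r *: (G (simil a r Q x) *m Q^T)) = r `^ (1 - n%:R / p) * pnorm p G.
Proof.
move=> r0 QQ LG; apply: pnormE => //; last by rewrite mulr_ge0 ?powR_ge0 ?pnorm_ge0.
by rewrite energy_simil ?(energyE p1 LG)// ?powRM ?powR_ge0 ?pnorm_ge0//; case: LG.
Qed.

Lemma simil_continuous a r (Q : 'M[R]_n) : continuous (simil a r Q).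
Proof.
have -> : simil a r Q = fun x => a + x *m (r *: Q).
  by apply/funext => x; rewrite simil_affine.
exact: affine_continuous.
Qed.

Lemma similK a r (Q : 'M[R]_n) : 0 < r -> Q *m Q^T = 1%:M ->
  cancel (simil a r Q) (simil (- (r^-1 *: (a *m Q^T))) r^-1 Q^T).
Proof.
move=> r0 QQ x; rewrite /simil mulmxDl -scalemxAl -mulmxA QQ mulmx1 scalerDr.
by rewrite scalerA mulVf ?gt_eqF// scale1r addKr.
Qed.

(** A test function is written as [psi] composed with the similarity. The chain rule expresses its
    [i]-th derivative through those of [psi], and the change of variables contributes the same
    factor to both sides of each integration by parts. *)
Lemma Wgrad_simil u G a r (Q : 'M[R]_n) : 0 < r -> Q *m Q^T = 1%:M -> Wgrad u G ->
  Wgrad (u \o simil a r Q) (fun x => r *: (G (simil a r Q x) *m Q^T)).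
Proof.
move=> r0 QQ WG; have [cu LG wG] := WG; have LS := Lp_field_simil a r0 QQ LG.
have QQ' : Q^T *m Q^T^T = 1%:M by rewrite trmxK; exact: mulmx1C.
have r0' : 0 < r^-1 by rewrite invr_gt0.
split => //.
  by move=> x; apply: continuous_comp; [exact: simil_continuous|exact: cu].
move=> i; split; first exact: Lp_field_locally_integrable LS.
move=> phi tphi; pose psi := phi \o simil (- (r^-1 *: (a *m Q^T))) r^-1 Q^T.
have tpsi : test_function psi by exact: test_comp_simil.
have phiE x : phi x = psi (simil a r Q x) by rewrite /psi /= similK.
have DphiE x : 'D_('e_i) phi x = \sum_j (r *: Q) i j * 'D_('e_j) psi (simil a r Q x).
  have -> : phi = fun x => psi (a + x *m (r *: Q)).
    by apply/funext => y; rewrite phiE simil_affine.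
  have [_ ->] := is_derive_comp_affine a x (r *: Q) i (test_smooth tpsi).
  by apply: eq_bigr => j _; rewrite simil_affine.
have lu := Wgrad_locint WG.
have iu j := integrable_mul_test lu (test_partial j tpsi).
have lGj j := Lp_field_locally_integrable p1 j LG.
have iG j := integrable_mul_test (lGj j) tpsi.
have iuS j := integrable_simil a r0 QQ (iu j).
have iGS j := integrable_simil a r0 QQ (iG j).
have -> : \int[mu]_x ((u \o simil a r Q) x * 'D_('e_i) phi x) =
    \sum_j \int[mu]_x ((r *: Q) i j * (u (simil a r Q x) * 'D_('e_j) psi (simil a r Q x))).
  rewrite -(Rintegral_sum _).2; last first.
    by move=> j; exact: (integrableZl measurableT ((r *: Q) i j) (iuS j)).
  congr Rintegral; apply/funext => x; rewrite DphiE mulr_sumr; apply: eq_bigr => j _.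
  by rewrite mulrCA.
have -> : \int[mu]_x ((r *: (G (simil a r Q x) *m Q^T)) 0 i * phi x) =
    \sum_j \int[mu]_x ((r *: Q) i j * (G (simil a r Q x) 0 j * psi (simil a r Q x))).
  rewrite -(Rintegral_sum _).2; last first.
    by move=> j; exact: (integrableZl measurableT ((r *: Q) i j) (iGS j)).
  congr Rintegral; apply/funext => x; rewrite phiE !mxE mulr_sumr mulr_suml; apply: eq_bigr => j _.
  by rewrite !mxE; ring.
rewrite -sumrN; apply: eq_bigr => j _.
rewrite RintegralZl//; last exact: iuS.
rewrite RintegralZl//; last exact: iGS.
rewrite -mulrN; congr (_ * _).
rewrite (@Rintegral_simil R n a r Q (fun x => u x * 'D_('e_j) psi x))//.
rewrite (@Rintegral_simil R n a r Q (fun x => G x 0 j * psi x))//.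
by have [_ ->] := wG j; rewrite ?mulrN.
Qed.

End Wgrad.

(** * Morrey's inequality *)

Lemma ge0_integral_tens {R : realType} n (F : 'I_n -> R -> R) :
  (forall i, measurable_fun setT (F i)) -> (forall i t, 0 <= F i t) ->
  (\int[@lebesgue_rV R n]_x (tens F x)%:E = \prod_(i < n) \int[@lebesgue_measure R]_t (F i t)%:E)%E.
Proof.
elim: n F => [|n IH] F mF F0.
  rewrite ge0_integral_lebesgue_rV0.
  - by rewrite /tens !big_ord0.
  - rewrite (_ : (fun x => _) = cst 1%E); first exact: measurable_cst.
    by apply/funext => x; rewrite /tens big_ord0.
  - by move=> x; rewrite /tens big_ord0.
have mtens k (F' : 'I_k -> R -> R) : (forall i, measurable_fun setT (F' i)) ->
    measurable_fun setT (fun x : 'rV[R]_k => (tens F' x)%:E).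
  move=> mF'; apply/measurable_EFinP; apply: measurable_prod => i _.
  by apply: measurableT_comp; [exact: mF'|exact: measurable_coord_rV].
have tens0 k (F' : 'I_k -> R -> R) x : (forall i t, 0 <= F' i t) -> 0 <= tens F' x.
  by move=> h; apply: prodr_ge0 => i _.
rewrite ge0_integral_lebesgue_rVS; [|exact: mtens|by move=> x; rewrite lee_fin tens0].
rewrite big_ord_recl -(IH (fun i => F (lift ord0 i)))//.
under eq_integral => t _.
  rewrite (_ : (\int[_]_y _)%E = ((F ord0 t)%:E * \int[@lebesgue_rV R n]_y (tens (fun i => F (lift ord0 i)) y)%:E)%E).
    over.
  rewrite -ge0_integralZl//; last 3 first.
  - exact: mtens.
  - by move=> x _; rewrite lee_fin tens0.
  - by rewrite lee_fin.
  apply: eq_integral => y _; rewrite /tens big_ord_recl -EFinM; congr (_ * _)%:E.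
    congr (F _ _); rewrite /cons_rV mxE; case: splitP => j //=.
    by rewrite mxE.
  apply: eq_bigr => i _; congr (F _ _).
  rewrite /cons_rV mxE; case: splitP => j //=; first by rewrite [j]ord1.
  by move=> [/val_inj ->].
rewrite ge0_integralZr//; last 3 first.
- by apply/measurable_EFinP; exact: mF.
- by move=> t _; rewrite lee_fin.
- by apply: integral_ge0 => y _; rewrite lee_fin tens0.
Qed.

(** The primitive [S] climbs from 0 to the mass [c] of the bump [b]. Differences of rescaled or
    shifted copies of [S] cancel at both ends and so have bounded support; this is how differences
    of bumps become derivatives of test functions. *)
Lemma bump_primitive {R : realType} : exists b S : R -> R, exists c : R,
  [/\ smooth1 b /\ (forall t, 0 <= b t), forall t, 1 < `|t| -> b t = 0,
      smooth1 S /\ (forall t, deriv_at S t (b t)),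
      [/\ 0 < c, forall t, 0 <= S t <= c, forall t, t <= -1 -> S t = 0 & forall t, 1 <= t -> S t = c] &
      (\int[@lebesgue_measure R]_t (b t)%:E = c%:E)%E].
Proof.
pose b : R -> R := smooth_bump (-1) 1 0.
have b0 t : 0 <= b t by exact: smooth_bump_ge0.
have sb : smooth1 b by exact: smooth1_smooth_bump.
have cb := smooth1_continuous sb.
have mb : measurable_fun setT b by exact: continuous_measurable_fun.
have bout t : ~~ (-1 < t < 1) -> b t = 0 by exact: smooth_bump_out.
have eb0 t : (0 <= (b t)%:E)%E by rewrite lee_fin.
have meb : measurable_fun setT (fun t => (b t)%:E) by apply/measurable_EFinP.
have ib : (@lebesgue_measure R).-integrable setT (EFin \o b).
  apply/integrableP; split => //.
  apply: (@le_lt_trans _ _ (\int[@lebesgue_measure R]_t (\1_(`[-1, 1]%classic : set R) t)%:E)%E).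
    apply: ge0_le_integral => //.
    - exact: measurableT_comp.
    - by apply/measurable_EFinP; exact: measurable_indic.
    move=> t _ /=; rewrite lee_fin ger0_norm//; rewrite indicE.
    have [tb|tb] := boolP (t \in `[-1, 1]%classic); first exact: smooth_bump_le1.
    rewrite bout//; apply: contra tb => /andP[h1 h2].
    by rewrite inE /= in_itv/= !ltW.
  rewrite integral_indic//= setIT.
    have := @lebesgue_measure_itv R `[-1, 1] => /= ->.
    by case: ifP => _; rewrite ?ltry// -EFinB ltry.
pose I A := (\int[@lebesgue_measure R]_(t in A) (b t)%:E)%E.
have I0 A : (0 <= I A)%E by exact: integral_ge0.
have IT A : measurable A -> (I A <= I setT)%E.
  by move=> mA; apply: ge0_subset_integral.
have Tfin : I setT \is a fin_num by exact: integrable_fin_num.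
have Ifin A : measurable A -> I A \is a fin_num.
  by move=> mA; rewrite ge0_fin_numE// (le_lt_trans (IT _ mA))// -ge0_fin_numE.
pose c := fine (I setT); pose S t := fine (I [set` `]-oo, t]]).
have dS t : deriv_at S t (b t).
  have t1 : t < t + 1 by rewrite ltrDl.
  have it : (@lebesgue_measure R).-integrable [set` `]-oo, t + 1]] (EFin \o b).
    by apply: (integrableS measurableT) => //; exact: measurable_itv.
  have [d1 d2] := @continuous_FTC1 R b -oo%O t (t + 1) t1 it (ltNyr _) (cb t).
  rewrite /deriv_at -d2 derive1E; exact: derivableP.
have S0 t : t <= -1 -> S t = 0.
  move=> t1; rewrite /S /I integral_mkcond (_ : _ \_ _ = cst 0%E) ?integral0//.
  apply/funext => s; rewrite /patch; case: ifPn => //; rewrite inE /= in_itv/= => st.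
  by rewrite bout// negb_and -!leNgt (le_trans st t1).
have Sc t : 1 <= t -> S t = c.
  move=> t1; rewrite /S /I integral_mkcond (_ : _ \_ _ = (fun t => (b t)%:E))//.
  apply/funext => s; rewrite /patch; case: ifPn => //; rewrite notin_setE /= in_itv/= => /negP.
  by rewrite -ltNge => st; rewrite bout// negb_and -!leNgt (le_trans t1 (ltW st)) orbT.
have Sb t : 0 <= S t <= c.
  by rewrite fine_ge0//= fine_le// ?IT// Ifin.
(* A zero mass would force [S] to vanish identically, whereas its derivative at 0 is [b 0 > 0]. *)
have c0 : 0 < c.
  rewrite lt0r fine_ge0// andbT; apply/negP => /eqP c0.
  have S00 : S = cst 0.
    by apply/funext => t; apply/eqP; rewrite eq_le andbC -{2}c0; exact: Sb.
  have := dS 0; rewrite S00 => -[_]; rewrite derive_cst => /eqP; rewrite eq_sym gt_eqF//.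
  by apply: smooth_bump_gt0; rewrite ltr01 oppr_lt0 ltr01.
exists b, S, c; split => //.
- by move=> t t1; apply: bout; apply: contraL t1; rewrite -leNgt -ltr_norml => /ltW.
- by split=> // -[//|k]; apply: nderivable_is_derive (dS) (sb k).
- by rewrite -[LHS]/(I setT) -[LHS]fineK.
Qed.

(** * Gradients tested against bumps *)

Section holder_test.
Context {R : realType} {n : nat} (p : R).
Hypothesis p1 : 1 < p.
Local Notation mu := (@lebesgue_rV R n).
Implicit Types (u : 'rV[R]_n -> R) (G : 'rV[R]_n -> 'rV[R]_n).

(** Hoelder's inequality with the measure of [A] left explicit: the sharp constant in dimension one
    is read off from it. *)
Lemma holder_field G i phi (M : R) (A : set 'rV[R]_n) :
  Lp_field p G -> test_function phi -> 0 <= M -> (forall x, `|phi x| <= M * \1_A x) ->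
  measurable A -> (mu A < +oo)%E ->
  `|\int[mu]_x (G x 0 i * phi x)| <= M * fine (mu A) `^ (1 - p^-1) * pnorm p G.
Proof.
move=> LG tphi M0 phiM mA Afin; have p0 : 0 < p by exact: lt_trans p1.
have [mG _] := LG; have lGi := Lp_field_locally_integrable (ltW p1) i LG.
pose q := p / (p - 1); have p10 : 0 < p - 1 by rewrite subr_gt0.
have q0 : 0 < q by rewrite divr_gt0.
have qE : q^-1 = 1 - p^-1 by rewrite /q invf_div mulrBl divff ?gt_eqF// mul1r.
have pq : p^-1 + q^-1 = 1 by rewrite qE addrC subrK.
have mg : measurable_fun setT (fun x => M * \1_A x : R) by apply: measurable_funM => //; exact: measurable_indic.
have iG := integrable_mul_test lGi tphi.
have h := hoelder mu (measurable_enorm_field mG) mg p0 q0 pq.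
have Np : ('N[mu]_p%:E[EFin \o (fun x => enorm (G x))] = (pnorm p G)%:E)%E by exact: Lp_field_norm.
have Nq : ('N[mu]_q%:E[EFin \o (fun x => (M * \1_A x)%R)] = (M * fine (mu A) `^ (1 - p^-1))%:E)%E.
  rewrite unlock.
  under eq_integral => x _.
    rewrite /= ger0_norm ?mulr_ge0//.
    rewrite (_ : (M * \1_A x) `^ q = M `^ q * \1_A x); last first.
      rewrite indicE; case: (x \in A); first by rewrite !mulr1.
      by rewrite !mulr0 powR0// gt_eqF.
    rewrite EFinM; over.
  rewrite ge0_integralZl//; last 2 first.
  - by apply/measurable_EFinP; exact: measurable_indic.
  - by rewrite lee_fin powR_ge0.
  have -> : (\int[mu]_x (\1_A x)%:E = (fine (mu A))%:E)%E.
    by rewrite integral_indic// setIT fineK// ge0_fin_numE.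
  rewrite -EFinM poweR_EFin; congr (_%:E).
  by rewrite powRM ?powR_ge0 ?fine_ge0// -powRrM mulfV ?gt_eqF// powRr1// qE.
rewrite -lee_fin mulrC EFinM -Np -Nq.
apply: le_trans h; rewrite Lnorm1.
have h1 : (`|\int[mu]_x (G x 0 i * phi x)|%:E <= \int[mu]_x `|(EFin \o (fun x => (G x 0 i * phi x)%R)) x|)%E.
  rewrite -abse_EFin /Rintegral fineK; last exact: integrable_fin_num.
  by apply: le_abse_integral => //; case/integrableP: iG.
apply: (le_trans h1).
apply: ge0_le_integral => //.
- by apply: measurableT_comp => //; case/integrableP: iG.
- apply: measurableT_comp => //; apply/measurable_EFinP; apply: measurable_funM => //.
  exact: measurable_enorm_field.
move=> x _ /=; rewrite lee_fin !normrM ler_pM//.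
  by rewrite [leRHS]ger0_norm ?enorm_ge0// normr_coord_enorm.
by rewrite [`|M|]ger0_norm// [`|\1_A x|]ger0_norm.
Qed.

Lemma test_field_bounded i phi : test_function phi ->
  exists2 C : R, 0 <= C & forall G, Lp_field p G ->
    `|\int[mu]_x (G x 0 i * phi x)| <= C * pnorm p G.
Proof.
move=> tphi; have [M M0 hM] := test_bounded tphi; have [r hr] := test_bsupp tphi.
exists (M * fine (mu (cube r)) `^ (1 - p^-1)); first by rewrite mulr_ge0// powR_ge0.
move=> G LG; apply: holder_field LG tphi M0 _ (@measurable_cube R n r) (cube_lty r).
move=> x; rewrite indicE; have [_|] := boolP (x \in cube r); first by rewrite mulr1.
rewrite notin_setE => xr; rewrite mulr0 hr ?normr0// ltNge; apply/negP => /enorm_cube.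
exact: xr.
Qed.

Lemma test_deriv_bounded i phi : test_function phi ->
  exists2 C : R, 0 <= C & forall u G, Wgrad p u G ->
    `|\int[mu]_x (u x * 'D_('e_i) phi x)| <= C * pnorm p G.
Proof.
move=> tphi; have [C C0 hC] := test_field_bounded i tphi; exists C => // u G [_ LG wG].
by have [_ ->//] := wG i; rewrite normrN hC.
Qed.

End holder_test.

Lemma deriv_at_affine_comp {R : realType} (f g : R -> R) (a d : R) : (forall t, deriv_at f t (g t)) ->
  forall t, deriv_at (fun t => f (a * t + d)) t (a * g (a * t + d)).
Proof. by move=> df t; rewrite mulrC; exact: deriv_at_comp (df _) (deriv_at_affine a d t). Qed.

Lemma deriv_atB {R : realType} (f g : R -> R) (x a b : R) : deriv_at f x a -> deriv_at g x b ->
  deriv_at (fun y => f y - g y) x (a - b).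
Proof. exact: is_deriveB. Qed.

Lemma smooth1_affine {R : realType} (f : R -> R) (a d : R) : smooth1 f -> smooth1 (fun t => f (a * t + d)).
Proof. by move=> sf k; exact: nderivable_affine. Qed.

Lemma smooth1Z {R : realType} (f : R -> R) (a : R) : smooth1 f -> smooth1 (fun t => a * f t).
Proof. by move=> sf k; apply: nderivableM => //; exact: nderivable_cst. Qed.

Lemma smooth1B {R : realType} (f g : R -> R) : smooth1 f -> smooth1 g -> smooth1 (fun t => f t - g t).
Proof.
move=> sf sg; rewrite (_ : (fun t => _) = fun t => f t + -1 * g t); last first.
  by apply/funext => t; rewrite mulN1r.
by move=> k; apply: nderivableD => //; exact: smooth1Z.
Qed.

Section tens_replace.
Context {R : realType} {n : nat} (p : R).
Hypothesis p1 : 1 < p.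
Local Notation mu := (@lebesgue_rV R n).
Implicit Types (u : 'rV[R]_n -> R) (G : 'rV[R]_n -> 'rV[R]_n) (F B : 'I_n -> R -> R).

(* A tensor product may be replaced, one factor at a time, by another one whose
   factors have the same integrals: each step changes it by a partial derivative. *)
Lemma tens_replace (r : R) F F' B :
  (forall i, smooth1 (F i)) -> (forall i, smooth1 (F' i)) -> (forall i, smooth1 (B i)) ->
  (forall i t, r < `|t| -> [/\ F i t = 0, F' i t = 0 & B i t = 0]) ->
  (forall i t, deriv_at (B i) t (F i t - F' i t)) ->
  exists2 C : R, 0 <= C & forall u G, Wgrad p u G ->
    `|\int[mu]_x (u x * tens F x) - \int[mu]_x (u x * tens F' x)| <= C * pnorm p G.
Proof.
move=> sF sF' sB out dB.
pose mix (k : nat) (i : 'I_n) := if (i < k)%N then F i else F' i.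
have smix k i : smooth1 (mix k i) by rewrite /mix; case: ifP.
have omix k i t : r < `|t| -> mix k i t = 0.
  by move=> /(out i)[h1 h2 _]; rewrite /mix; case: ifP.
have tmix k : test_function (tens (mix k)) by apply: (@test_tens _ _ _ r) => // i t; exact: omix.
pose phi (j : 'I_n) := tens (upd (mix j) j (B j)).
have tphi j : test_function (phi j).
  apply: (@test_tens _ _ _ r) => i; first by rewrite /upd; case: ifP.
  by move=> t rt; rewrite /upd; case: ifP => _; [have [] := out j t rt|exact: omix].
have phiE j x : 'D_('e_j) (phi j) x = tens (mix j.+1) x - tens (mix j) x.
  have d t : deriv_at (upd (mix j) j (B j) j) t (F j t - F' j t).
    by rewrite /upd eqxx; exact: dB.
  have [_ ->] := @is_derive_tens _ _ _ j x _ d.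
  have -> : tens (mix j.+1) x = tens (upd (mix j) j (F j)) x.
    apply: eq_bigr => i _; congr (_ _); rewrite /upd /mix ltnS leq_eqVlt (inj_eq val_inj).
    by case: eqP => [->|].
  have -> : tens (mix j) x = tens (upd (mix j) j (F' j)) x.
    apply: eq_bigr => i _; congr (_ _); rewrite /upd /mix.
    by case: eqP => [->|//]; rewrite ltnn.
  rewrite !tens_upd -mulrBl; congr (_ * _).
  by apply: eq_bigr => i ij; rewrite /upd (negbTE ij).
have /choice[C hC] : forall j, exists C : R, 0 <= C /\ forall u G, Wgrad p u G ->
    `|\int[mu]_x (u x * 'D_('e_j) (phi j) x)| <= C * pnorm p G.
  by move=> j; have [C C0 hC] := test_deriv_bounded p1 j (tphi j); exists C.
exists (\sum_j C j); first by apply: sumr_ge0 => j _; case: (hC j).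
move=> u G WG; have lu := Wgrad_locint WG.
pose a k := \int[mu]_x (u x * tens (mix k) x).
have -> : \int[mu]_x (u x * tens F x) - \int[mu]_x (u x * tens F' x) = a n - a 0.
  congr (_ - _); congr Rintegral; apply/funext => x; congr (_ * _); apply: eq_bigr => i _.
  by rewrite /mix ltn_ord.
rewrite -telescope_sumr// big_mkord mulr_suml.
apply: (le_trans (ler_norm_sum _ _ _)); apply: ler_sum => j _.
have [_ /(_ u G WG)] := hC j; apply: le_trans.
rewrite /a -RintegralB//; [|exact: integrable_mul_test..].
rewrite le_eqVlt; apply/orP; left; apply/eqP; congr (`| _ |); congr Rintegral.
by apply/funext => x; rewrite phiE mulrBr.
Qed.

End tens_replace.

Lemma half_exp_small {R : realType} (e : R) : 0 < e -> exists k, 2^-1 ^+ k < e.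
Proof.
move=> e0; exists (Num.truncn e^-1).+1.
rewrite exprVn invf_plt ?posrE ?exprn_gt0//.
apply: (@lt_trans _ _ (Num.truncn e^-1).+1%:R); first exact: truncnS_gt.
by rewrite -natrX ltr_nat ltn_expl.
Qed.

Lemma powR_expn {R : realType} (a r : R) k : 0 <= a -> (a ^+ k) `^ r = (a `^ r) ^+ k.
Proof.
by move=> a0; rewrite -powR_mulrn// -powRrM mulrC powRrM powR_mulrn ?powR_ge0.
Qed.

(** * Averages against a bump at all scales *)

Section bump_averages.
Context {R : realType} {n : nat} (p : R) (b S : R -> R) (c : R).
Hypothesis n0 : (0 < n)%N.
Hypothesis np : n%:R < p.
Hypotheses (sb : smooth1 b) (b0 : forall t, 0 <= b t) (bout : forall t, 1 < `|t| -> b t = 0).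
Hypotheses (sS : smooth1 S) (dS : forall t, deriv_at S t (b t)).
Hypotheses (c0 : 0 < c) (Sb : forall t, 0 <= S t <= c).
Hypotheses (S0 : forall t, t <= -1 -> S t = 0) (Sc : forall t, 1 <= t -> S t = c).
Hypothesis bint : (\int[@lebesgue_measure R]_t (b t)%:E = c%:E)%E.
Local Notation mu := (@lebesgue_rV R n).
Implicit Types (u : 'rV[R]_n -> R) (G : 'rV[R]_n -> 'rV[R]_n).

Let rho := tens (fun _ : 'I_n => b).
Let avg u := \int[mu]_x (u x * rho x).
Let al := 1 - n%:R / p.

Let p1 : 1 < p. Proof. by apply: le_lt_trans np; rewrite ler1n. Qed.
Let p0 : 0 < p. Proof. exact: lt_trans p1. Qed.
Let al0 : 0 < al. Proof. by rewrite subr_gt0 ltr_pdivrMr// mul1r. Qed.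

(** Averaging the dilated function amounts to averaging [u] against the kernel with factors
    [2 * b (2 * t)]. These have the same integral as [b], and [S (2 * t) - S t] is a primitive of
    the difference with bounded support, so [tens_replace] applies. *)
Lemma avg_dilate : exists2 C : R, 0 <= C & forall u G, Wgrad p u G ->
  `|avg (u \o simil 0 2^-1 1%:M) - avg u| <= C * pnorm p G.
Proof.
(* The [+ 0] fits the shape [a * t + d] of the affine substitution lemmas. *)
have out (i : 'I_n) t : 1 < `|t| -> [/\ 2 * b (2 * t + 0) = 0, b t = 0 & S (2 * t + 0) - S t = 0].
  move=> t1; split; last 1 first.
  - move: t1; rewrite addr0 lter_normr => /orP[] t1.
      by rewrite !Sc ?subrr//; lra.
    by rewrite !S0 ?subrr//; lra.
  - by rewrite bout ?mulr0// addr0 normrM ger0_norm//; have := normr_ge0 t; lra.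
  - exact: bout.
have [C C0 hC] := @tens_replace R n p p1 1 (fun=> fun t => 2 * b (2 * t + 0)) (fun=> b)
  (fun=> fun t => S (2 * t + 0) - S t)
  (fun=> smooth1Z 2 (smooth1_affine 2 0 sb)) (fun=> sb)
  (fun=> smooth1B (smooth1_affine 2 0 sS) sS) out
  (fun _ t => deriv_atB (deriv_at_affine_comp 2 0 dS t) (dS t)).
exists C => // u G WG.
have -> : avg (u \o simil 0 2^-1 1%:M) = \int[mu]_x (u x * tens (fun=> fun t => 2 * b (2 * t + 0)) x).
  pose f x := u x * rho (2 *: x).
  have E x : f x = 2 ^- n * (u x * tens (fun=> fun t => 2 * b (2 * t + 0)) x).
    rewrite /f mulrCA; congr (_ * _); rewrite /tens big_split/= prodr_const card_ord mulKf//.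
    by apply: eq_bigr => i _; rewrite mxE addr0.
  have tT : test_function (tens (fun _ : 'I_n => fun t => 2 * b (2 * t + 0))).
    apply: (@test_tens _ _ _ 1) => i; first exact: smooth1Z (smooth1_affine 2 0 sb).
    by move=> t t1; rewrite bout ?mulr0// addr0 normrM ger0_norm//; have := normr_ge0 t; lra.
  have iT := integrable_mul_test (Wgrad_locint WG) tT.
  have iF : mu.-integrable setT (EFin \o f).
    rewrite (_ : f = fun x => 2 ^- n * (u x * tens (fun=> fun t => 2 * b (2 * t + 0)) x)); last exact/funext.
    exact: (integrableZl measurableT (2 ^- n) iT).
  have h : 0 < 2^-1 :> R by rewrite invr_gt0.
  have := @Rintegral_simil R n 0 2^-1 1%:M f h _ iF; rewrite trmx1 mulmx1 => /(_ erefl).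
  have -> : \int[mu]_x f x = 2 ^- n * \int[mu]_x (u x * tens (fun=> fun t => 2 * b (2 * t + 0)) x).
    by rewrite -RintegralZl//; congr Rintegral; apply/funext => x; rewrite E.
  rewrite mulrA exprVn invrK mulfV ?expf_neq0// mul1r => <-.
  congr Rintegral; apply/funext => x; rewrite /f /=; congr (_ * rho _).
  by rewrite /simil add0r mulmx1 scalerA mulfV// scale1r.
exact: hC.
Qed.

Lemma test_rho : test_function rho.
Proof. by apply: (@test_tens _ _ _ 1) => // i t; exact: bout. Qed.

Lemma rho_ge0 x : 0 <= rho x.
Proof. by apply: prodr_ge0 => i _. Qed.

Lemma Rintegral_rho : \int[mu]_x rho x = c ^+ n.
Proof.
rewrite /Rintegral ge0_integral_tens//; last first.
  by move=> i; apply: continuous_measurable_fun; exact: smooth1_continuous.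
by under eq_bigr do rewrite bint; rewrite prodEFin prodr_const card_ord.
Qed.

(** Translating [u] changes one factor of the kernel to [b (t - L)], and [S (t - L) - S t] is a
    primitive of the change with bounded support. The length [L] is arbitrary: [L = 1] serves the
    general inequality, large [L] the sharp one in dimension one. *)
Lemma avg_shift (L : R) (i : 'I_n) : 0 <= L ->
  let phi := tens (upd (fun=> b) i (fun t => S (1 * t - L) - S t)) in
  test_function phi /\ forall u, locally_integrable_rV u ->
    avg (u \o simil (L *: 'e_i) 1 1%:M) - avg u = \int[mu]_x (u x * 'D_('e_i) phi x).
Proof.
move=> L0 phi.
have tsh : test_function (tens (upd (fun=> b) i (fun t => b (1 * t - L)))).
  apply: (@test_tens _ _ _ (1 + L)) => j; rewrite /upd; case: ifP => _ //.
    exact: smooth1_affine.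
    move=> t tL; apply: bout; rewrite mul1r; have := lerB_dist t L; rewrite [`|L|]ger0_norm//; lra.
  by move=> t tL; apply: bout; lra.
split.
  apply: (@test_tens _ _ _ (1 + L)) => j; rewrite /upd; case: ifP => _ //.
    by apply: smooth1B => //; exact: smooth1_affine.
    move=> t; rewrite lter_normr => /orP[] tL; first by rewrite !Sc ?subrr//; lra.
    by rewrite !S0 ?subrr//; lra.
  by move=> t tL; apply: bout; lra.
move=> u lu.
have phiE x : 'D_('e_i) phi x = tens (upd (fun=> b) i (fun t => b (1 * t - L))) x - rho x.
  have d t : deriv_at (upd (fun=> b) i (fun t => S (1 * t - L) - S t) i) t (b (1 * t - L) - b t).
    rewrite /upd eqxx; apply: deriv_atB => //.
    by have := deriv_at_affine_comp 1 (- L) dS t; rewrite mul1r.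
  have [_ ->] := @is_derive_tens _ _ _ i x _ d.
  rewrite /rho !tens_upd [tens (fun=> b) x](bigD1 i)//= mulrBl; congr (_ * _ - _ * _).
    by apply: eq_bigr => j ji; rewrite /upd (negbTE ji).
  by apply: eq_bigr => j ji; rewrite /upd (negbTE ji).
have -> : avg (u \o simil (L *: 'e_i) 1 1%:M) =
    \int[mu]_x (u x * tens (upd (fun=> b) i (fun t => b (1 * t - L))) x).
  rewrite -(Rintegral_shift (L *: 'e_i) (integrable_mul_test lu tsh)).
  congr Rintegral; apply/funext => x; rewrite /= /simil mulmx1 scale1r addrC; congr (_ * _).
  apply: eq_bigr => j _; rewrite /upd !mxE eqxx /=; case: eqP => _.
    by rewrite mulr1 mul1r addrK.
  by rewrite mulr0 addr0.
rewrite /avg -RintegralB//; [|exact: integrable_mul_test lu tsh|exact: integrable_mul_test lu test_rho].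
by congr Rintegral; apply/funext => x; rewrite phiE mulrBr.
Qed.

(** The kernel is supported in the unit cube, so the dilated function samples [u] only at points
    whose coordinates are at most 2^-k in absolute value. *)
Lemma avg_dilate_cvg u (e : R) : continuous u -> 0 < e ->
  exists k0, forall k, (k0 <= k)%N -> `|avg (u \o simil 0 (2^-1 ^+ k) 1%:M) - u 0 * c ^+ n| <= e * c ^+ n.
Proof.
move=> cu e0.
have /nbhs_ballP[d /= d0 hd] : \forall x \near (0 : 'rV[R]_n), ball (u 0) e (u x).
  by apply: cu; apply/nbhs_ballP; exists e.
have [k0 hk0] := half_exp_small d0; exists k0 => k kk.
set r := 2^-1 ^+ k.
have r0 : 0 < r by rewrite exprn_gt0.
have rd : r < d.
  apply: le_lt_trans hk0; rewrite ler_wiXn2l//; lra.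
have tr : test_function rho by exact: test_rho.
have lu : locally_integrable_rV (u \o simil 0 r 1%:M).
  apply: continuous_locally_integrable => x; apply: continuous_comp; first exact: simil_continuous.
  exact: cu.
have i1 := integrable_mul_test lu tr; have ir := integrable_test tr.
have i2 : mu.-integrable setT (EFin \o (fun x => u 0 * rho x)) by exact: (integrableZl measurableT (u 0) ir).
rewrite -Rintegral_rho -RintegralZl// /avg -RintegralB//.
apply: (le_trans (le_normr_Rintegral measurableT (integrableB measurableT i1 i2))).
rewrite -RintegralZl//; apply: le_Rintegral => //.
- have i3 : mu.-integrable setT (EFin \o (fun x => (u \o simil 0 r 1%:M) x * rho x - u 0 * rho x)).
    exact: (integrableB measurableT i1 i2).
  exact: (integrable_norm i3).
- exact: (integrableZl measurableT e ir).
move=> x _; rewrite -mulrBl normrM [`|rho x|]ger0_norm; last exact: rho_ge0.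
have [->|rx] := eqVneq (rho x) 0; first by rewrite !mulr0.
rewrite ler_wpM2r//; first exact: rho_ge0.
rewrite ltW// distrC; apply: (hd (simil 0 r 1%:M x)); apply/rV_ballP; split => // i.
rewrite /simil add0r mulmx1 !mxE sub0r normrN normrM gtr0_norm//.
apply: le_lt_trans rd; rewrite ger_pMr// leNgt.
apply: contra_neqN rx => xi; apply/eqP/prodf_eq0; exists i => //; apply/eqP; exact: bout.
Qed.

Lemma Wgrad_dilate u G (r : R) : 0 < r -> Wgrad p u G ->
  exists2 G', Wgrad p (u \o simil 0 r 1%:M) G' & pnorm p G' = r `^ al * pnorm p G.
Proof.
move=> r0 WG; have QQ : 1%:M *m (1%:M)^T = 1%:M :> 'M[R]_n by rewrite trmx1 mulmx1.
exists (fun x => r *: (G (simil 0 r 1%:M x) *m 1%:M^T)).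
  exact: (Wgrad_simil (ltW p1) 0 r0 QQ WG).
by apply: pnorm_simil => //; [exact: ltW|case: WG].
Qed.

(** Passing from scale 2^-k to the next costs at most [C * q ^+ k * N] by [avg_dilate], and [q < 1]
    because n < p. A geometric series bounds the drift through all scales, while the averages tend
    to [u 0 * c ^+ n]. *)
Lemma avg_center : exists2 C : R, 0 <= C & forall u G, Wgrad p u G ->
  `|avg u - u 0 * c ^+ n| <= C * pnorm p G.
Proof.
have [C C0 hC] := avg_dilate.
pose q : R := 2^-1 `^ al.
have q0 : 0 <= q by exact: powR_ge0.
have q1 : q < 1.
  have := @gt0_ltr_powR R al al0 2^-1 1; rewrite powR1 !nnegrE; apply => //.
  by rewrite invf_lt1// ltr1n.
have q1' : 0 < 1 - q by rewrite subr_gt0.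
exists (C / (1 - q)); first by rewrite divr_ge0// ltW.
move=> u G WG; set N := pnorm p G; have N0 : 0 <= N by exact: pnorm_ge0.
have step k : `|avg (u \o simil 0 (2^-1 ^+ k) 1%:M) - avg u| <= C * N * ((1 - q ^+ k) / (1 - q)).
  elim: k => [|k IH].
    rewrite expr0 (_ : u \o _ = u) ?subrr ?normr0 ?mul0r ?mulr0//.
    by apply/funext => x; rewrite /= /simil add0r scale1r mulmx1.
  have rk : 0 < 2^-1 ^+ k :> R by rewrite exprn_gt0.
  have [G' WG' NG'] := Wgrad_dilate rk WG.
  have := hC _ _ WG'; rewrite NG' powR_expn// -/q -/N.
  rewrite (_ : (u \o _) \o _ = u \o simil 0 (2^-1 ^+ k.+1) 1%:M); last first.
    by apply/funext => x; rewrite /= /simil !add0r !mulmx1 scalerA exprSr.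
  move=> h; have := lerD h IH.
  rewrite -/(avg (u \o simil 0 (2^-1 ^+ k.+1) 1%:M)) -/(avg (u \o simil 0 (2^-1 ^+ k) 1%:M)).
  move=> h2; apply: (le_trans _ (le_trans h2 _)).
    apply: le_trans (ler_normD _ _); by rewrite addrA subrK.
  rewrite le_eqVlt; apply/orP; left; apply/eqP; rewrite exprS; field.
  by rewrite gt_eqF.
have step' k : `|avg (u \o simil 0 (2^-1 ^+ k) 1%:M) - avg u| <= C / (1 - q) * N.
  apply: (le_trans (step k)); rewrite [X in _ <= X]mulrAC.
  rewrite ler_wpM2l ?mulr_ge0// -[X in _ <= X]mul1r ler_wpM2r ?invr_ge0 ?(ltW q1')//.
  by rewrite gerBl exprn_ge0.
apply/ler_addgt0Pr => e e0.
have cn0 : 0 < c ^+ n by rewrite exprn_gt0.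
have [cu _ _] := WG.
have [k /(_ k (leqnn k)) hk] := avg_dilate_cvg cu (divr_gt0 e0 cn0).
rewrite divfK ?gt_eqF// in hk.
apply: le_trans (lerD (step' k) hk).
rewrite [X in _ <= X + _]distrC; apply: le_trans (ler_normD _ _).
by rewrite addrA subrK.
Qed.

(** The path goes from [u 0] to the average of [u], to that of its translate, to [u 'e_i]. The outer
    links cost [C] each by [avg_center], the middle one costs [D] by [avg_shift], and averages carry
    the mass [c ^+ n]. *)
Lemma morrey_unit (i : 'I_n) : exists2 C : R, 0 <= C & forall u G, Wgrad p u G ->
  `|u 0 - u 'e_i| <= C * pnorm p G.
Proof.
have [C C0 hC] := avg_center.
have [tphi havg] := avg_shift i ler01.
have [D D0 hD] := test_deriv_bounded p1 i tphi.
have cn0 : 0 < c ^+ n by rewrite exprn_gt0.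
exists ((C + D + C) / c ^+ n); first by rewrite divr_ge0 ?addr_ge0// ltW.
move=> u G WG; have QQ : 1%:M *m (1%:M)^T = 1%:M :> 'M[R]_n by rewrite trmx1 mulmx1.
set N := pnorm p G.
have W2 := Wgrad_simil (ltW p1) (1 *: 'e_i) ltr01 QQ WG.
have LG : Lp_field p G by case: WG.
have N2 := pnorm_simil (ltW p1) (1 *: 'e_i) ltr01 QQ LG.
rewrite powR1 mul1r -/N in N2.
have h1 := hC _ _ WG; have h2 := hC _ _ W2; rewrite N2 in h2.
have h3 := hD _ _ WG; rewrite -havg in h3; last exact: Wgrad_locint WG.
have E : (u \o simil (1 *: 'e_i) 1 1%:M) 0 = u 'e_i.
  by rewrite /= /simil mul0mx scaler0 addr0 scale1r.
rewrite E -/N in h2.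
rewrite mulrAC ler_pdivlMr// -[X in _ * X](gtr0_norm cn0) -normrM mulrBl.
rewrite !mulrDl; apply: le_trans (lerD (lerD h1 h3) h2).
rewrite -/(avg u) -/(avg (u \o simil (1 *: 'e_i) 1 1%:M)).
rewrite [X in _ <= X + _ + _]distrC [X in _ <= _ + X + _]distrC.
apply: le_trans (lerD (ler_normD _ _) (lexx _)).
apply: le_trans (ler_normD _ _).
rewrite le_eqVlt; apply/orP; left; apply/eqP; congr (`| _ |).
set a1 := avg u; set a2 := avg _; ring.
Qed.

End bump_averages.

Lemma enorm_delta {R : realType} {n : nat} (i : 'I_n) : enorm ('e_i : 'rV[R]_n) = 1.
Proof.
apply/eqP; rewrite -(@eqrXn2 _ 2) ?enorm_ge0// expr1n sqr_enorm (bigD1 i)//= big1.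
  by rewrite mxE !eqxx expr1n addr0.
by move=> j ji; rewrite mxE (negbTE ji) andbF expr0n.
Qed.

(* The witness is the Householder reflection exchanging the two vectors. *)
Lemma orthogonal_to_unit {R : realType} {n : nat} (e f : 'rV[R]_n) : enorm e = 1 -> enorm f = 1 ->
  exists2 Q : 'M[R]_n, Q *m Q^T = 1%:M & e *m Q = f.
Proof.
move=> e1 f1; have [->|ef] := eqVneq e f.
  by exists 1%:M; rewrite ?trmx1 mulmx1.
pose w := e - f; pose s := (w *m w^T) 0 0.
have s0 : s != 0.
  by rewrite /s -sqr_enormE expf_neq0// enorm_eq0 subr_eq0.
have ww : w *m w^T = s%:M by rewrite [LHS]mx11_scalar.
have sE : s = 2 * (e *m w^T) 0 0.
  have := sqr_enormE e; have := sqr_enormE f; rewrite e1 f1 expr1n => ff ee.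
  have fe : (f *m e^T) 0 0 = (e *m f^T) 0 0.
    by rewrite !mxE; apply: eq_bigr => i _; rewrite !mxE mulrC.
  rewrite /s /w linearB/= mulmxBl !mulmxBr !mxE.
  move: ff ee fe; rewrite !mxE => <- <- ->; ring.
have ew : e *m w^T = (s / 2)%:M by rewrite [LHS]mx11_scalar sE mulrAC divff// mul1r.
pose X := w^T *m w; have XX : X *m X = s *: X.
  by rewrite /X -mulmxA (mulmxA w) ww mul_scalar_mx -scalemxAr.
pose Q := 1%:M - (2 / s) *: X.
have QT : Q^T = Q by rewrite /Q linearB/= trmx1 linearZ/= trmx_mul trmxK.
exists Q.
  rewrite QT {2}/Q mulmxBr mulmx1 -scalemxAr /Q mulmxBl mul1mx -scalemxAl XX scalerA.
  move: (X) (1%:M : 'M[R]_n) => Y I; apply/matrixP => i j; rewrite !mxE; field.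
  exact: s0.
rewrite /Q mulmxBr mulmx1 -scalemxAr /X mulmxA ew mul_scalar_mx scalerA.
have -> : 2 / s * (s / 2) = 1 by field.
by rewrite scale1r /w opprB addrC subrK.
Qed.

Lemma simil_pair {R : realType} {n : nat} (i : 'I_n) (x y : 'rV[R]_n) : x != y ->
  exists Q : 'M[R]_n, [/\ Q *m Q^T = 1%:M, simil x (enorm (x - y)) Q 0 = x &
    simil x (enorm (x - y)) Q 'e_i = y].
Proof.
move=> xy; have r0 : 0 < enorm (x - y) by rewrite enorm_gt0 subr_eq0.
have f1 : enorm ((enorm (x - y))^-1 *: (y - x)) = 1.
  by rewrite enormZ gtr0_norm ?invr_gt0// enormB_sym mulVf// gt_eqF// enormB_sym.
have [Q QQ eQ] := orthogonal_to_unit (enorm_delta i) f1.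
exists Q; split => //; first by rewrite /simil mul0mx scaler0 addr0.
by rewrite /simil eQ scalerA mulfV ?gt_eqF// scale1r addrC subrK.
Qed.

Section morrey.
Context {R : realType} {n : nat} (p : R).
Hypothesis n0 : (0 < n)%N.
Hypothesis np : n%:R < p.
Implicit Types (u : 'rV[R]_n -> R) (G : 'rV[R]_n -> 'rV[R]_n).
Let al := 1 - n%:R / p.
Let p1 : 1 < p. Proof. by apply: le_lt_trans np; rewrite ler1n. Qed.

Lemma Wgrad_unit_pair (i : 'I_n) u G x y : Wgrad p u G -> x != y ->
  exists u' G', [/\ Wgrad p u' G', u' 0 = u x, u' 'e_i = u y & pnorm p G' = enorm (x - y) `^ al * pnorm p G].
Proof.
move=> WG xy; have [Q [QQ Q0 Qe]] := simil_pair i xy.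
have r0 : 0 < enorm (x - y) by rewrite enorm_gt0 subr_eq0.
have LG : Lp_field p G by case: WG.
exists (u \o simil x (enorm (x - y)) Q); eexists; split.
- exact: (Wgrad_simil (ltW p1) x r0 QQ WG).
- by rewrite /= Q0.
- by rewrite /= Qe.
- exact: (pnorm_simil (ltW p1) x r0 QQ LG).
Qed.

Lemma morrey : exists2 C : R, 0 <= C & forall u G, Wgrad p u G -> forall x y,
  `|u x - u y| <= C * enorm (x - y) `^ al * pnorm p G.
Proof.
have [b [S [c [[sb b0] bout [sS dS] [c0 Sb S0 Sc] bint]]]] := @bump_primitive R.
have [C C0 hC] := morrey_unit n0 np sb b0 bout sS dS c0 S0 Sc bint (Ordinal n0).
exists C => // u G WG x y; have [->|xy] := eqVneq x y.
  by rewrite subrr normr0 !mulr_ge0 ?powR_ge0 ?pnorm_ge0.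
have [u' [G' [WG' <- <- N']]] := Wgrad_unit_pair (Ordinal n0) WG xy.
by have := hC _ _ WG'; rewrite N' mulrA.
Qed.

End morrey.

Lemma lebesgue_slab {R : realType} (a b : R) : a <= b ->
  lebesgue_rV 1 [set x : 'rV[R]_1 | a <= x 0 0 <= b] = (b - a)%:E.
Proof.
move=> ab; pose A : set 'rV[R]_1 := [set x | a <= x 0 0 <= b].
have mA : measurable A.
  rewrite (_ : A = prod_rV (fun=> `[a, b]%classic)).
    by apply: measurable_prod_rV => i; exact: measurable_itv.
  apply/seteqP; split=> x /= h; last by have := h 0; rewrite /= in_itv.
  by move=> i; rewrite ord1 /= in_itv.
rewrite -[X in lebesgue_rV 1 X]setIT -integral_indic// ge0_integral_lebesgue_rVS; last 2 first.
- by apply/measurable_EFinP; exact: measurable_indic.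
- by move=> x; rewrite lee_fin.
under eq_integral => t _.
  rewrite ge0_integral_lebesgue_rV0; last 2 first.
  - apply/measurable_EFinP; apply: measurableT_comp; first exact: measurable_indic.
    by apply: measurableT_comp => //; exact: measurable_cons_rV.
  - by move=> y; rewrite lee_fin.
  rewrite (_ : \1_A (cons_rV (t, 0)) = \1_(`[a, b]%classic : set R) t); last first.
    rewrite !indicE; congr (nat_of_bool _)%:R; apply/idP/idP; rewrite !inE /A /= in_itv/= /cons_rV mxE;
      by case: splitP => j //; rewrite mxE.
  over.
rewrite integral_indic//= setIT.
have := @lebesgue_measure_itv R `[a, b] => /= ->.
rewrite lte_fin; case: ifPn => [_|]; first by rewrite EFinB.
by rewrite -leNgt => ba; rewrite (@le_anti _ _ a b) ?subrr// ab ba.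
Qed.

(** * The sharp bound in dimension one *)

Section morrey1.
Context {R : realType} (p : R).
Hypothesis p1 : 1 < p.
Implicit Types (u : 'rV[R]_1 -> R) (G : 'rV[R]_1 -> 'rV[R]_1).
Let al := 1 - p^-1.

(** The function [S (t - L) - S t] is bounded by [c] and supported in an interval of length [L + 2],
    so after division by [c] Hoelder's inequality gives a leading term with coefficient 1. The error
    [K] made by averaging at the two ends does not depend on [L]. *)
Lemma morrey1_scaled : exists2 K : R, 0 <= K & forall (L : R), 0 < L -> forall u G, Wgrad p u G ->
  `|u 0 - u (L *: 'e_0)| <= ((L + 2) `^ al + K) * pnorm p G.
Proof.
have [b [S [c [[sb b0] bout [sS dS] [c0 Sb S0 Sc] bint]]]] := @bump_primitive R.
have [C C0 hC] := @avg_center R 1 p b S c (ltn0Sn 0) p1 sb b0 bout sS dS c0 S0 Sc bint.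
exists (2 * C / c); first by rewrite !mulr_ge0// invr_ge0 ltW.
move=> L L0 u G WG; have QQ : 1%:M *m (1%:M)^T = 1%:M :> 'M[R]_1 by rewrite trmx1 mulmx1.
have [tphi havg] := @avg_shift R 1 b S c sb bout sS dS S0 Sc L 0 (ltW L0).
set phi := tens _ in tphi havg.
have hphi x : `|phi x| <= c * \1_[set x : 'rV[R]_1 | - 1 <= x 0 0 <= L + 1] x.
  rewrite /phi /tens big_ord1 /upd eqxx indicE mul1r; set t := x 0 0.
  have [_|h] := boolP (x \in _).
    rewrite mulr1 ler_norml; have := Sb t; have := Sb (t - L); lra.
  move: h; rewrite notin_setE /= => /negP; rewrite negb_and -!ltNge -/t => /orP[h|h].
    by rewrite !S0 ?subrr ?normr0 ?mulr0//; lra.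
  by rewrite !Sc ?subrr ?normr0 ?mulr0//; lra.
have slab : lebesgue_rV 1 [set x : 'rV[R]_1 | - 1 <= x 0 0 <= L + 1] = (L + 2)%:E.
  by rewrite lebesgue_slab; [congr (_%:E); ring|lra].
have mslab : measurable [set x : 'rV[R]_1 | - 1 <= x 0 0 <= L + 1].
  rewrite (_ : mkset _ = prod_rV (fun=> `[-1, L + 1]%classic)).
    by apply: measurable_prod_rV => i; exact: measurable_itv.
  apply/seteqP; split=> x /= h; last by have := h 0; rewrite /= in_itv.
  by move=> i; rewrite ord1 /= in_itv.
set N := pnorm p G.
have W2 := Wgrad_simil (ltW p1) (L *: 'e_0) ltr01 QQ WG.
have LG : Lp_field p G by case: WG.
have N2 := pnorm_simil (ltW p1) (L *: 'e_0) ltr01 QQ LG.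
rewrite powR1 mul1r -/N in N2.
have h1 := hC _ _ WG; have h2 := hC _ _ W2; rewrite N2 in h2.
have h3 := @holder_field R 1 p p1 G 0 phi c _ LG tphi (ltW c0) hphi mslab.
have [_ _ wG] := WG; have [_ wG0] := wG 0.
rewrite slab /= ltry -[X in `|X|]opprK -wG0// normrN -havg in h3; last exact: Wgrad_locint WG.
have {}h3 := h3 isT.
have E : (u \o simil (L *: 'e_0) 1 1%:M) 0 = u (L *: 'e_0).
  by rewrite /= /simil mul0mx scaler0 addr0.
rewrite E -/N !expr1 in h1 h2 h3.
have -> : (L + 2) `^ al + 2 * C / c = (c * (L + 2) `^ al + 2 * C) / c by field; rewrite gt_eqF.
rewrite mulrAC ler_pdivlMr// -[X in _ * X](gtr0_norm c0) -normrM mulrBl.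
have -> : (c * (L + 2) `^ al + 2 * C) * N = C * N + c * (L + 2) `^ al * N + C * N by ring.
apply: le_trans (lerD (lerD h1 h3) h2).
rewrite [X in _ <= X + _ + _]distrC [X in _ <= _ + X + _]distrC.
apply: le_trans (lerD (ler_normD _ _) (lexx _)).
apply: le_trans (ler_normD _ _).
rewrite le_eqVlt; apply/orP; left; apply/eqP; congr (`| _ |).
set a1 := Rintegral _ _ _; set a2 := Rintegral _ _ _; ring.
Qed.

(** Stretching the unit interval to length [L] multiplies the norm of the derivative by L^-al, so
    [morrey1_scaled] gives the factor ((L + 2)^al + K) / L^al, which tends to 1 as [L] grows. *)
Lemma morrey1 u G : Wgrad p u G -> forall x y,
  `|u x - u y| <= enorm (x - y) `^ al * pnorm p G.
Proof.
move=> WG x y; have [->|xy] := eqVneq x y.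
  by rewrite subrr normr0 mulr_ge0 ?powR_ge0 ?pnorm_ge0.
have [K K0 hK] := morrey1_scaled.
have p0 : 0 < p by exact: lt_trans p1.
have al0 : 0 < al by rewrite subr_gt0 invf_lt1.
have al1 : al <= 1 by rewrite gerBl invr_ge0 ltW.
have [u' [G' [WG' <- <- N']]] := @Wgrad_unit_pair R 1 p (ltn0Sn 0) p1 0 u G x y WG xy.
have alE : 1 - 1%:R / p = al by rewrite mul1r.
rewrite alE in N'; rewrite -N'.
set N := pnorm p G'; have N0 : 0 <= N by exact: pnorm_ge0.
have QQ : 1%:M *m (1%:M)^T = 1%:M :> 'M[R]_1 by rewrite trmx1 mulmx1.
have LG' : Lp_field p G' by case: WG'.
have main L : 0 < L -> `|u' 0 - u' 'e_0| <= N + (2 / L + K / L `^ al) * N.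
  move=> L0; have Li : 0 < L^-1 by rewrite invr_gt0.
  have W2 := Wgrad_simil (ltW p1) 0 Li QQ WG'.
  have N2 := pnorm_simil (ltW p1) 0 Li QQ LG'; rewrite alE -/N in N2.
  have := hK L L0 _ _ W2; rewrite N2 /= /simil mul0mx scaler0 !add0r mulmx1 scalerA mulVf ?gt_eqF// scale1r.
  move=> h; apply: (le_trans h).
  have La : 0 < L `^ al by exact: powR_gt0.
  have -> : L^-1 `^ al = (L `^ al)^-1.
    by apply: (mulIf (lt0r_neq0 La)); rewrite -powRM ?ltW// !mulVf ?gt_eqF// powR1.
  rewrite mulrA -{2}[N]mul1r -mulrDl ler_wpM2r//.
  rewrite (addrA 1) [X in X <= _]mulrDl; apply: lerD => //.
  have -> : L + 2 = L * (1 + 2 / L) by field; rewrite gt_eqF.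
  have l1 : 1 <= 1 + 2 / L by rewrite lerDl divr_ge0// ltW.
  rewrite (powRM _ (ltW L0) (le_trans ler01 l1)).
  rewrite mulrAC mulfV ?gt_eqF// mul1r.
  (* Since [al <= 1] and the base is at least 1, the power is bounded by the base. *)
  by apply: le_trans (ler_powR l1 al1) _; rewrite powRr1// (le_trans ler01).
have lim0 (e : R) : 0 < e -> exists2 L, 0 < L & 2 / L + K / L `^ al <= e.
  (* Each of the two bounds makes one summand at most [e / 2]; [K + 1] keeps the base positive even
     if [K = 0]. *)
  move=> e0; pose L := Num.max (4 / e) ((2 * (K + 1) / e) `^ al^-1).
  have L0 : 0 < L by rewrite lt_max divr_gt0.
  exists L => //; have -> : e = e / 2 + e / 2 by field.
  have Ke : 0 < 2 * (K + 1) / e by rewrite divr_gt0// mulr_gt0// ltr_wpDl.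
  apply: lerD.
    rewrite ler_pdivrMr// mulrC -ler_pdivrMr ?divr_gt0//.
    have -> : 2 / (e / 2) = 4 / e by field; rewrite gt_eqF.
    by rewrite le_max lexx.
  have La : 2 * (K + 1) / e <= L `^ al.
    have -> : 2 * (K + 1) / e = ((2 * (K + 1) / e) `^ al^-1) `^ al.
      by rewrite -powRrM mulVf ?gt_eqF// powRr1// ltW.
    apply: ge0_ler_powR; rewrite ?nnegrE ?powR_ge0 ?(ltW al0) ?(ltW L0)//.
    by rewrite le_max lexx orbT.
  rewrite ler_pdivrMr ?powR_gt0// mulrC -ler_pdivrMr ?divr_gt0//.
  apply: le_trans La; have -> : K / (e / 2) = 2 * K / e by field; rewrite gt_eqF.
  by rewrite ler_wpM2r ?invr_ge0 ?(ltW e0)// ler_wpM2l// lerDl.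
apply/ler_addgt0Pr => e e0.
have e1 : 0 < e / (N + 1) by rewrite divr_gt0// ltr_wpDl.
have [L L0 hL] := lim0 _ e1.
apply: (le_trans (main L L0)); rewrite lerD2l.
apply: (le_trans (ler_wpM2r N0 hL)); rewrite mulrAC ler_pdivrMr ?ltr_wpDl//.
by rewrite ler_wpM2l ?(ltW e0)// lerDl.
Qed.

End morrey1.

(** * Clarkson's inequalities *)

Section two_point.
Context {R : realType}.
Implicit Types a b x y m p q r s t : R.

(* [f a = (1 + x a^(-m)) (1 + x a)^m + (1 - x a^(-m)) (1 - x a)^m] is nonincreasing
   on ]0, 1]; the two sides are [f 1] and [f (x^(1/m))]. *)
Lemma two_point_le1 m x : 1 <= m -> 0 <= x <= 1 ->
  (1 + x) `^ (m + 1) + (1 - x) `^ (m + 1) <= 2 * (1 + x `^ (1 + m^-1)) `^ m.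
Proof.
move=> m1 /andP[x0 x1]; have m0 : 0 < m by exact: lt_le_trans m1.
have mn0 : m != 0 by rewrite gt_eqF.
have m2 : m + 1 != 0 by rewrite gt_eqF// addr_gt0.
have mp : 1 + m^-1 != 0 by rewrite gt_eqF// addr_gt0// invr_gt0.
have [->|xn0] := eqVneq x 0; first by rewrite addr0 subr0 (powR0 mp) addr0 powR1 mulr1.
have {xn0}x0 : 0 < x by rewrite lt0r xn0.
have [->|xn1] := eqVneq x 1.
  rewrite subrr (powR0 m2) powR1 addr0 -[1 + 1]/(2%:R : R) powRD; last by rewrite pnatr_eq0 implybT.
  by rewrite powRr1// mulrC.
have {xn1 x1}x1 : x < 1 by rewrite lt_neqAle xn1.
pose f a := (1 + x * a `^ (- m)) * (x * a + 1) `^ m + (1 - x * a `^ (- m)) * (- x * a + 1) `^ m.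
pose f' a := m * x * (1 - a `^ (- m - 1)) * ((x * a + 1) `^ (m - 1) - (- x * a + 1) `^ (m - 1)).
have A0 a : 0 < a -> 0 < x * a + 1 by move=> a0; rewrite addr_gt0// mulr_gt0.
have B0 a : 0 < a <= 1 -> 0 < - x * a + 1.
  move=> /andP[a0 a1]; rewrite mulNr addrC subr_gt0; apply: le_lt_trans x1.
  by rewrite ler_piMr// ltW.
have df a : 0 < a <= 1 -> deriv_at f a (f' a).
  move=> /andP[a0 a1].
  have dp : deriv_at (fun a => a `^ (- m)) a (- m * a `^ (- m - 1)) by exact: is_derive1_powR.
  have dA : deriv_at (fun a => (x * a + 1) `^ m) a (m * (x * a + 1) `^ (m - 1) * x).
    apply: (@deriv_at_comp R (fun y => y `^ m) (fun a => x * a + 1)); last exact: deriv_at_affine.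
    by apply: is_derive1_powR; exact: A0.
  have dB : deriv_at (fun a => (- x * a + 1) `^ m) a (m * (- x * a + 1) `^ (m - 1) * - x).
    apply: (@deriv_at_comp R (fun y => y `^ m) (fun a => - x * a + 1)); last exact: deriv_at_affine.
    by apply: is_derive1_powR; apply: B0; rewrite a0.
  have d1 : deriv_at (fun a => 1 + x * a `^ (- m)) a (x * (- m * a `^ (- m - 1))).
    have := deriv_at_comp (deriv_at_affine x 1 _) dp.
    by congr deriv_at; apply/funext => y; rewrite addrC.
  have d2 : deriv_at (fun a => 1 - x * a `^ (- m)) a (- x * (- m * a `^ (- m - 1))).
    have := deriv_at_comp (deriv_at_affine (- x) 1 _) dp.
    by congr deriv_at; apply/funext => y; rewrite addrC mulNr.
  apply: (@eq_ind _ _ (deriv_at f a) (deriv_atD (deriv_atM d1 dA) (deriv_atM d2 dB))).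
  have aE : a `^ (- m) = a * a `^ (- m - 1).
    have -> : - m = 1 + (- m - 1) by ring.
    rewrite powRD ?powRr1 ?(ltW a0)//; last by rewrite (gt_eqF a0) implybT.
    by congr (_ * _ `^ _); ring.
  have AE : (x * a + 1) `^ m = (x * a + 1) * (x * a + 1) `^ (m - 1).
    by rewrite mulr_powRB1// ltW// A0.
  have BE : (- x * a + 1) `^ m = (- x * a + 1) * (- x * a + 1) `^ (m - 1).
    by rewrite mulr_powRB1// ltW// B0// a0.
  rewrite aE AE BE /f'; set z := a `^ _; set P := (x * a + 1) `^ _; set Q := (- x * a + 1) `^ _.
  ring.
have f'0 a : 0 < a <= 1 -> f' a <= 0.
  move=> /andP[a0 a1]; rewrite /f'; apply: mulr_le0_ge0.
    apply: mulr_ge0_le0; first by rewrite mulr_ge0// ltW.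
    rewrite subr_le0 -[X in X <= _](powRr0 a) ger_powR ?a0//.
    by lra.
  rewrite subr_ge0 ge0_ler_powR ?nnegrE ?subr_ge0 ?(ltW (A0 _ _)) ?(ltW (B0 _ _)) ?a0//.
  by rewrite lerD2r mulNr; have := mulr_gt0 x0 a0; lra.
pose a0 := x `^ m^-1.
have a00 : 0 < a0 by exact: powR_gt0.
have a01 : a0 <= 1.
  rewrite -[X in _ <= X](powRr0 x) ger_powR ?x0 ?ltW//.
  by rewrite invr_gt0.
have E0 : f a0 = 2 * (1 + x `^ (1 + m^-1)) `^ m.
  have e1 : x * a0 `^ (- m) = 1.
    by rewrite /a0 -powRrM mulrN mulVf// powR_inv1 ?ltW// mulfV// gt_eqF.
  rewrite /f e1 subrr mul0r addr0 -[1 + 1]/(2%:R : R); congr (_ * _ `^ _).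
  by rewrite addrC powRD ?(gt_eqF x0) ?implybT// powRr1// ltW.
have E1 : f 1 = (1 + x) `^ (m + 1) + (1 - x) `^ (m + 1).
  rewrite /f powR1 !mulr1 !(addrC _ 1).
  have e y : 0 <= y -> y * y `^ m = y `^ (1 + m).
    move=> y0; have := mulr_powRB1 y0 (addr_gt0 ltr01 m0).
    by rewrite addrAC subrr add0r.
  by rewrite (e (1 + x)) ?(e (1 - x))//; lra.
rewrite -E0 -E1; apply: (@ler0_derive1_nincr R f a0 1) => //.
- move=> a; rewrite in_itv/= => /andP[h1 h2].
  have h : 0 < a <= 1 by rewrite (lt_trans a00 h1) ltW.
  by have [] := df a h.
- move=> a; rewrite in_itv/= => /andP[h1 h2].
  have h : 0 < a <= 1 by rewrite (lt_trans a00 h1) ltW.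
  by rewrite derive1E; have [_ ->] := df a h; exact: f'0.
apply: continuous_in_subspaceT => a; rewrite inE /= in_itv/= => /andP[h1 h2].
apply/differentiable_continuous/derivable1_diffP.
have h : 0 < a <= 1 by rewrite (lt_le_trans a00 h1).
by have [] := df a h.
Qed.

(** Write z^r as z times z^(r-1) and enlarge the second factor to that of [s + t]. *)
Lemma powR_superadditive s t r : 0 <= s -> 0 <= t -> 1 <= r -> s `^ r + t `^ r <= (s + t) `^ r.
Proof.
move=> s0 t0 r1; have r0 : 0 < r by exact: lt_le_trans r1.
rewrite -(mulr_powRB1 s0 r0) -(mulr_powRB1 t0 r0) -(mulr_powRB1 (addr_ge0 s0 t0) r0) mulrDl.
have r10 : 0 <= r - 1 by rewrite subr_ge0.
apply: lerD; rewrite ler_wpM2l//; apply: ge0_ler_powR; rewrite ?nnegrE ?(addr_ge0 s0 t0)//.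
  by rewrite lerDl.
by rewrite lerDr.
Qed.

Lemma powR_midpoint s t r : 0 <= s -> 0 <= t -> 1 <= r ->
  (2^-1 * s + 2^-1 * t) `^ r <= 2^-1 * s `^ r + 2^-1 * t `^ r.
Proof.
move=> s0 t0 r1.
have h : (0 <= 2^-1 :> R) /\ (2^-1 <= 1 :> R) by split; lra.
pose k := @Itv01 R 2^-1 h.1 h.2.
have kE (x y : R) : conv k (x : R^o) (y : R^o) = 2^-1 * x + 2^-1 * y.
  by rewrite convRE /= /unstable.onem (_ : 1 - 2^-1 = 2^-1)//; field.
have := @convex_powR R r r1 k s t.
rewrite !inE /= !in_itv/= !andbT => /(_ s0 t0); rewrite -kE => h1.
by rewrite -kE; exact: h1.
Qed.

(** Dividing by the larger of [|a|] and [|b|] leaves one ratio in [-1, 1], whose sign merely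
    exchanges the two terms on the left. Then [two_point_le1] applies with m = 1/(p-1), because
    p/(p-1) = m + 1 and p = 1 + 1/m. *)
Lemma two_point p a b : 1 < p -> p <= 2 ->
  `|2^-1 * (a + b)| `^ (p / (p - 1)) + `|2^-1 * (a - b)| `^ (p / (p - 1)) <=
  (2^-1 * `|a| `^ p + 2^-1 * `|b| `^ p) `^ (p - 1)^-1.
Proof.
move=> p1 p2; have p10 : 0 < p - 1 by rewrite subr_gt0.
set q := p / (p - 1); set m := (p - 1)^-1.
have m1 : 1 <= m by rewrite /m invf_ge1//; lra.
have m0 : 0 < m by rewrite invr_gt0.
have qE : q = m + 1 by rewrite /q /m; field; rewrite gt_eqF.
have pE : p = 1 + m^-1 by rewrite /m invrK addrC subrK.
have p0 : 0 < p by exact: lt_trans p1.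
have pmq : p * m = q by [].
have qn0 : q != 0 by rewrite qE gt_eqF// addr_gt0.
wlog ab : a b / `|b| <= `|a| => [hw|].
  have [h|/ltW h] := leP `|b| `|a|; first exact: hw.
  have := hw b a h; rewrite [b + a]addrC [2^-1 * (b - a)](_ : _ = - (2^-1 * (a - b))); last by ring.
  by rewrite normrN [X in X `^ m]addrC.
have [a0|an0] := eqVneq a 0.
  have b0 : b = 0 by apply/eqP; rewrite -normr_le0 (le_trans ab)// a0 normr0.
  by rewrite a0 b0 subrr addr0 mulr0 normr0 powR0// addr0 powR_ge0.
have na0 : 0 < `|a| by rewrite normr_gt0.
set y := b / a; have y1 : `|y| <= 1 by rewrite normrM normfV ler_pdivrMr// mul1r.
have bE : b = a * y by rewrite mulrCA mulfV// mulr1.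
have e1 : `|2^-1 * (a + b)| = 2^-1 * (`|a| * `|1 + y|).
  by rewrite bE -{1}[a]mulr1 -mulrDr !normrM ger0_norm.
have e2 : `|2^-1 * (a - b)| = 2^-1 * (`|a| * `|1 - y|).
  by rewrite bE -{1}[a]mulr1 -mulrBr !normrM ger0_norm.
have e3 : `|b| = `|a| * `|y| by rewrite bE normrM.
have ev : `|1 + y| `^ q + `|1 - y| `^ q = (1 + `|y|) `^ q + (1 - `|y|) `^ q.
  move: y1; rewrite ler_norml => /andP[h1 h2].
  have [y0|y0] := leP 0 y; first by rewrite !ger0_norm//; lra.
  rewrite (ltr0_norm y0) opprK [LHS]addrC.
  by congr (_ `^ q + _ `^ q); rewrite ger0_norm//; lra.
rewrite e1 e2 e3 !powRM ?mulr_ge0// -!mulrDr ev.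
have yb : 0 <= `|y| <= 1 by rewrite normr_ge0.
have h := two_point_le1 m1 yb; rewrite -qE -pE in h.
have -> : `|a| `^ p + `|a| `^ p * `|y| `^ p = `|a| `^ p * (1 + `|y| `^ p) by ring.
rewrite !powRM ?mulr_ge0 ?addr_ge0 ?powR_ge0// -powRrM pmq.
(* The factor 2 split off here is the one on the right of [two_point_le1]. *)
have -> : 2^-1 `^ m = 2^-1 `^ q * 2 :> R.
  rewrite qE powRD; last by rewrite invr_eq0 pnatr_eq0 implybT.
  by rewrite powRr1// mulfVK.
rewrite -mulrA [2 * _]mulrCA ler_wpM2l ?powR_ge0// ler_wpM2l ?powR_ge0//.
Qed.

End two_point.

Section clarkson.
Context {R : realType} {n : nat} (p : R).
Hypothesis p1 : 1 < p.
Local Notation mu := (@lebesgue_rV R n).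
Implicit Types F G : 'rV[R]_n -> 'rV[R]_n.

Let p0 : 0 < p. Proof. exact: lt_trans p1. Qed.

(** The integration step common to both cases. The constant weights serve [p < 2], where the
    pointwise inequality must be made linear in the p-th powers before it can be integrated. *)
Lemma le_energy_lincomb (a b c : R) F G (A D : 'rV[R]_n -> 'rV[R]_n) : 0 <= a -> 0 <= b -> 0 <= c ->
  Lp_field p F -> Lp_field p G -> Lp_field p A -> Lp_field p D ->
  (forall x, a * enorm (A x) `^ p + b * enorm (D x) `^ p <=
     c * (2^-1 * enorm (F x) `^ p + 2^-1 * enorm (G x) `^ p)) ->
  a * pnorm p A `^ p + b * pnorm p D `^ p <=
    c * (2^-1 * pnorm p F `^ p + 2^-1 * pnorm p G `^ p).
Proof.
move=> a0 b0 c0 LF LG LA LD h.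
have lin (s t : R) (H K : 'rV[R]_n -> 'rV[R]_n) : 0 <= s -> 0 <= t -> Lp_field p H -> Lp_field p K ->
    (\int[mu]_x (s * enorm (H x) `^ p + t * enorm (K x) `^ p)%:E =
     (s * pnorm p H `^ p + t * pnorm p K `^ p)%:E)%E.
  move=> s0 t0 LH LK; have [mH _] := LH; have [mK _] := LK.
  have eH := energyE (ltW p1) LH; have eK := energyE (ltW p1) LK.
  under eq_integral => x _ do rewrite EFinD !EFinM.
  rewrite ge0_integralD//.
  - rewrite !ge0_integralZl//.
    + by rewrite -/(energy p H) -/(energy p K) eH eK EFinD !EFinM.
    + exact: measurable_energy.
    + by move=> x _; rewrite lee_fin powR_ge0.
    + exact: measurable_energy.
    + by move=> x _; rewrite lee_fin powR_ge0.
  - by move=> x _; rewrite -EFinM lee_fin mulr_ge0// powR_ge0.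
  - by apply: measurable_funeM; exact: measurable_energy.
  - by move=> x _; rewrite -EFinM lee_fin mulr_ge0// powR_ge0.
  - by apply: measurable_funeM; exact: measurable_energy.
have mlin (s t : R) (H K : 'rV[R]_n -> 'rV[R]_n) : Lp_field p H -> Lp_field p K ->
    measurable_fun setT (fun x => (s * enorm (H x) `^ p + t * enorm (K x) `^ p)%:E).
  move=> [mH _] [mK _]; apply/measurable_EFinP; apply: measurable_funD; apply: measurable_funM => //;
  by apply/measurable_EFinP; exact: measurable_energy.
rewrite -lee_fin -(lin _ _ _ _ a0 b0 LA LD) mulrDr !mulrA.
have c2 : 0 <= c * 2^-1 by rewrite mulr_ge0.
rewrite -(lin _ _ _ _ c2 c2 LF LG); apply: ge0_le_integral => //.
- by move=> x _; rewrite lee_fin addr_ge0// mulr_ge0// powR_ge0.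
- exact: mlin.
- exact: mlin.
by move=> x _; rewrite lee_fin; apply: le_trans (h x) _; rewrite mulrDr !mulrA.
Qed.

Lemma sqr_enorm_parallelogram (x y : 'rV[R]_n) :
  enorm (2^-1 *: (x + y)) ^+ 2 + enorm (2^-1 *: (x - y)) ^+ 2 =
  2^-1 * enorm x ^+ 2 + 2^-1 * enorm y ^+ 2.
Proof.
rewrite !sqr_enorm !mulr_sumr -!big_split/=; apply: eq_bigr => i _.
by rewrite !mxE; field.
Qed.

(** The parallelogram identity raised to the power p/2 >= 1: superadditivity handles the left side,
    convexity the right side. *)
Lemma clarkson_point_ge2 (x y : 'rV[R]_n) : 2 <= p ->
  enorm (2^-1 *: (x + y)) `^ p + enorm (2^-1 *: (x - y)) `^ p <=
  2^-1 * enorm x `^ p + 2^-1 * enorm y `^ p.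
Proof.
move=> p2; pose r := p / 2; have r1 : 1 <= r by rewrite /r ler_pdivlMr// mul1r.
have E (z : 'rV[R]_n) : enorm z `^ p = (enorm z ^+ 2) `^ r.
  by rewrite -powR_mulrn ?enorm_ge0// -powRrM /r mulrCA mulfV// mulr1.
rewrite !E; apply: le_trans (powR_superadditive _ _ r1) _; rewrite ?sqr_ge0//.
by rewrite sqr_enorm_parallelogram powR_midpoint ?sqr_ge0.
Qed.

(** Hoelder's inequality for two terms with exponents 1/(2-p) and 1/(p-1); the powers on the weights
    fit because q - p = q (2 - p). *)
Lemma hoelder_weights (a d s t : R) : p < 2 ->
  let q := p / (p - 1) in
  a `^ (q - p) * s `^ p + d `^ (q - p) * t `^ p <=
  ((a `^ q + d `^ q) `^ (2 - p) * (s `^ q + t `^ q) `^ (p - 1))%R.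
Proof.
move=> p2; hnf; set q := p / (p - 1).
have p10 : 0 < p - 1 by rewrite subr_gt0.
have p20 : 0 < 2 - p by rewrite subr_gt0.
set m := (p - 1)^-1; have m0 : 0 < m by rewrite invr_gt0.
have qp : q - p = q * (2 - p) by rewrite /q; field; rewrite gt_eqF.
have wE z : (z `^ (q - p)) `^ (2 - p)^-1 = z `^ q.
  by rewrite -powRrM qp mulfK// gt_eqF.
have vE z : (z `^ p) `^ m = z `^ q by rewrite -powRrM.
have pq : (2 - p)^-1^-1 + m^-1 = 1 by rewrite /m !invrK; ring.
have i20 : 0 < (2 - p)^-1 by rewrite invr_gt0.
apply: le_trans (hoelder2 (powR_ge0 _ _) (powR_ge0 _ _) (powR_ge0 _ _) (powR_ge0 _ _) i20 m0 pq) _.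
by rewrite (wE a) (wE d) (vE s) (vE t) !invrK.
Qed.

(** In dimension one [enorm] is an absolute value, so [two_point] bounds the second factor of
    [hoelder_weights]. The free weights [a] and [d] linearize the inequality and do the work of the
    reverse Minkowski inequality in L^(p-1). *)
Lemma clarkson_point_lt2 (a d : R) (x y : 'rV[R]_n) : p < 2 -> n = 1%N ->
  a `^ (p / (p - 1) - p) * enorm (2^-1 *: (x + y)) `^ p +
    d `^ (p / (p - 1) - p) * enorm (2^-1 *: (x - y)) `^ p <=
  (a `^ (p / (p - 1)) + d `^ (p / (p - 1))) `^ (2 - p) * (2^-1 * enorm x `^ p + 2^-1 * enorm y `^ p).
Proof.
move=> p2 n1; apply: (le_trans (hoelder_weights _ _ _ _ p2)); apply: ler_wpM2l; first exact: powR_ge0.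
have p10 : 0 < p - 1 by rewrite subr_gt0.
have en (z : 'rV[R]_n) : enorm z = `|z 0 (cast_ord (esym n1) 0)|.
  rewrite -sqrtr_sqr; congr Num.sqrt; rewrite (bigD1 (cast_ord (esym n1) 0))//= big1 ?addr0//.
  move=> i /eqP; case; apply: val_inj => /=; have := ltn_ord i; by rewrite {2}n1; case: (val i).
rewrite !en; set i := cast_ord _ _; rewrite !mxE.
have h := @two_point R p (x 0 i) (y 0 i) p1 (ltW p2).
have P0 : 0 <= 2^-1 * `|x 0 i| `^ p + 2^-1 * `|y 0 i| `^ p by rewrite addr_ge0// mulr_ge0// powR_ge0.
have PE : 2^-1 * `|x 0 i| `^ p + 2^-1 * `|y 0 i| `^ p =
    ((2^-1 * `|x 0 i| `^ p + 2^-1 * `|y 0 i| `^ p) `^ (p - 1)^-1) `^ (p - 1).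
  by rewrite -powRrM mulVf ?gt_eqF// powRr1.
rewrite [leRHS]PE; apply: ge0_ler_powR h; rewrite ?nnegrE ?powR_ge0//.
exact: ltW.
Qed.

(** The two formulas agree at [p = 2], so the branch taken there is immaterial. *)
Definition clarkson_exp := if 2 <= p then p else p / (p - 1).

Lemma clarkson_exp_gt1 : 1 < clarkson_exp.
Proof.
rewrite /clarkson_exp; case: ifPn => // _.
by rewrite ltr_pdivlMr ?subr_gt0// mul1r gtrDl oppr_lt0.
Qed.

Hypothesis np : 2 <= p \/ n = 1%N.

Lemma clarkson F G : Lp_field p F -> Lp_field p G ->
  pnorm p (fun x => 2^-1 *: (F x + G x)) `^ clarkson_exp + pnorm p (fun x => 2^-1 *: (F x - G x)) `^ clarkson_exp <=
  2^-1 * pnorm p F `^ clarkson_exp + 2^-1 * pnorm p G `^ clarkson_exp.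
Proof.
move=> LF LG; have LA := Lp_fieldZ 2^-1 (Lp_fieldD (ltW p1) LF LG).
have LD := Lp_fieldZ 2^-1 (Lp_fieldB (ltW p1) LF LG).
rewrite /clarkson_exp; case: ifPn => p2.
  have simp (s t r : R) : 1 * s + 1 * t <= 1 * r -> s + t <= r by rewrite !mul1r.
  have unit (s t r : R) : s + t <= r -> 1 * s + 1 * t <= 1 * r by rewrite !mul1r.
  apply: simp; exact: (le_energy_lincomb ler01 ler01 ler01 LF LG LA LD
    (fun x => unit _ _ _ (clarkson_point_ge2 (F x) (G x) p2))).
have n1 : n = 1%N by case: np => // h; rewrite h in p2.
rewrite -ltNge in p2.
set a := pnorm p (fun x => 2^-1 *: (F x + G x)); set d := pnorm p (fun x => 2^-1 *: (F x - G x)).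
have a0 : 0 <= a by exact: pnorm_ge0.
have d0 : 0 <= d by exact: pnorm_ge0.
have p10 : 0 < p - 1 by rewrite subr_gt0.
have p20 : 0 < 2 - p by rewrite subr_gt0.
set q := p / (p - 1); set m := (p - 1)^-1.
have q0 : 0 < q by rewrite divr_gt0.
have pmq : p * m = q by [].
set X := a `^ q + d `^ q.
set M := 2^-1 * pnorm p F `^ p + 2^-1 * pnorm p G `^ p.
have M0 : 0 <= M by rewrite addr_ge0// mulr_ge0// powR_ge0.
have X0 : 0 <= X by rewrite addr_ge0 ?powR_ge0.
(* The weights are the norms [a] and [d] of the half-sum and the half-difference themselves: the
   left side becomes [X], and solving the resulting inequality for [X] gives the bound. *)
have key : X <= X `^ (2 - p) * M.
  have qp : q - p != 0.
    have -> : q - p = q * (2 - p) by rewrite /q; field; rewrite gt_eqF.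
    by rewrite gt_eqF// mulr_gt0.
  have E z : z `^ (q - p) * z `^ p = z `^ q.
    rewrite -powRD ?subrK//; apply/implyP => /eqP q00; by rewrite q00 ltxx in q0.
  have le_eq (s t s' t' r : R) : s = s' -> t = t' -> s + t <= r -> s' + t' <= r by move=> -> ->.
  exact: le_eq (E a) (E d) (le_energy_lincomb (powR_ge0 _ _) (powR_ge0 _ _) (powR_ge0 _ _) LF LG LA LD
    (fun x => clarkson_point_lt2 a d (F x) (G x) p2 n1)).
have XM : X <= M `^ m.
  have [->|Xn0] := eqVneq X 0; first exact: powR_ge0.
  have {Xn0}Xp : 0 < X by rewrite lt0r Xn0.
  have h : X `^ (p - 1) <= M.
    have -> : p - 1 = 1 - (2 - p) by ring.
    rewrite powRB; last by rewrite (gt_eqF Xp) implybT.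
    by rewrite powRr1// ler_pdivrMr ?powR_gt0// mulrC.
  have mi : (p - 1) * m = 1 by rewrite mulfV// gt_eqF.
  rewrite -[leLHS](powRr1 X0) -mi powRrM; apply: ge0_ler_powR => //; rewrite ?nnegrE ?powR_ge0//.
  by rewrite ltW// invr_gt0.
apply: (le_trans XM); have m1 : 1 <= m by rewrite /m invf_ge1//; lra.
apply: le_trans (powR_midpoint _ _ m1) _; rewrite ?powR_ge0//.
by rewrite -!powRrM.
Qed.

End clarkson.

(** * Completeness *)

Lemma sum_half_le {R : realType} k : \sum_(0 <= j < k) (2^-1 ^+ j) <= 2 :> R.
Proof.
suff -> : \sum_(0 <= j < k) (2^-1 ^+ j) = 2 - 2 * 2^-1 ^+ k :> R.
  by rewrite gerBl mulr_ge0// exprn_ge0.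
elim: k => [|k IH]; first by rewrite big_nil expr0 mulr1 subrr.
by rewrite big_nat_recr//= IH exprS; field.
Qed.

Lemma cvg_summable_increments {R : realType} (a : R^nat) (C : R) :
  (forall j, `|a j.+1 - a j| <= C * 2^-1 ^+ j) -> cvgn a.
Proof.
move=> h; have C0 : 0 <= C.
  by have := h 0%N; rewrite expr0 mulr1; apply: le_trans.
have hlt1 : `|2^-1| < 1 :> R by rewrite gtr0_norm// invf_lt1// ltr1n.
pose d j := a j.+1 - a j.
have cd : cvgn (series d).
  apply: normed_cvg; apply: (@series_le_cvg _ _ (geometric C 2^-1)) => //.
  - by move=> j; exact: normr_ge0.
  - by move=> j; rewrite /geometric /= mulr_ge0// exprn_ge0.
  - exact: is_cvg_geometric_series.
have -> : a = fun k => a 0%N + series d k.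
  apply/funext => k; rewrite /series /= (@telescope_sumr _ 0 k a)//.
  by rewrite addrC subrK.
by apply: is_cvgD => //; exact: is_cvg_cst.
Qed.

Lemma enorm_continuous {R : realType} {n : nat} : continuous (@enorm R n).
Proof.
move=> x; apply: (@continuous_comp _ _ _ (fun x : 'rV[R]_n => \sum_(i < n) x 0 i ^+ 2) Num.sqrt);
  last exact: sqrt_continuous.
move: x; apply: continuous_big => [|i _ y]; first exact: add_continuous.
apply: (@continuous_comp _ _ _ (fun x : 'rV[R]_n => x 0 i) (fun t => t ^+ 2)); first exact: coord_continuous.
exact: exprn_continuous.
Qed.

Section completeness.
Context {R : realType} {n : nat} (p : R).
Hypothesis p1 : 1 <= p.
Local Notation mu := (@lebesgue_rV R n).
Implicit Types F G : 'rV[R]_n -> 'rV[R]_n.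

Let p0 : 0 < p. Proof. exact: lt_le_trans p1. Qed.

(** Increments of norm at most 4^-j remain summable in energy after multiplication by 2^j. The sum
    [h] of these energy densities is integrable, hence finite almost everywhere, and where it is
    finite the increments are at most 2^-j h(x)^(1/p). *)
Lemma ae_cvg_fast (f : nat -> 'rV[R]_n -> 'rV[R]_n) :
  (forall j, Lp_field p (f j)) ->
  (forall j, pnorm p (fun x => f j.+1 x - f j x) <= 4^-1 ^+ j) ->
  {ae mu, forall x, forall i, cvgn (fun j => f j x 0 i)}.
Proof.
move=> Lf hf; pose d j x := f j.+1 x - f j x.
have Ld j : Lp_field p (d j) by exact: Lp_fieldB.
pose t j x : \bar R := (enorm (2 ^+ j *: d j x) `^ p)%:E.
have mt j : measurable_fun setT (t j).
  by apply: measurable_energy; case: (Lp_fieldZ (2 ^+ j) (Ld j)).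
have t0 j x : (0 <= t j x)%E by rewrite lee_fin powR_ge0.
have it j : (\int[mu]_x t j x <= (2^-1 ^+ j)%:E)%E.
  have L2 := Lp_fieldZ (2 ^+ j) (Ld j).
  rewrite -[leLHS]/(energy p (fun x => 2 ^+ j *: d j x)) (energyE p1 L2) lee_fin.
  have b1 : pnorm p (fun x => 2 ^+ j *: d j x) <= 2^-1 ^+ j.
    rewrite (pnormZ p1 _ (Ld j)) ger0_norm ?exprn_ge0//.
    apply: le_trans (ler_wpM2l _ (hf j)) _; first by rewrite exprn_ge0.
    rewrite -exprMn (_ : 2 * 4^-1 = 2^-1)//; by field.
  have b2 : 0 <= pnorm p (fun x => 2 ^+ j *: d j x) by exact: pnorm_ge0.
  apply: (@le_trans _ _ ((2^-1 ^+ j) `^ p)).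
    by apply: ge0_ler_powR b1; rewrite ?nnegrE ?exprn_ge0// ltW.
  by apply: ge1r_powR => //; rewrite exprn_gt0//= exprn_ile1// invf_le1// ler1n.
pose h x := (\sum_(0 <= j <oo) t j x)%E.
have mh : measurable_fun setT h.
  by apply: ge0_emeasurable_sum => // j x _ _; exact: t0.
have ih : mu.-integrable setT h.
  apply/integrableP; split => //.
  apply: (@le_lt_trans _ _ (\int[mu]_x h x)%E).
    by apply: ge0_le_integral => //; [exact: measurableT_comp|move=> x _; rewrite gee0_abs//; exact: nneseries_ge0].
  rewrite integral_nneseries//; apply: (@le_lt_trans _ _ 2%:E); last exact: ltry.
  apply: lime_le; first by apply: is_cvg_nneseries => j _ _; exact: integral_ge0.
  apply: nearW => k; apply: (@le_trans _ _ (\sum_(0 <= j < k) (2^-1 ^+ j)%:E)%E).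
    by apply: lee_sum => j _; exact: it.
  by rewrite sumEFin lee_fin sum_half_le.
apply: filterS (integrable_ae measurableT ih) => x /(_ I) hx i.
apply: (@cvg_summable_increments _ _ (fine (h x) `^ p^-1)) => j.
have tj : (t j x <= h x)%E.
  apply: le_trans (nneseries_lim_ge j.+1 _); last by move=> k _ _; exact: t0.
  by rewrite big_nat_recr//= leeDr// sume_ge0.
rewrite -[h x]fineK// lee_fin in tj.
have h0 : 0 <= fine (h x) by rewrite fine_ge0// nneseries_ge0.
have e1 : enorm (2 ^+ j *: d j x) <= fine (h x) `^ p^-1.
  rewrite -[leLHS](powRr1 (enorm_ge0 _)) -[X in _ `^ X](mulfV (lt0r_neq0 p0)) powRrM.
  by apply: ge0_ler_powR tj; rewrite ?nnegrE ?powR_ge0// invr_ge0 ltW.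
rewrite exprVn ler_pdivlMr ?exprn_gt0// mulrC.
apply: le_trans e1; rewrite enormZ (ger0_norm (exprn_ge0 j (ler0n R 2))).
apply: ler_wpM2l; first exact: exprn_ge0.
have -> : f j.+1 x 0 i - f j x 0 i = d j x 0 i by rewrite !mxE.
exact: normr_coord_enorm.
Qed.

(** The Riesz-Fischer argument: a fast subsequence converges almost everywhere, and Fatou's lemma
    turns the Cauchy condition into convergence in norm to the pointwise limit. *)
Lemma Lp_complete (F : nat -> 'rV[R]_n -> 'rV[R]_n) :
  (forall j, Lp_field p (F j)) ->
  (forall e : R, 0 < e -> exists N, forall j k, (N <= j)%N -> (N <= k)%N -> pnorm p (fun x => F j x - F k x) <= e) ->
  exists2 G, Lp_field p G &
    forall e : R, 0 < e -> exists N, forall k, (N <= k)%N -> pnorm p (fun x => F k x - G x) <= e.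
Proof.
move=> LF cF.
have /choice[N hN] : forall j, exists N, forall a b, (N <= a)%N -> (N <= b)%N ->
    pnorm p (fun x => F a x - F b x) <= 4^-1 ^+ j.
  by move=> j; apply: cF; rewrite exprn_gt0// invr_gt0.
(* A running sum of [N i + 1] is monotone and dominates both [N j] and [j]. *)
pose psi j := (\sum_(i < j.+1) (N i).+1)%N.
have psiN j : (N j <= psi j)%N by rewrite /psi big_ord_recr/= (leq_trans (leqnSn _))// leq_addl.
have psiS j : (psi j <= psi j.+1)%N by rewrite {2}/psi big_ord_recr/= leq_addr.
have psi_mono : {homo psi : a b / (a <= b)%N}.
  by apply: homo_leq => //; exact: leq_trans.
have psi_ge j : (j <= psi j)%N.
  elim: j => // j IH; rewrite /psi big_ord_recr/= addnS ltnS.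
  by rewrite (leq_trans IH)// leq_addr.
pose f j := F (psi j).
have Lf j : Lp_field p (f j) by exact: LF.
have hf j : pnorm p (fun x => f j.+1 x - f j x) <= 4^-1 ^+ j.
  by apply: hN; [exact: leq_trans (psiN j) (psiS j)|exact: psiN].
have ae := ae_cvg_fast Lf hf.
(* The upper limit is measurable on the whole space and equals the limit where that exists;
   elsewhere the value is arbitrary. *)
pose G x : 'rV[R]_n := \row_i fine (limn_esup (fun j => (f j x 0 i)%:E)).
have mG : measurable_fun setT G.
  apply: measurable_fun_rVP => i.
  rewrite (_ : (fun x => _) = fine \o (fun x => limn_esup (fun j => (f j x 0 i)%:E))); last first.
    by apply/funext => x; rewrite /= mxE.
  apply: measurableT_comp; first exact: (fine_measurable measurableT).
  apply: (@measurable_fun_limn_esup _ _ _ _ (fun j x => (f j x 0 i)%:E)) => j.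
  apply/measurable_EFinP; have [mf _] := Lf j.
  by apply: (measurableT_comp (measurable_coord_rV i)).
have aeG : {ae mu, forall x, forall i, (fun j => f j x 0 i) @ \oo --> G x 0 i}.
  apply: filterS ae => x h i; rewrite mxE.
  have /cvg_ex[l hl] := h i.
  have hl' : (fun j => (f j x 0 i)%:E) @ \oo --> l%:E by apply: cvg_EFin => //; exact: nearW.
  by rewrite (cvg_limn_einf_sup hl').2.
have bound k (e : R) (M : nat) : 0 <= e -> (forall j, (M <= j)%N -> pnorm p (fun x => F k x - f j x) <= e) ->
    (energy p (fun x => (F k x - G x)%R) <= (e `^ p)%:E)%E.
  move=> e0 hM.
  pose g j x := (enorm (F k x - f (j + M)%N x) `^ p)%:E.
  have mg j : measurable_fun setT (g j).
    by apply: measurable_energy; case: (Lp_fieldB p1 (LF k) (Lf (j + M)%N)).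
  have g0 j x : (0 <= g j x)%E by rewrite lee_fin powR_ge0.
  have [mFk _] := LF k.
  have mB : measurable_fun setT (fun x => F k x - G x).
    by apply: measurable_rVD => //; exact: measurable_rVN.
  have mliminf : measurable_fun setT (fun x => limn_einf (g^~ x)).
    rewrite (_ : (fun x => _) = (fun x => - limn_esup (fun j => - g j x))%E).
      apply: measurableT_comp => //; apply: (@measurable_fun_limn_esup _ _ _ _ (fun j x => (- g j x)%E)) => j.
      exact: measurableT_comp.
    by apply/funext => x; rewrite /limn_einf.
  have li0 x : (0 <= limn_einf (g^~ x))%E.
    rewrite limn_einf_lim; apply: lime_ge; first exact: is_cvg_einfs.
    by apply: nearW => j; apply: le_ereal_inf_tmp => _ [k' _ <-].
  apply: (@le_trans _ _ (\int[mu]_x limn_einf (g^~ x))%E).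
    apply: ae_ge0_le_integral => //.
    - by move=> x _; rewrite lee_fin powR_ge0.
    - exact: measurable_energy.
    apply: filterS aeG => x hx _.
    (* Continuity of the power is taken from its derivative, hence at positive points only; at 0 it
       is enough that the lower limit is nonnegative. *)
    have [e0'|en0] := eqVneq (enorm (F k x - G x)) 0.
      by rewrite e0' powR0 ?gt_eqF//; exact: li0.
    have ep : 0 < enorm (F k x - G x) by rewrite lt0r en0 enorm_ge0.
    have cFG : (fun j => F k x - f (j + M)%N x) @ \oo --> F k x - G x.
      apply: rV_near_ball => i.
      have -> : (fun j => (F k x - f (j + M)%N x) 0 i) = fun j => F k x 0 i - f (j + M)%N x 0 i.
        by apply/funext => j; rewrite !mxE.
      have -> : (F k x - G x) 0 i = F k x 0 i - G x 0 i by rewrite !mxE.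
      apply: cvgB; first exact: cvg_cst.
      by have := hx i; rewrite -(cvg_shiftn M (fun j => f j x 0 i)).
    have cg : (g^~ x) @ \oo --> (enorm (F k x - G x) `^ p)%:E.
      apply: cvg_EFin; first exact: nearW.
      apply: (@cvg_comp _ _ _ (fun j => enorm (F k x - f (j + M)%N x)) (fun s => s `^ p) _
        (nbhs (enorm (F k x - G x)))).
        exact: (cvg_comp _ _ cFG (@enorm_continuous R n _)).
      have cp : {for enorm (F k x - G x), continuous (fun s => s `^ p)}.
        apply/differentiable_continuous/derivable1_diffP.
        by have [] := @is_derive1_powR R p _ ep.
      exact: cp.
    by rewrite (cvg_limn_einf_sup cg).1.
  apply: le_trans (fatou _ measurableT mg _) _; first by move=> j x _; exact: g0.
  rewrite limn_einf_lim; apply: lime_le; first exact: is_cvg_einfs.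
  apply: nearW => j; apply: ge_ereal_inf; exists (\int[mu]_x g j x)%E; first by exists j => /=.
  have LB := Lp_fieldB p1 (LF k) (Lf (j + M)%N).
  rewrite -[leLHS]/(energy p (fun x => F k x - f (j + M)%N x)) (energyE p1 LB) lee_fin.
  apply: ge0_ler_powR; rewrite ?nnegrE ?pnorm_ge0 ?(ltW p0)//.
  by apply: hM; rewrite leq_addl.
have LG : Lp_field p G.
  have [N1 h1] := cF 1 ltr01.
  have LB : Lp_field p (fun x => F N1 x - G x).
    have [mF _] := LF N1; split; first by apply: measurable_rVD => //; exact: measurable_rVN.
    apply: le_lt_trans (bound N1 1 N1 ler01 _) (ltry _) => j jN.
    by apply: h1 => //; exact: leq_trans jN (psi_ge j).
  have := Lp_fieldB p1 (LF N1) LB.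
  by congr Lp_field; apply/funext => x; rewrite opprB addrC subrK.
exists G => // e e0; have [N1 h1] := cF e e0; exists N1 => k kN.
have LB := Lp_fieldB p1 (LF k) LG.
have := bound k e N1 (ltW e0); rewrite (energyE p1 LB) lee_fin => hb.
have {}hb : pnorm p (fun x => F k x - G x) `^ p <= e `^ p.
  by apply: hb => j jN; apply: h1 => //; exact: leq_trans jN (psi_ge j).
rewrite leNgt; apply/negP => h; move: hb; apply/negP; rewrite -ltNge.
by apply: gt0_ltr_powR => //; rewrite nnegrE ?pnorm_ge0// ltW.
Qed.

End completeness.

Lemma real_cauchy {R : realType} (a : R^nat) :
  (forall e : R, 0 < e -> exists N, forall j k, (N <= j)%N -> (N <= k)%N -> `|a j - a k| <= e) ->
  cvgn a.
Proof.
move=> h; apply/cauchy_cvgP/cauchy_ballP => e e0.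
have [N hN] := h (e / 2) (divr_gt0 e0 (ltr0n _ 2)).
pose A := [set x | exists2 j, (N <= j)%N & x = a j].
exists (A, A); first by split; exists N => // j jN; exists j.
move=> [_ _] [/= [j jN ->] [k kN ->]]; rewrite -ball_normE /=; apply: le_lt_trans (hN _ _ jN kN) _.
by rewrite ltr_pdivrMr// mulrDr mulr1 ltrDl.
Qed.

Lemma cvg_dist_le {R : realType} (a : R^nat) (c l B : R) (N : nat) :
  a @ \oo --> l -> (forall j, (N <= j)%N -> `|c - a j| <= B) -> `|c - l| <= B.
Proof.
move=> al h; apply/ler_addgt0Pr => e e0.
have [M _ hM] := (cvgrPdist_le _ _).1 al e e0.
have jM : (M <= maxn M N)%N by exact: leq_maxl.
have jN : (N <= maxn M N)%N by exact: leq_maxr.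
apply: le_trans (lerD (h _ jN) (hM _ jM)).
by rewrite [X in _ <= _ + X]distrC; exact: ler_distD.
Qed.

Lemma holder_continuous {R : realType} {n : nat} (w : 'rV[R]_n -> R) (K al : R) : 0 <= K -> 0 < al ->
  (forall x y, `|w x - w y| <= K * enorm (x - y) `^ al) -> continuous w.
Proof.
move=> K0 al0 h x A /nbhs_ballP[e0 /= e00 eA].
pose e := e0 / 2; have e0' : 0 < e by rewrite divr_gt0.
pose d := (e / (K + 1)) `^ al^-1.
have eK : 0 < e / (K + 1) by rewrite divr_gt0// ltr_wpDl.
have d0 : 0 < d by exact: powR_gt0.
have dn : 0 < d / (n%:R + 1) by rewrite divr_gt0// ltr_wpDl.
apply/nbhs_ballP; exists (d / (n%:R + 1)) => //= y /rV_ballP[_ xy].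
apply: eA; rewrite -ball_normE /=; apply: le_lt_trans (h x y) _.
apply: (@le_lt_trans _ _ e); last by rewrite /e; lra.
have xyd : enorm (x - y) <= d.
  apply: (@le_trans _ _ (n%:R * (d / (n%:R + 1)))).
    by apply: cube_enorm => i; rewrite /= in_itv/= -ler_norml !mxE ltW.
  by rewrite mulrCA ger_pMr// ler_pdivrMr ?ltr_wpDl// mul1r lerDl.
apply: (@le_trans _ _ (K * (d `^ al))).
  apply: ler_wpM2l => //; apply: ge0_ler_powR; rewrite ?nnegrE ?enorm_ge0 ?(ltW al0) ?(ltW d0)//.
rewrite /d -powRrM mulVf ?gt_eqF// powRr1 ?(ltW eK)// mulrCA ger_pMr//.
by rewrite ler_pdivrMr ?ltr_wpDl// mul1r lerDl.
Qed.

(** * Limits of functions whose gradients converge *)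

Section closedness.
Context {R : realType} {n : nat} (p : R).
Hypothesis n0 : (0 < n)%N.
Hypothesis np : n%:R < p.
Local Notation mu := (@lebesgue_rV R n).
Let al := 1 - n%:R / p.
Let p1 : 1 < p. Proof. by apply: le_lt_trans np; rewrite ler1n. Qed.
Let p0 : 0 < p. Proof. exact: lt_trans p1. Qed.
Let al0 : 0 < al. Proof. by rewrite subr_gt0 ltr_pdivrMr// mul1r. Qed.

Lemma WgradB u v F G : Wgrad p u F -> Wgrad p v G ->
  Wgrad p (fun x : 'rV[R]_n => u x - v x) (fun x => F x - G x).
Proof.
move=> WF WG; have := WgradD (ltW p1) 1 (-1) WF WG; congr Wgrad; apply/funext => x.
  by rewrite mul1r mulN1r.
by rewrite scale1r scaleN1r.
Qed.

(** With the value at 0 fixed, Morrey's inequality bounds [w j x - w k x] by a multiple of |x|^al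
    times the distance of the gradients. Convergence is thus uniform on bounded sets, which suffices
    against test functions, and the Hoelder bound survives to make the limit continuous. *)
Lemma Wgrad_closed (w : nat -> 'rV[R]_n -> R) (H : nat -> 'rV[R]_n -> 'rV[R]_n) :
  (forall k, Wgrad p (w k) (H k)) -> (forall k, w k 0 = 0) ->
  (forall e : R, 0 < e -> exists N, forall j k, (N <= j)%N -> (N <= k)%N -> pnorm p (fun x => H j x - H k x) <= e) ->
  exists u G, [/\ Wgrad p u G, forall x, w^~ x @ \oo --> u x &
    forall e : R, 0 < e -> exists N, forall k, (N <= k)%N -> pnorm p (fun x => H k x - G x) <= e].
Proof.
move=> WH w0 cH.
have LH k : Lp_field p (H k) by case: (WH k).
have [G LG HG] := Lp_complete (ltW p1) LH cH.
have [C C0 hC] := @morrey R n p n0 np.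
have dist j k x : `|w j x - w k x| <= C * enorm x `^ al * pnorm p (fun x => H j x - H k x).
  have := hC _ _ (WgradB (WH j) (WH k)) x 0.
  by rewrite !w0 !subr0.
have D1 (x : 'rV[R]_n) : 0 < C * enorm x `^ al + 1 by rewrite ltr_wpDl// mulr_ge0// powR_ge0.
have cw x : cvgn (w^~ x).
  apply: real_cauchy => e e0.
  have [N hN] := cH _ (divr_gt0 e0 (D1 x)); exists N => j k jN kN.
  apply: (le_trans (dist j k x)); apply: (le_trans (ler_wpM2l _ (hN _ _ jN kN))).
    by rewrite mulr_ge0// powR_ge0.
  by rewrite mulrCA ger_pMr// ler_pdivrMr// mul1r lerDl.
pose u x := limn (w^~ x).
have wu x : w^~ x @ \oo --> u x by exact: cw.
have unif (e : R) : 0 < e -> exists N, forall k, (N <= k)%N -> forall x, `|w k x - u x| <= C * enorm x `^ al * e.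
  move=> e0; have [N hN] := cH e e0; exists N => k kN x.
  apply: (cvg_dist_le (N := N) (wu x)) => j jN; apply: (le_trans (dist k j x)).
  by apply: ler_wpM2l; [rewrite mulr_ge0// powR_ge0|exact: hN].
have hu x y : `|u x - u y| <= C * pnorm p G * enorm (x - y) `^ al.
  apply/ler_addgt0Pr => e e0.
  pose K := C * enorm x `^ al + C * enorm (x - y) `^ al + C * enorm y `^ al + 1.
  have cge (z : 'rV[R]_n) : 0 <= C * enorm z `^ al by rewrite mulr_ge0// powR_ge0.
  have K0 : 0 < K by rewrite ltr_wpDl// !addr_ge0.
  have eK : 0 < e / K by exact: divr_gt0.
  have [N1 h1] := unif _ eK; have [N2 h2] := HG _ eK.
  pose k := maxn N1 N2.
  have kN1 : (N1 <= k)%N by exact: leq_maxl.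
  have kN2 : (N2 <= k)%N by exact: leq_maxr.
  have hk : pnorm p (H k) <= pnorm p G + e / K.
    rewrite addrC -lerBlDr; apply: le_trans (h2 k kN2).
    exact: (pnormB_ge (ltW p1) (LH k) LG).
  have a1 := h1 k kN1 x; have a2 := hC _ _ (WH k) x y; have a3 := h1 k kN1 y.
  have a2' := le_trans a2 (ler_wpM2l (cge (x - y)) hk).
  have -> : u x - u y = - (w k x - u x) + (w k x - w k y) + (w k y - u y) by ring.
  apply: (le_trans (ler_normD _ _)); apply: (le_trans (lerD (ler_normD _ _) a3)).
  rewrite normrN; apply: (le_trans (lerD (lerD a1 a2') (lexx _))).
  have -> : C * enorm x `^ al * (e / K) + C * enorm (x - y) `^ al * (pnorm p G + e / K) +
      C * enorm y `^ al * (e / K) =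
    C * pnorm p G * enorm (x - y) `^ al + (K - 1) * (e / K) by rewrite /K; ring.
  rewrite lerD2l mulrBl mul1r mulrCA mulfV ?gt_eqF// mulr1 gerBl ltW//.
have N0 : 0 <= pnorm p G by exact: pnorm_ge0.
have cu : continuous u by exact: holder_continuous (mulr_ge0 C0 N0) al0 hu.
exists u, G; split => //; split => // i; split.
  exact: (Lp_field_locally_integrable (ltW p1) i LG).
move=> phi tphi.
have tD := test_partial i tphi.
have lu := continuous_locally_integrable cu.
have [r hr] := test_bsupp tD.
have [M M0 hM] := test_field_bounded p1 i tphi.
pose I := \int[mu]_x `|'D_('e_i) phi x|.
have I0 : 0 <= I by apply: Rintegral_ge0.
have iD := integrable_test tD.
(* The radius given by [bsupp] may be negative, and monotonicity of the power needs a nonnegative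
   base. *)
pose rho := Num.max r 0.
have key (e : R) : 0 < e -> `|\int[mu]_x (u x * 'D_('e_i) phi x) + \int[mu]_x (G x 0 i * phi x)| <=
   (C * rho `^ al * I + M) * e.
  move=> e0; have [N1 h1] := unif _ e0; have [N2 h2] := HG _ e0.
  pose k := maxn N1 N2.
  have kN1 : (N1 <= k)%N by exact: leq_maxl.
  have kN2 : (N2 <= k)%N by exact: leq_maxr.
  have [_ _ wk] := WH k; have [lHk /(_ _ tphi) wki] := wk i.
  have iu := integrable_mul_test lu tD.
  have iw := integrable_mul_test (Wgrad_locint (WH k)) tD.
  have iH := integrable_mul_test lHk tphi.
  have iG := integrable_mul_test (Lp_field_locally_integrable (ltW p1) i LG) tphi.
  have e1 : `|\int[mu]_x (u x * 'D_('e_i) phi x) - \int[mu]_x (w k x * 'D_('e_i) phi x)| <= C * rho `^ al * I * e.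
    rewrite -RintegralB//.
    have iB : mu.-integrable setT (EFin \o (fun x => u x * 'D_('e_i) phi x - w k x * 'D_('e_i) phi x)).
      exact: (integrableB measurableT iu iw).
    apply: (le_trans (le_normr_Rintegral measurableT iB)).
    have -> : C * rho `^ al * I * e = \int[mu]_x (C * rho `^ al * e * `|'D_('e_i) phi x|).
      rewrite RintegralZl//; last exact: (integrable_norm iD).
      by rewrite -/I; ring.
    apply: le_Rintegral => //.
    - exact: (integrable_norm iB).
    - exact: (integrableZl measurableT (C * rho `^ al * e) (integrable_norm iD)).
    move=> x _; rewrite -mulrBl normrM.
    have [xr|xr] := leP (enorm x) r; last by rewrite (hr _ xr) normr0 !mulr0.
    apply: ler_wpM2r => //; rewrite distrC; apply: (le_trans (h1 k kN1 x)).
    apply: ler_wpM2r; first exact: ltW.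
    apply: ler_wpM2l => //; apply: ge0_ler_powR; rewrite ?nnegrE ?enorm_ge0 ?(ltW al0)//.
      by rewrite le_max lexx orbT.
    by rewrite le_max xr.
  have e2 : `|\int[mu]_x (H k x 0 i * phi x) - \int[mu]_x (G x 0 i * phi x)| <= M * e.
    rewrite -RintegralB//.
    have LB := Lp_fieldB (ltW p1) (LH k) LG.
    have -> : \int[mu]_x (H k x 0 i * phi x - G x 0 i * phi x) = \int[mu]_x ((H k x - G x) 0 i * phi x).
      by congr Rintegral; apply/funext => x; rewrite !mxE mulrBl.
    apply: (le_trans (hM _ LB)); exact: ler_wpM2l (h2 k kN2).
  rewrite mulrDl; apply: le_trans (lerD e1 e2); rewrite wki opprK.
  set U := Rintegral _ _ _; set V := Rintegral _ _ _; set W := Rintegral _ _ (fun x => H k x 0 i * _).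
  by rewrite (_ : U + V = U + W - (W - V)); [exact: ler_normB|ring].
apply/eqP; rewrite -addr_eq0 -normr_le0; apply/ler_addgt0Pr => e e0; rewrite add0r.
have Q0 : 0 < C * rho `^ al * I + M + 1 by rewrite ltr_wpDl// addr_ge0// !mulr_ge0// powR_ge0.
apply: (le_trans (key _ (divr_gt0 e0 Q0))).
by rewrite mulrCA ger_pMr// ler_pdivrMr// mul1r lerDl.
Qed.

End closedness.

(** * Extremals and stability *)

Lemma powR_right_continuous {R : realType} (d s e : R) : 0 < d -> 0 < e ->
  exists2 h : R, 0 < h & (d + h) `^ s <= d `^ s + e.
Proof.
move=> d0 e0.
have cp : {for d, continuous (fun x : R => x `^ s)}.
  by apply/differentiable_continuous/derivable1_diffP; have [] := @is_derive1_powR R s d d0.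
have /nbhs_ballP[r /= r0 hr] : nbhs d ((fun x : R => x `^ s) @^-1` ball (d `^ s) e).
  by apply: cp; exact: nbhsx_ballx.
exists (r / 2); first by rewrite divr_gt0.
have := hr (d + r / 2); rewrite -!ball_normE /= => h.
have /h : `|d - (d + r / 2)| < r.
  by rewrite opprD addNKr normrN gtr0_norm ?divr_gt0// ltr_pdivrMr// mulrDr mulr1 ltrDl.
by rewrite distrC => /ltW/(le_trans (ler_norm _)); rewrite lerBlDl.
Qed.

Lemma ler_powR_inv {R : realType} (x y s : R) : 0 < s -> 0 <= x -> 0 <= y -> x `^ s <= y `^ s -> x <= y.
Proof.
move=> s0 x0 y0; apply: contraTT; rewrite -!ltNge => yx.
by apply: gt0_ltr_powR; rewrite ?nnegrE.
Qed.

(** [x] and [y] are the left terms of Clarkson's inequality, [D] the lower bound due to minimality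
    and [M] a common upper bound for the two norms, all raised to the same power. *)
Lemma midpoint_excess {R : realType} (x y J K M D E : R) :
  x + y <= 2^-1 * J + 2^-1 * K -> D <= x -> J <= M -> K <= M -> M <= D + E -> y <= E.
Proof. by lra. Qed.

Section minimizer.
Context {R : realType} {n : nat} (p : R).
Hypothesis n0 : (0 < n)%N.
Hypothesis np : n%:R < p.
Local Notation mu := (@lebesgue_rV R n).
Let al := 1 - n%:R / p.
Implicit Types (u w : 'rV[R]_n -> R) (G H : 'rV[R]_n -> 'rV[R]_n).
Let p1 : 1 < p. Proof. by apply: le_lt_trans np; rewrite ler1n. Qed.
Let al0 : 0 < al. Proof. by rewrite subr_gt0 ltr_pdivrMr ?mul1r// (lt_trans ltr01). Qed.
Let i0 := Ordinal n0.
Let e : 'rV[R]_n := 'e_i0.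
Let np2 : 2 <= p \/ n = 1%N.
Proof.
case: (ltngtP n 1) => [|n2|->]; [by rewrite ltnS leqn0; case: n n0| |by right].
by left; apply: le_trans (ltW np); rewrite ler_nat.
Qed.

Lemma Wgrad_affine (a b : R) (u : 'rV[R]_n -> R) G : Wgrad p u G ->
  Wgrad p (fun x => a + b * u x) (fun x => b *: G x).
Proof.
move=> WG; have := WgradD (ltW p1) a b (@Wgrad_cst R n p (ltW p1) 1) WG.
congr Wgrad; apply/funext => x; first by rewrite mulr1.
by rewrite scaler0 add0r.
Qed.

Let admissible (u : 'rV[R]_n -> R) G := [/\ Wgrad p u G, u 0 = 0 & u e = 1].

Lemma unit_minimizer : (exists w H, Wgrad p w H /\ w 0 != w e) ->
  exists u G, [/\ admissible u G, 0 < pnorm p G & forall w H, admissible w H -> pnorm p G <= pnorm p H].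
Proof.
move=> [w0 [H0 [W0 w0e]]].
have we : w0 e - w0 0 != 0 by rewrite subr_eq0 eq_sym.
pose b := (w0 e - w0 0)^-1.
have A0 : admissible (fun x => - (b * w0 0) + b * w0 x) (fun x => b *: H0 x).
  split; first exact: Wgrad_affine.
    by rewrite addNr.
  by rewrite addrC -mulrBr mulVf.
pose E := [set t | exists w H, admissible w H /\ t = pnorm p H].
have E0 : E (pnorm p (fun x => b *: H0 x)) by exists (fun x => - (b * w0 0) + b * w0 x), (fun x => b *: H0 x).
have lbE : lbound E 0 by move=> _ [w [H [_ ->]]]; exact: pnorm_ge0.
have hE : has_inf E by split; [exists (pnorm p (fun x => b *: H0 x))|exists 0].
have [C C0 hC] := @morrey R n p n0 np.
have CE w H : admissible w H -> 1 <= C * pnorm p H.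
  move=> [WH w00 w1]; have := hC _ _ WH 0 e.
  by rewrite w00 w1 !sub0r normrN normr1 enormN enorm_delta powR1 mulr1.
have {C0} : 0 < C.
  rewrite lt0r C0 andbT; apply/negP => /eqP C00.
  by have := CE _ _ A0; rewrite C00 mul0r ler10.
move=> C0; pose d := inf E.
(* Morrey's inequality between [0] and [e] keeps the infimum away from 0. *)
have d0 : 0 < d.
  apply: (@lt_le_trans _ _ C^-1); first by rewrite invr_gt0.
  apply: lb_le_inf; first by case: hE.
  by move=> _ [w [H [A ->]]]; rewrite -[leLHS]mul1r ler_pdivrMr// mulrC; exact: CE A.
have dle w H : admissible w H -> d <= pnorm p H.
  by move=> A; apply: ge_inf; [exists 0|exists w, H].
have /choice[f hf] : forall k : nat, exists wH : ('rV[R]_n -> R) * ('rV[R]_n -> 'rV[R]_n),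
    admissible wH.1 wH.2 /\ pnorm p wH.2 < d + k.+1%:R^-1.
  move=> k; have k0 : 0 < k.+1%:R^-1 :> R by rewrite invr_gt0.
  have [_ [w [H [A ->]]] h] := inf_adherent k0 hE.
  by exists (w, H).
have hf1 k : Wgrad p (f k).1 (f k).2 by have [[]] := hf k.
have Lf k : Lp_field p (f k).2 by have [] := hf1 k.
have cauchy_f : forall r : R, 0 < r -> exists N, forall j k, (N <= j)%N -> (N <= k)%N ->
    pnorm p (fun x => (f j).2 x - (f k).2 x) <= r.
  move=> r r0; pose s := clarkson_exp p.
  have s1 : 1 < s by exact: clarkson_exp_gt1.
  have s0 : 0 < s by exact: lt_trans s1.
  have r2 : 0 < (2^-1 * r) `^ s by rewrite powR_gt0// mulr_gt0.
  (* Once both norms are at most [d + h], the half-sum, being admissible, has norm at least [d], and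
     Clarkson's inequality leaves at most (r/2)^s for the half-difference. *)
  have [h h0 hh] := powR_right_continuous s d0 r2.
  exists (Num.truncn h^-1).+1 => j k jN kN.
  have small i : ((Num.truncn h^-1).+1 <= i)%N -> pnorm p (f i).2 <= d + h.
    move=> iN; have [_ /ltW hi] := hf i; apply: (le_trans hi); rewrite lerD2l.
    rewrite invf_ple ?posrE//; apply: (@le_trans _ _ (Num.truncn h^-1).+1%:R).
      by rewrite ltW// truncnS_gt.
    by rewrite ler_nat (leq_trans iN).
  have := clarkson p1 np2 (Lf j) (Lf k); rewrite -/s.
  set X := pnorm p (fun x => 2^-1 *: (_ + _)); set Y := pnorm p (fun x => 2^-1 *: (_ - _)) => hXY.
  have dX : d <= X.
    have Wm := WgradD (ltW p1) 2^-1 2^-1 (hf1 j) (hf1 k).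
    have -> : X = pnorm p (fun x => 2^-1 *: (f j).2 x + 2^-1 *: (f k).2 x).
      by congr pnorm; apply/funext => x; rewrite scalerDr.
    apply: (dle (fun x => 2^-1 * (f j).1 x + 2^-1 * (f k).1 x)); split => //.
      by have [[_ -> _] _] := hf j; have [[_ -> _] _] := hf k; rewrite mulr0 addr0.
    by have [[_ _ ->] _] := hf j; have [[_ _ ->] _] := hf k; field.
  have X0 : 0 <= X by exact: pnorm_ge0.
  have Y0 : 0 <= Y by exact: pnorm_ge0.
  have mono z : 0 <= z -> z <= d + h -> z `^ s <= (d + h) `^ s.
    by move=> z0 zh; apply: ge0_ler_powR; rewrite ?nnegrE// ?ltW// addr_gt0.
  have mj := mono _ (pnorm_ge0 _ _) (small j jN).
  have mk := mono _ (pnorm_ge0 _ _) (small k kN).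
  have md : d `^ s <= X `^ s by apply: ge0_ler_powR dX; rewrite ?nnegrE// ltW.
  have YE : Y = 2^-1 * pnorm p (fun x => (f j).2 x - (f k).2 x).
    rewrite /Y (pnormZ (ltW p1) _ (Lp_fieldB (ltW p1) (Lf j) (Lf k))) ger0_norm//.
  have := midpoint_excess hXY md mj mk hh.
  move=> /(ler_powR_inv s0 Y0); rewrite YE => h1.
  by rewrite -(@ler_pM2l _ 2^-1) ?invr_gt0// h1// mulr_ge0// ltW.
have f0 k : (f k).1 0 = 0 by have [[]] := hf k.
have [u [G [WG cu cG]]] := @Wgrad_closed R n p n0 np _ _ hf1 f0 cauchy_f.
have LG : Lp_field p G by case: WG.
have u0 : u 0 = 0.
  have := cu 0; rewrite (_ : (fun k => (f k).1 0) = fun=> 0); last exact/funext.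
  by move=> /(cvg_unique (@Rhausdorff R)) /(_ (cvg_cst _)).
have ue : u e = 1.
  have := cu e; rewrite (_ : (fun k => (f k).1 e) = fun=> 1); last by apply/funext => k; have [[]] := hf k.
  by move=> /(cvg_unique (@Rhausdorff R)) /(_ (cvg_cst _)).
have Gd : pnorm p G <= d.
  apply/ler_addgt0Pr => r r0; have r2 : 0 < r / 2 by rewrite divr_gt0.
  have [N hN] := cG _ r2.
  pose k := maxn N (Num.truncn (r / 2)^-1).+1.
  have hk := hN k (leq_maxl _ _); have [_ /ltW hk2] := hf k.
  have k2 : k.+1%:R^-1 <= r / 2.
    rewrite invf_ple ?posrE//; apply: (@le_trans _ _ (Num.truncn (r / 2)^-1).+1%:R).
      by rewrite ltW// truncnS_gt.
    by rewrite ler_nat; apply: leqW; exact: leq_maxr.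
  have := pnormB_ge (ltW p1) LG (Lf k).
  rewrite (pnormB_sym (ltW p1) LG (Lf k)); move: hk hk2 k2; move: (k.+1%:R^-1) => c; lra.
exists u, G; split => //; last by move=> w H A; exact: le_trans Gd (dle w H A).
by apply: lt_le_trans d0 (dle u G _).
Qed.

(** The best constant is the reciprocal of the minimal norm. A function with distinct values at some
    pair becomes admissible after a similarity and an affine change of values, which gives the
    inequality; the minimizer excludes smaller constants, and its images under the inverse
    operations attain equality at any pair with any prescribed values. *)
Lemma morrey_constP : (exists w H, Wgrad p w H /\ w 0 != w e) ->
  exists C : R, [/\ 0 < C,
    (forall w H, Wgrad p w H -> forall x y, `|w x - w y| <= C * enorm (x - y) `^ al * pnorm p H),
    (forall C' : R, (forall w H, Wgrad p w H -> forall x y, `|w x - w y| <= C' * enorm (x - y) `^ al * pnorm p H) ->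
      C <= C') &
    forall x y (a b : R), x != y -> exists u G,
      [/\ Wgrad p u G, u x = a, u y = b & `|a - b| = C * enorm (x - y) `^ al * pnorm p G]].
Proof.
move=> hw; have [u [G [[WG u0 ue] G0 Gmin]]] := unit_minimizer hw.
have LG : Lp_field p G by case: WG.
exists (pnorm p G)^-1; split; first by rewrite invr_gt0.
- move=> w H WH x y; have [->|wxy] := eqVneq (w x) (w y).
    by rewrite subrr normr0 !mulr_ge0 ?invr_ge0 ?powR_ge0 ?pnorm_ge0.
  have xy : x != y by apply: contra_neq wxy => ->.
  have [w' [H' [WH' w'0 w'e NH']]] := Wgrad_unit_pair n0 np i0 WH xy.
  have ne : w y - w x != 0 by rewrite subr_eq0 eq_sym.
  pose b := (w y - w x)^-1.
  have A : admissible (fun z => - (b * w x) + b * w' z) (fun z => b *: H' z).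
    split; first exact: Wgrad_affine.
      by rewrite w'0 addNr.
    by rewrite w'e addrC -mulrBr mulVf.
  have := Gmin _ _ A; have LH' : Lp_field p H' by case: WH'.
  rewrite (pnormZ (ltW p1) _ LH') NH' /b normfV distrC mulrC ler_pdivlMr ?normr_gt0 ?subr_eq0//.
  by rewrite -mulrA ler_pdivlMl.
- move=> C' hC'; have := hC' _ _ WG 0 e.
  rewrite u0 ue !sub0r normrN normr1 enormN enorm_delta powR1 mulr1.
  by move=> h; rewrite -[leLHS]mul1r ler_pdivrMr.
move=> x y a b xy; have [Q [QQ Q0 Qe]] := simil_pair i0 xy.
set r := enorm (x - y) in Q0 Qe *.
have r0 : 0 < r by rewrite enorm_gt0 subr_eq0.
have ri0 : 0 < r^-1 by rewrite invr_gt0.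
have QQ' : Q^T *m Q^T^T = 1%:M by rewrite trmxK; exact: mulmx1C.
(* The inverse of the similarity that carries [0] and [e] to [x] and [y]. *)
pose T := simil (- (r^-1 *: (x *m Q^T))) r^-1 Q^T.
have TK : cancel (simil x r Q) T by exact: similK.
have Tx : T x = 0 by rewrite -{1}Q0 TK.
have Ty : T y = e by rewrite -Qe TK.
have W1 := Wgrad_simil (ltW p1) (- (r^-1 *: (x *m Q^T))) ri0 QQ' WG.
have N1 := pnorm_simil (ltW p1) (- (r^-1 *: (x *m Q^T))) ri0 QQ' LG.
have W2 := Wgrad_affine a (b - a) W1.
eexists; eexists; split; first exact: W2.
- by rewrite /= -/T Tx u0 mulr0 addr0.
- by rewrite /= -/T Ty ue mulr1 addrC subrK.
have L1 : Lp_field p (fun z => r^-1 *: (G (T z) *m Q^T^T)) by case: W1.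
rewrite (pnormZ (ltW p1) _ L1) N1 distrC -/al.
have ra : r `^ al * r^-1 `^ al = 1 by rewrite -powRM ?(ltW r0) ?(ltW ri0)// mulfV ?gt_eqF// powR1.
rewrite -[LHS]mul1r -{1}ra; field; by rewrite gt_eqF.
Qed.

End minimizer.

Lemma midpoint_gap {R : realType} (a b c d : R) : a <= b -> b + d <= 2^-1 * a + 2^-1 * c -> a + 2 * d <= c.
Proof. by lra. Qed.

(** One copy of [d] absorbs the loss [eps] of a pair that is only nearly maximizing; the other
    survives in the estimate. *)
Lemma absorb_slack {R : realType} (t t' eps d c : R) : t <= t' + eps -> eps <= d -> t' + 2 * d <= c -> d + t <= c.
Proof. by lra. Qed.

Section stability.
Context {R : realType} {n : nat} (p : R).
Hypothesis n0 : (0 < n)%N.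
Hypothesis np : n%:R < p.
Implicit Types (u v w : 'rV[R]_n -> R) (G H : 'rV[R]_n -> 'rV[R]_n) (x y : 'rV[R]_n).
Let al := 1 - n%:R / p.
Let p1 : 1 < p. Proof. by apply: le_lt_trans np; rewrite ler1n. Qed.
Let al0 : 0 < al. Proof. by rewrite subr_gt0 ltr_pdivrMr ?mul1r// (lt_trans ltr01). Qed.
Let np2 : 2 <= p \/ n = 1%N.
Proof.
case: (ltngtP n 1) => [|n2|->]; [by rewrite ltnS leqn0; case: n n0| |by right].
by left; apply: le_trans (ltW np); rewrite ler_nat.
Qed.

Lemma enorm_powR_gt0 x y : x != y -> 0 < enorm (x - y) `^ al.
Proof. by move=> xy; rewrite powR_gt0// enorm_gt0 subr_eq0. Qed.

Lemma morrey_seminorm_le w (T : R) : (forall x y, `|w x - w y| <= T * enorm (x - y) `^ al) ->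
  (morrey_seminorm p w <= T%:E)%E.
Proof.
move=> h; apply: ge_ereal_sup => _ [x [y [xy ->]]].
by rewrite lee_fin ler_pdivrMr ?enorm_powR_gt0.
Qed.

Lemma morrey_seminorm_ge w x y : x != y ->
  ((`|w x - w y| / enorm (x - y) `^ al)%:E <= morrey_seminorm p w)%E.
Proof. by move=> xy; apply: ereal_sup_ubound; exists x, y. Qed.

(** The constants valid at all pairs of points, for explicit gradients, are those valid for the
    seminorm, once the trivial pairs with [x = y] are set apart. *)
Lemma morrey_constE (C : R) : 0 < C ->
  (forall w H, Wgrad p w H -> forall x y, `|w x - w y| <= C * enorm (x - y) `^ al * pnorm p H) ->
  (forall C' : R, (forall w H, Wgrad p w H -> forall x y, `|w x - w y| <= C' * enorm (x - y) `^ al * pnorm p H) ->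
    C <= C') ->
  morrey_const n p = C.
Proof.
move=> C0 hC minC; rewrite /morrey_const; set S := [set _ | _].
have SC : S C.
  move=> u /(D1p_Wgrad (ltW p1) n0) WG; rewrite (Wgrad_Lnorm (ltW p1) n0 WG) -EFinM.
  by apply: morrey_seminorm_le => x y; rewrite mulrAC; exact: hC WG x y.
have lbS : lbound S C.
  move=> C' SC'; apply: minC => w H WH x y; have [->|xy] := eqVneq x y.
    by rewrite !subrr normr0 enorm0 powR0 ?mulr0 ?mul0r// gt_eqF.
  have := SC' _ (Wgrad_D1p (ltW p1) n0 WH); rewrite (Wgrad_Lnorm (ltW p1) n0 WH).
  move=> /(le_trans (morrey_seminorm_ge w xy)); rewrite -EFinM lee_fin.
  by rewrite ler_pdivrMr ?enorm_powR_gt0// mulrAC.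
apply/eqP; rewrite eq_le; apply/andP; split.
  by apply: ge_inf => //; exists C.
by apply: lb_le_inf => //; exists C.
Qed.

Lemma extremalP (C : R) u G x y : Wgrad p u G -> x != y -> morrey_const n p = C ->
  (forall x y, `|u x - u y| <= C * enorm (x - y) `^ al * pnorm p G) ->
  `|u x - u y| = C * enorm (x - y) `^ al * pnorm p G -> extremal p u.
Proof.
move=> WG xy CE hC eC; split; first exact: (Wgrad_D1p (ltW p1) n0 WG).
rewrite (Wgrad_Lnorm (ltW p1) n0 WG) CE -EFinM; apply/eqP; rewrite eq_le; apply/andP; split.
  by apply: morrey_seminorm_le => z t; rewrite mulrAC.
have := morrey_seminorm_ge u xy; rewrite eC mulrAC mulfK// gt_eqF//; exact: enorm_powR_gt0.
Qed.

(* [u] attains Morrey's inequality at the pair [x], [y], so its gradient norm [m] is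
   minimal among the functions having the same increment there, in particular
   with respect to the average of [u] and [v]; Clarkson's inequality applied to
   [u] and [v] gives the estimate. *)
Lemma clarkson_extremal (C : R) u v G H x y : 0 < C ->
  (forall w H, Wgrad p w H -> forall x y, `|w x - w y| <= C * enorm (x - y) `^ al * pnorm p H) ->
  Wgrad p u G -> Wgrad p v H -> x != y -> u x = v x -> u y = v y ->
  `|u x - u y| = C * enorm (x - y) `^ al * pnorm p G ->
  pnorm p G `^ clarkson_exp p + 2 * (2^-1 * pnorm p (fun x => G x - H x)) `^ clarkson_exp p <=
    pnorm p H `^ clarkson_exp p.
Proof.
move=> C0 hC WG WH xy ux uy eC; set s := clarkson_exp p.
have LG : Lp_field p G by case: WG.
have LH : Lp_field p H by case: WH.
have s0 : 0 < s by apply: lt_trans (clarkson_exp_gt1 p1).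
have Wm := WgradD (ltW p1) 2^-1 2^-1 WG WH.
set K := (fun z => _ *: _ + _) in Wm.
have mK : pnorm p G <= pnorm p K.
  have := hC _ _ Wm x y; rewrite -ux -uy.
  have -> : 2^-1 * u x + 2^-1 * u x - (2^-1 * u y + 2^-1 * u y) = u x - u y by field.
  by rewrite eC ler_pM2l// mulr_gt0// enorm_powR_gt0.
have := clarkson p1 np2 LG LH; rewrite -/s.
have -> : (fun z => 2^-1 *: (G z + H z)) = K by apply/funext => z; rewrite scalerDr.
rewrite (pnormZ (ltW p1) _ (Lp_fieldB (ltW p1) LG LH)) ger0_norm//.
have hGK : pnorm p G `^ s <= pnorm p K `^ s by apply: ge0_ler_powR mK; rewrite ?nnegrE ?pnorm_ge0// ltW.
exact: midpoint_gap hGK.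
Qed.

Let s := clarkson_exp p.
Let s0 : 0 < s. Proof. exact: lt_trans (clarkson_exp_gt1 p1). Qed.

(** Both conclusions of the theorem with the common exponent [clarkson_exp p]. The real number [T]
    records that the seminorm of [v] is finite; the last clause, with 1 in place of [morrey_const],
    is asked for in dimension one only. *)
Definition stable v H u G :=
  exists T : R, [/\ 0 <= T, morrey_seminorm p v = T%:E,
    (morrey_const n p / 2) `^ s * pnorm p (fun x => G x - H x) `^ s + T `^ s <=
      morrey_const n p `^ s * pnorm p H `^ s &
    n = 1%N -> (1 / 2) `^ s * pnorm p (fun x => G x - H x) `^ s + T `^ s <= pnorm p H `^ s].

Lemma pnormBxx H : pnorm p (fun x => H x - H x) = 0.
Proof.
by rewrite -[RHS](@pnorm0 R n p (ltW p1)); congr pnorm; apply/funext => x; rewrite subrr.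
Qed.

(** Treated apart because [morrey_constP] starts from a nonconstant function. All norms and
    seminorms vanish here, so [v] is its own extremal whatever [morrey_const] is. *)
Lemma stability_cst v H : Wgrad p v H -> (forall x y, v x = v y) -> extremal p v /\ stable v H v H.
Proof.
move=> WH vcst; have sn0 : s != 0 by rewrite gt_eqF.
have Wc : Wgrad p v (fun=> 0).
  rewrite (_ : v = fun=> v 0); last by apply/funext => x; exact: vcst.
  exact: (@Wgrad_cst R n p (ltW p1) (v 0)).
have Lv := Wgrad_Lnorm (ltW p1) n0 Wc; rewrite (@pnorm0 R n p (ltW p1)) in Lv.
have H0 : pnorm p H = 0 by have := Wgrad_Lnorm (ltW p1) n0 WH; rewrite Lv => -[<-].
have v0 : morrey_seminorm p v = 0%E.
  apply/eqP; rewrite eq_le; apply/andP; split.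
    by apply: morrey_seminorm_le => x y; rewrite (vcst x y) subrr normr0 mul0r.
  have e0 : (0 : 'rV[R]_n) != 'e_(Ordinal n0).
    by rewrite eq_sym -enorm_gt0 enorm_delta.
  by apply: le_trans (morrey_seminorm_ge v e0); rewrite lee_fin divr_ge0 ?powR_ge0.
split.
  split; first exact: (Wgrad_D1p (ltW p1) n0 Wc).
  by rewrite v0 Lv mule0.
by exists 0; rewrite pnormBxx H0 !powR0// !mulr0 addr0.
Qed.

(** The slack is measured after raising to the power [s], as the final estimate uses it. If no pair
    qualified, the supremum would be at most the s-th root of T^s - e, which is less than [T]. *)
Lemma near_maximal_pair v (T e : R) x1 y1 : x1 != y1 -> 0 <= T -> 0 < e ->
  morrey_seminorm p v = T%:E ->
  exists x y, x != y /\ T `^ s <= (`|v x - v y| / enorm (x - y) `^ al) `^ s + e.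
Proof.
move=> xy1 T0 e0 vT; apply: contrapT => h.
have {}h x y : x != y -> (`|v x - v y| / enorm (x - y) `^ al) `^ s <= T `^ s - e.
  move=> xy; rewrite lerBrDr leNgt; apply/negP => hl; apply: h.
  by exists x, y; split => //; exact: ltW.
have B0 : 0 <= T `^ s - e by apply: le_trans (h _ _ xy1); exact: powR_ge0.
have : (T%:E <= ((T `^ s - e) `^ s^-1)%:E)%E.
  rewrite -vT; apply: ge_ereal_sup => _ [x [y [xy ->]]]; rewrite lee_fin.
  apply: (ler_powR_inv s0); rewrite ?powR_ge0 ?divr_ge0 ?powR_ge0//.
  by rewrite -powRrM mulVf ?gt_eqF// powRr1// h.
rewrite lee_fin => hT.
have : T `^ s <= ((T `^ s - e) `^ s^-1) `^ s by apply: ge0_ler_powR hT; rewrite ?nnegrE ?powR_ge0// ltW.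
by rewrite -powRrM mulVf ?gt_eqF// powRr1// lerBrDr gerDl leNgt e0.
Qed.

Lemma morrey_const_le1 : n = 1%N -> forall w H, Wgrad p w H ->
  forall x y, `|w x - w y| <= 1 * enorm (x - y) `^ al * pnorm p H.
Proof.
move=> n1 w H WH x y; rewrite mul1r /al; move: w H WH x y np; rewrite n1 => w H WH x y p1'.
by rewrite mul1r; exact: (morrey1 p1' WH).
Qed.

Lemma stability v H : Wgrad p v H -> exists u G, [/\ Wgrad p u G, extremal p u & stable v H u G].
Proof.
move=> WH; have LH : Lp_field p H by case: WH.
have [vcst|] := pselect (forall x y, v x = v y).
  by have [ev sv] := stability_cst WH vcst; exists v, H.
move=> /existsNP[x1 /existsNP[y1 /eqP vxy1]].
have xy1 : x1 != y1 by apply: contra_neq vxy1 => ->.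
have [w' [H' [WH' w'0 w'e _]]] := Wgrad_unit_pair n0 np (Ordinal n0) WH xy1.
have [C [C0 hC minC exC]] : exists C : R, [/\ 0 < C,
    (forall w H, Wgrad p w H -> forall x y, `|w x - w y| <= C * enorm (x - y) `^ al * pnorm p H),
    (forall C' : R, (forall w H, Wgrad p w H -> forall x y, `|w x - w y| <= C' * enorm (x - y) `^ al * pnorm p H) ->
      C <= C') &
    forall x y (a b : R), x != y -> exists u G,
      [/\ Wgrad p u G, u x = a, u y = b & `|a - b| = C * enorm (x - y) `^ al * pnorm p G]].
  by apply: (morrey_constP np); exists w', H'; split => //; rewrite w'0 w'e.
have CE := morrey_constE C0 hC minC.
have C1 : n = 1%N -> C <= 1 by move=> n1; apply: minC; exact: morrey_const_le1.
set M := pnorm p H; have M0 : 0 <= M by exact: pnorm_ge0.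
have vle : (morrey_seminorm p v <= (C * M)%:E)%E.
  by apply: morrey_seminorm_le => x y; rewrite mulrAC; exact: hC WH x y.
have vge : (0 <= morrey_seminorm p v)%E.
  by apply: le_trans (morrey_seminorm_ge v xy1); rewrite lee_fin divr_ge0 ?powR_ge0.
pose T := fine (morrey_seminorm p v).
have vT : morrey_seminorm p v = T%:E.
  by rewrite /T fineK// ge0_fin_numE// (le_lt_trans vle) ?ltry.
have T0 : 0 <= T by rewrite fine_ge0.
have TM : T <= C * M by rewrite vT lee_fin in vle.
have mono a b : 0 <= a -> a <= b -> a `^ s <= b `^ s.
  by move=> a0 ab; apply: ge0_ler_powR; rewrite ?nnegrE ?(le_trans a0 ab)// ltW.
(* If [v] attains equality it is its own extremal, and the gradient distance is 0. *)
have [TE|/eqP TN] := pselect (T = C * M).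
  exists v, H; split => //.
    split; first exact: (Wgrad_D1p (ltW p1) n0 WH).
    by rewrite (Wgrad_Lnorm (ltW p1) n0 WH) CE -EFinM -TE.
  exists T; rewrite CE pnormBxx -/M; split => //.
    by rewrite powR0 ?gt_eqF// mulr0 add0r TE powRM// ltW.
  move=> n1; rewrite powR0 ?gt_eqF// mulr0 add0r; apply: mono => //.
  by rewrite TE ler_piMl// C1.
have {TN}TM' : T < C * M by rewrite lt_neqAle TN.
(* Whatever pair is chosen, the resulting [u] has gradient norm [m <= T / C], so by the triangle
   inequality [d] bounds |Du - Dv| from below. *)
pose d := M - T / C; have d0 : 0 < d by rewrite subr_gt0 ltr_pdivrMr// mulrC.
have C2 : 0 < C / 2 by rewrite divr_gt0.
(* The tolerance must be fixed before the pair is chosen: it is the value of the term (C/2)^s |Du -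
   Dv|^s at the lower bound [d] of the distance. *)
pose eps := (C / 2) `^ s * d `^ s.
have eps0 : 0 < eps by rewrite mulr_gt0// powR_gt0.
have [x [y [xy hxy]]] := near_maximal_pair xy1 T0 eps0 vT.
have [u [G [WG ux uy uE]]] := exC x y (v x) (v y) xy.
have LG : Lp_field p G by case: WG.
have r0 := enorm_powR_gt0 xy.
set m := pnorm p G in uE; have m0 : 0 <= m by exact: pnorm_ge0.
have tE : `|v x - v y| / enorm (x - y) `^ al = C * m by rewrite uE mulrAC mulfK// gt_eqF.
have tT : C * m <= T by have := morrey_seminorm_ge v xy; rewrite vT lee_fin tE.
rewrite tE in hxy.
have ceq := clarkson_extremal C0 hC WG WH xy ux uy.
rewrite ux uy in ceq; have {}ceq := ceq uE; rewrite -/m -/s -/M in ceq.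
exists u, G; split => //.
  apply: (extremalP WG xy CE (hC _ _ WG)); by rewrite ux uy.
exists T; rewrite CE -/M; set D := pnorm p (fun x => G x - H x) in ceq *.
have D0 : 0 <= D by exact: pnorm_ge0.
have dD : d <= D.
  have := pnormB_ge (ltW p1) LH LG; rewrite (pnormB_sym (ltW p1) LH LG) -/M -/m -/D.
  apply: le_trans; rewrite lerD2l lerN2 ler_pdivlMr// mulrC//.
have epsD : eps <= (C / 2) `^ s * D `^ s.
  by rewrite ler_wpM2l ?powR_ge0// mono// ltW.
have D2 : (C / 2) `^ s * D `^ s = C `^ s * (2^-1 * D) `^ s.
  by rewrite [C / 2]mulrC powRM ?(ltW C0)// [(2^-1 * D) `^ s]powRM// mulrCA mulrA.
split => //.
  apply: absorb_slack hxy epsD _.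
  by rewrite (powRM _ (ltW C0) m0) D2 [2 * _]mulrCA -mulrDr ler_wpM2l ?powR_ge0.
(* Here Clarkson's estimate is used without multiplying it by C^s; since [C <= 1], both (C m)^s and
   [eps] are bounded by their counterparts with [C] replaced by 1. *)
move=> n1; have {}C1 := C1 n1; have h1 : (C / 2) `^ s * D `^ s <= (1 / 2) `^ s * D `^ s.
  by rewrite ler_wpM2r ?powR_ge0// mono ?(ltW C2)// ler_wpM2r.
have h2 : (C * m) `^ s <= m `^ s by rewrite mono// ?mulr_ge0 ?(ltW C0)// ler_piMl.
have h3 : (2^-1 * D) `^ s = (1 / 2) `^ s * D `^ s by rewrite mul1r powRM.
rewrite h3 in ceq; apply: absorb_slack (le_trans epsD h1) ceq.
by apply: le_trans hxy _; rewrite lerD2r.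
Qed.

End stability.

Theorem corollary6p3 (R : realType) (n : nat) (p : R) (v : 'rV[R]_n -> R) :
  (0 < n)%N -> n%:R < p -> D1p p v ->
  exists u : 'rV[R]_n -> R, extremal p u /\
    (2 < p ->
      (((morrey_const n p / 2) `^ p)%:E *
          Lnorm_rV p (fun x => weak_grad u x - weak_grad v x)%R `^ p
        + morrey_seminorm p v `^ p
        <= (morrey_const n p `^ p)%:E * Lnorm_rV p (weak_grad v) `^ p)%E) /\
    (p <= 2 -> n = 1%N /\
      (((1 / 2) `^ (p / (p - 1)))%:E *
          Lnorm_rV p (fun x => weak_grad u x - weak_grad v x)%R `^ (p / (p - 1))
        + morrey_seminorm p v `^ (p / (p - 1))
        <= Lnorm_rV p (weak_grad v) `^ (p / (p - 1)))%E).
Proof.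
move=> n0 np Dv; have p1 : 1 < p by apply: le_lt_trans np; rewrite ler1n.
have WH := D1p_Wgrad (ltW p1) n0 Dv.
have [u [G [WG eu [T [T0 vT h1 h2]]]]] := stability n0 np WH.
exists u; split => //.
rewrite (Wgrad_LnormB (ltW p1) n0 WG WH) (Wgrad_Lnorm (ltW p1) n0 WH) vT !poweR_EFin -!EFinM -!EFinD !lee_fin.
split=> [p2|p2].
  by move: h1; rewrite /clarkson_exp (ltW p2).
have n1 : n = 1%N.
  case: (ltngtP n 1) => [|n2|//]; first by rewrite ltnS leqn0; case: n n0 {v Dv np WH u G WG eu T T0 vT h1 h2}.
  by have := lt_le_trans np p2; rewrite ltr_nat ltnNge n2.
split => //; have := h2 n1; rewrite /clarkson_exp; case: ifPn => // p2'.
(* At [p = 2] the exponent [clarkson_exp] takes its first branch, which coincides there with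
   p/(p-1). *)
have -> : p = 2 by apply/eqP; rewrite eq_le p2 p2'.
by rewrite (_ : 2 / (2 - 1) = 2 :> R); [|field].
Qed.
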